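(* For any $K>0$ there exist constants $C_1,C_2>0$ depending only on $K$ such that the following holds. Let $\mathbf{X}\in\mathbb{R}^p$ be a mean-zero, $K$-subgaussian random vector with covariance matrix $\boldsymbol{\Sigma}=\mathbb{E}(\mathbf{X}\mathbf{X}^T)\in\mathbb{R}^{p\times p}$, and let $\mathbf{X}_0,\dots,\mathbf{X}_n$ be i.i.d. copies of $\mathbf{X}$. For $1\le k\le n$ let $\boldsymbol{\Lambda}_k\in\mathbb{R}^{p\times p}$ be the diagonal matrix with diagonal entries $$(\boldsymbol{\Lambda}_k)_{ii}=C_1\log(k)^{1/2}\Big(\frac1k\sum_{j=0}^{k-1}(\mathbf{X}_j)_i^2\Big)^{1/2},\qquad i=1,\dots,p,$$ and let $\hat{\boldsymbol{\Sigma}}^{\mathrm{adap}}_n$ be the corresponding one-bit estimator with entry-wise adaptive dithering (defined in the context). Then for any $\theta\ge C_2\max\{\log(p),\log(n)\}$ we have with probability at least $1-4e^{-\theta}$ $$\|\hat{\boldsymbol{\Sigma}}^{\mathrm{adap}}_n-\boldsymbol{\Sigma}\|\lesssim_K\log(p)\log(n)\,\|\boldsymbol{\Sigma}\|\left(\theta^{5/2}\sqrt{\frac{\mathrm{r}(\boldsymbol{\Sigma})}{n}}+\theta^{7/2}\frac{\mathrm{r}(\boldsymbol{\Sigma})}{n}\right),$$ where $\mathrm{r}(\boldsymbol{\Sigma})=\mathrm{Tr}(\boldsymbol{\Sigma})/\|\boldsymbol{\Sigma}\|$ is the effective rank of $\boldsymbol{\Sigma}$.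
   Context: $a\lesssim_K b$ means $a\le C_K b$ for a constant $C_K>0$ depending only on $K$. A mean-zero random vector $\mathbf{X}$ in $\mathbb{R}^p$ is $K$-subgaussian if $\|\langle\mathbf{X},\mathbf{x}\rangle\|_{\psi_2}\le K(\mathbb{E}\langle\mathbf{X},\mathbf{x}\rangle^2)^{1/2}$ for all $\mathbf{x}\in\mathbb{R}^p$, where $\|X\|_{\psi_2}=\inf\{t>0:\mathbb{E}\exp(X^2/t^2)\le 2\}$. $\|\cdot\|$ is the operator norm with respect to the Euclidean norm. $\mathrm{sign}$ acts entry-wise, with $\mathrm{sign}(x)=1$ if $x\ge0$ and $-1$ if $x<0$. Dithers: $\boldsymbol{\tau}_1,\bar{\boldsymbol{\tau}}_1,\dots,\boldsymbol{\tau}_n,\bar{\boldsymbol{\tau}}_n$ are independent, uniformly distributed in $[-1,1]^p$, and independent of $\mathbf{X}_0,\dots,\mathbf{X}_n$. Estimator: $\hat{\boldsymbol{\Sigma}}^{\mathrm{adap}}_n=\frac12\hat{\boldsymbol{\Sigma}}'_n+\frac12(\hat{\boldsymbol{\Sigma}}'_n)^T$ with $$\hat{\boldsymbol{\Sigma}}'_n=\frac1n\sum_{k=1}^n\big(\boldsymbol{\Lambda}_k\,\mathrm{sign}(\mathbf{X}_k+\boldsymbol{\Lambda}_k\boldsymbol{\tau}_k)\big)\big(\boldsymbol{\Lambda}_k\,\mathrm{sign}(\mathbf{X}_k+\boldsymbol{\Lambda}_k\bar{\boldsymbol{\tau}}_k)\big)^T.$$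
   Formalization: The formal theorem assumes p ≥ 2 and n ≥ 2: for p = 1 or n = 1 the factor log(p)log(n) is 0 and the stated bound would force the estimator to equal Σ, which fails (for n = 1 the estimator is 0). *)

(* Defs.v *)
(* MathComp / MathComp-Analysis. *)
From HB Require Import structures.
From mathcomp Require Import all_boot all_order all_algebra.
From mathcomp Require Import all_classical all_reals all_analysis.

Set Implicit Arguments.
Unset Strict Implicit.
Unset Printing Implicit Defensive.

Import Order.TTheory GRing.Theory Num.Theory.
Import numFieldNormedType.Exports.

Local Open Scope classical_set_scope.
Local Open Scope ring_scope.

(* Random vectors are random variables valued in [p.-tuple R], on which the
   library puts the product of the Borel sigma-algebras; [colv] turns their
   values into column vectors. *)
Definition colv (R : realType) (p : nat) (x : p.-tuple R) : 'cV[R]_p :=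
  \col_i tnth x i.

Definition dotv (R : realType) (p : nat) (x y : 'cV[R]_p) : R :=
  \sum_(i < p) x i 0 * y i 0.

Definition enorm (R : realType) (p : nat) (x : 'cV[R]_p) : R :=
  Num.sqrt (dotv x x).

Definition opnorm (R : realType) (p : nat) (A : 'M[R]_p) : R :=
  sup [set enorm (A *m x) | x in [set x : 'cV[R]_p | enorm x <= 1]].

Definition effective_rank (R : realType) (p : nat) (A : 'M[R]_p) : R :=
  \tr A / opnorm A.

Definition sgn1 (R : realType) (x : R) : R := if 0 <= x then 1 else -1.

(* The infimum is taken in [\bar R], hence is [+oo] when no [t] is admissible. *)
Definition psi2norm d (T : measurableType d) (R : realType)
    (P : probability T R) (Y : T -> R) : \bar R :=
  ereal_inf [set t%:E | t in [set t : R | 0 < t /\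
    ('E_P[fun w => expR (Y w ^+ 2 / t ^+ 2)%R] <= 2%:E)%E]].

Definition mean_zero d (T : measurableType d) (R : realType)
    (P : probability T R) (p : nat) (X : T -> p.-tuple R) : Prop :=
  forall i : 'I_p, 'E_P[fun w => tnth (X w) i]%E = 0%E.

Definition square_integrable d (T : measurableType d) (R : realType)
    (P : probability T R) (p : nat) (X : T -> p.-tuple R) : Prop :=
  forall i : 'I_p, (fun w => tnth (X w) i) \in Lfun P 2%:E.

Definition subgaussian d (T : measurableType d) (R : realType)
    (P : probability T R) (K : R) (p : nat) (X : T -> p.-tuple R) : Prop :=
  forall x : 'cV[R]_p,
    (psi2norm P (fun w => dotv (colv (X w)) x) <=
     K%:E * sqrte 'E_P[fun w => (dotv (colv (X w)) x ^+ 2)%R])%E.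

(* E(X X^T), entrywise; the covariance matrix when X is centered. *)
Definition covmx d (T : measurableType d) (R : realType)
    (P : probability T R) (p : nat) (X : T -> p.-tuple R) : 'M[R]_p :=
  \matrix_(i, j) fine 'E_P[fun w => (colv (X w) *m (colv (X w))^T) i j]%E.

Definition same_law d (T : measurableType d) d' (T' : measurableType d')
    d1 (S : measurableType d1) (R : realType)
    (P : probability T R) (X : T -> S) (P' : probability T' R) (X' : T' -> S)
    : Prop :=
  forall B : set S, measurable B -> P (X @^-1` B) = P' (X' @^-1` B).

Definition mutually_independent d (T : measurableType d) d1
    (S : measurableType d1) (R : realType) (P : probability T R)
    (I : finType) (X : I -> T -> S) : Prop :=
  forall (J : {set I}) (B : I -> set S), (forall i, measurable (B i)) ->
    P (\bigcap_(i in [set` J]) (X i @^-1` B i)) =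
    (\prod_(i in J) P (X i @^-1` B i))%E.

Definition independent d (T : measurableType d) d1 (S1 : measurableType d1)
    d2 (S2 : measurableType d2) (R : realType) (P : probability T R)
    (X : T -> S1) (Y : T -> S2) : Prop :=
  forall (A : set S1) (B : set S2), measurable A -> measurable B ->
    P (X @^-1` A `&` Y @^-1` B) = (P (X @^-1` A) * P (Y @^-1` B))%E.

Fact ltrN11 (R : realType) : (-1 : R) < 1.
Proof. exact: gtrN. Qed.

(* The uniform law on [-1, 1]^p is the p-fold product of the uniform law on
   [-1, 1]; it is determined by its values on measurable boxes. *)
Definition uniform_cube d (T : measurableType d) (R : realType)
    (P : probability T R) (p : nat) (X : T -> p.-tuple R) : Prop :=
  forall B : 'I_p -> set R, (forall i, measurable (B i)) ->
    P [set w | forall i, B i (tnth (X w) i)] =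
    (\prod_(i < p) uniform_prob (@ltrN11 R) (B i))%E.

(* Samples are indexed by 0 <= j <= n.  The index 1 <= k <= n of the dithers
   and of Lambda is represented by [k : 'I_n] standing for [k.+1]: thus
   [X (lift ord0 k)] is the sample of index k + 1, and [Lambda c X k] involves the
   samples j = 0, ..., k. *)
Definition Lambda (R : realType) (n p : nat) (c : R)
    (X : 'I_n.+1 -> 'cV[R]_p) (k : 'I_n) : 'M[R]_p :=
  diag_mx (\row_i (c * Num.sqrt (ln k.+1%:R) *
    Num.sqrt (k.+1%:R^-1 * \sum_(j < n.+1 | (j < k.+1)%N) X j i 0 ^+ 2))).

Definition Sigma' (R : realType) (n p : nat) (c : R)
    (X : 'I_n.+1 -> 'cV[R]_p)
    (tau taub : 'I_n -> 'cV[R]_p) : 'M[R]_p :=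
  n%:R^-1 *: \sum_(k < n)
    (Lambda c X k *m
       map_mx (@sgn1 R) (X (lift ord0 k) + Lambda c X k *m tau k)) *m
    (Lambda c X k *m
       map_mx (@sgn1 R) (X (lift ord0 k) + Lambda c X k *m taub k))^T.

Definition Sigma_adap (R : realType) (n p : nat) (c : R)
    (X : 'I_n.+1 -> 'cV[R]_p)
    (tau taub : 'I_n -> 'cV[R]_p) : 'M[R]_p :=
  2^-1 *: Sigma' c X tau taub + 2^-1 *: (Sigma' c X tau taub)^T.

(* Main.v *)
(** Average over the dithers first.  Given the samples, the sign of
    [x + l * tau] scaled by [l] has mean [clip x l], so on the test vectors the
    error of the estimator splits into (i) the deviation of the empirical
    covariance, (ii) the effect of clipping and (iii) bilinear forms in centered
    independent bounded signs, which are subgaussian.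

    For (ii), the running second moment is at least half the variance once
    [k >= c * theta], and then [|X_k| > Lambda_k] has probability at most
    [2 / (k + 1) ^ 2]; the expected number of exceedances being bounded, there are
    [O(theta)] of them in each coordinate, each of squared size [O(theta)] times
    the variance.

    Uniformity over the ball comes from Maurey's empirical method rather than
    from chaining: a vector of norm at most 1/2 is the mean of a random average
    of [m] multiples of coordinate vectors taken from at most [p ^ 4] candidates,
    and such an average increases a nonnegative quadratic form [S] by at most
    [Tr S / m] in expectation.  With [m] of the order of the effective rank this
    excess is at most [|S|], while the union bound costs only [m * log p].

    Finally the bound holds for each fixed good sample with probability
    [1 - 3 exp (- theta)] over the dithers, and Fubini's theorem combines it with
    the probability [1 - exp (- theta)] of a good sample. *)
Require Import Defs.
From HB Require Import structures.
From mathcomp Require Import all_boot all_order all_algebra.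
From mathcomp Require Import all_classical all_reals all_analysis.
From mathcomp Require Import measurable_realfun.
From mathcomp Require Import ring lra.

Set Implicit Arguments.
Unset Strict Implicit.
Unset Printing Implicit Defensive.

Import Order.TTheory GRing.Theory Num.Theory.
Import numFieldNormedType.Exports.

Local Open Scope classical_set_scope.
Local Open Scope ring_scope.

(** * Maurey's empirical method *)

(** The scale [Lambda_k] is a function of earlier samples, so the summands of the estimator are
    dependent and concentration for sums of independent matrices does not apply directly. With all
    samples frozen, what remains random is a family of independent bits with explicit weights
    [up_prob], and a probability over the dithers is a finite weighted sum over sign patterns. The
    sample then has to satisfy only finitely many deterministic inequalities, collected in
    [good_sample].

    A product of two one-bit vectors is not linear in the bits, but it is linear in the second
    family once the first is fixed. Its variance then depends on the first family, whose noise
    matrix is therefore bounded in norm beforehand.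

    Maurey's method averages over random net points, so tail bounds at these points need thresholds
    linear in quadratic forms: sums [c1 * A + c2 * D] take the place of geometric means
    [sqrt (A * D)].

    The factor [2 * (K + 1)] in the scale is chosen so that a running moment of half the variance
    gives a squared scale of [2 * ln k * (K + 1) ^ 2] times the variance, a level whose exceedance
    probability is summable in [k]. *)

Lemma sum_prod_weights (R : realType) (I F : finType) (w h : I -> F -> R) :
  \sum_(f : {ffun I -> F}) (\prod_i w i (f i)) * (\prod_i h i (f i)) =
  \prod_i \sum_c w i c * h i c.
Proof.
by rewrite bigA_distr_bigA; apply: eq_bigr => f _; rewrite big_split.
Qed.

Lemma sum_prod_weights1 (R : realType) (I F : finType) (w : I -> F -> R) :
  (forall i, \sum_c w i c = 1) ->
  \sum_(f : {ffun I -> F}) \prod_i w i (f i) = 1.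
Proof. by move=> w1; rewrite -bigA_distr_bigA big1. Qed.

Lemma sum_prod_weights_marginal (R : realType) (m : nat) (F : finType)
    (w : F -> R) (u : F -> R) (l : 'I_m) :
  \sum_c w c = 1 ->
  \sum_(f : {ffun 'I_m -> F}) (\prod_i w (f i)) * u (f l) = \sum_c w c * u c.
Proof.
move=> w1; pose h i c := if i == l then u c else 1.
transitivity (\sum_(f : {ffun 'I_m -> F})
    (\prod_i w (f i)) * \prod_i h i (f i)).
  apply: eq_bigr => f _; congr (_ * _).
  rewrite (bigD1 l)//= /h eqxx big1 ?mulr1// => i /negbTE ->//.
rewrite (sum_prod_weights (fun=> w) h) (bigD1 l)//= /h eqxx.
rewrite [X in _ * X]big1 ?mulr1// => i /negbTE ->.
by under eq_bigr do rewrite mulr1.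
Qed.

Lemma sum_prod_weights_marginal2 (R : realType) (m : nat) (F : finType)
    (w : F -> R) (u v : F -> R) (l l' : 'I_m) :
  \sum_c w c = 1 -> l' != l ->
  \sum_(f : {ffun 'I_m -> F}) (\prod_i w (f i)) * (u (f l) * v (f l')) =
  (\sum_c w c * u c) * (\sum_c w c * v c).
Proof.
move=> w1 ll'; pose h i c := if i == l then u c else if i == l' then v c else 1.
transitivity (\sum_(f : {ffun 'I_m -> F})
    (\prod_i w (f i)) * \prod_i h i (f i)).
  apply: eq_bigr => f _; congr (_ * _).
  rewrite (bigD1 l)//= (bigD1 l')//= /h eqxx (negbTE ll') eqxx big1 ?mulr1//.
  by move=> i /andP[/negbTE -> /negbTE ->].
rewrite (sum_prod_weights (fun=> w) h) (bigD1 l)//= (bigD1 l')//= /h eqxx.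
rewrite (negbTE ll') eqxx [X in _ * (_ * X)]big1 ?mulr1//.
move=> i /andP[/negbTE -> /negbTE ->].
by under eq_bigr do rewrite mulr1.
Qed.

(* An atom [(b, j, c)] is the vector [(-1)^b p/c e_j]; it is zero for [c = 0]. *)
Definition atom (p : nat) : finType := (bool * 'I_p * 'I_p.+1)%type.

Definition atom_val (R : realType) (p : nat) (a : atom p) (i : 'I_p) : R :=
  if i == a.1.2 then (-1) ^+ a.1.1 * (a.2%:R / p%:R)^-1 else 0.

Definition atom_mean (R : realType) (p m : nat) (f : {ffun 'I_m -> atom p})
    (i : 'I_p) : R :=
  m%:R^-1 * \sum_(l < m) atom_val R (f l) i.

Definition bform (R : realType) (p q : nat) (M : 'I_p -> 'I_q -> R)
    (x : 'I_p -> R) (y : 'I_q -> R) : R := \sum_i \sum_j M i j * (x i * y j).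

(** Radius 1/2 instead of 1 leaves room for rounding the sampling weights up to the grid of step
    [1 / p]: the total weight stays at most 3/4. *)
Definition half_ball (R : realType) (p : nat) (x : 'I_p -> R) : Prop :=
  \sum_i x i ^+ 2 <= 4^-1.

(** Coordinate [i] is drawn with weight [|x i| * g i] and carries the value [sign / g i], where
    [g i] is [|x i|] rounded up to the grid. The mean is then exact, and the second moment is
    [|x i| / g i], at most 1 because the rounding is upwards. The remaining weight goes to the zero
    atom. *)
Lemma atom_weights (R : realType) (p : nat) (x : 'I_p -> R) :
  (0 < p)%N -> half_ball x ->
  exists w : atom p -> R, [/\ forall a, 0 <= w a, \sum_a w a = 1,
    forall i, \sum_a w a * atom_val R a i = x i &
    forall i, \sum_a w a * atom_val R a i ^+ 2 <= 1].
Proof.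
move=> p0 hx.
have p0R : (0 : R) < p%:R by rewrite ltr0n.
have hx1 i : `|x i| <= 2^-1.
  have : `|x i| ^+ 2 <= 4^-1.
    apply: le_trans hx; rewrite (bigD1 i)//= real_normK ?num_real// lerDl.
    by apply: sumr_ge0 => j _; rewrite sqr_ge0.
  have := normr_ge0 (x i); nra.
(* Truncation plus one keeps [g i] positive even where [x i] vanishes. *)
pose t i := (Num.truncn (`|x i| * p%:R)).+1.
have tp i : (t i < p.+1)%N.
  rewrite /t ltnS truncn_lt_nat ?mulr_ge0//; have := hx1 i; nra.
pose code i : atom p := (x i < 0, i, Ordinal (tp i)).
pose g i : R := (t i)%:R / p%:R.
have g0 i : 0 < g i by rewrite divr_gt0// ltr0n.
have xg i : `|x i| <= g i.
  rewrite ler_pdivlMr// ltW// /t.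
  by have /andP[] := truncn_itv (mulr_ge0 (normr_ge0 (x i)) (ltW p0R)).
have gx i : g i <= `|x i| + p%:R^-1.
  rewrite ler_pdivrMr// mulrDl mulVf ?gt_eqF// /t -natr1 lerD2r.
  by have /andP[] := truncn_itv (mulr_ge0 (normr_ge0 (x i)) (ltW p0R)).
pose i0 : 'I_p := Ordinal p0.
pose a0 : atom p := (false, i0, ord0).
pose r := 1 - \sum_j `|x j| * g j.
have r0 : 0 <= r.
  rewrite subr_ge0; apply: (@le_trans _ _ (\sum_j (x j ^+ 2 + 2^-1 * p%:R^-1))).
    apply: ler_sum => j _; rewrite -(real_normK (num_real (x j))).
    have := hx1 j; have := gx j; have := normr_ge0 (x j).
    have : 0 < (p%:R : R)^-1 by rewrite invr_gt0.
    nra.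
  rewrite big_split/= sumr_const card_ord -[X in _ + X]mulr_natr -mulrA mulVf ?gt_eqF//.
  move: hx; rewrite /half_ball; lra.
pose w a := \sum_j (`|x j| * g j) * (code j == a)%:R + r * (a0 == a)%:R.
have wE (G : atom p -> R) :
    \sum_a w a * G a = \sum_j (`|x j| * g j) * G (code j) + r * G a0.
  under eq_bigr do rewrite /w mulrDl mulr_suml.
  rewrite big_split/= exchange_big/=; congr (_ + _).
    apply: eq_bigr => j _; rewrite (bigD1 (code j))// eqxx mulr1 big1; first exact: addr0.
    by move=> a /andP[_ /negbTE aj]; rewrite eq_sym aj mulr0 mul0r.
  rewrite (bigD1 a0)// eqxx mulr1 big1; first exact: addr0.
  by move=> a /andP[_ /negbTE aj]; rewrite eq_sym aj mulr0 mul0r.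
have val0 i : atom_val R a0 i = 0.
  by rewrite /atom_val /=; case: ifP => //; rewrite mul0r invr0 mulr0.
have valc i j : atom_val R (code j) i =
    if i == j then (-1) ^+ (x j < 0)%R * (g j)^-1 else 0.
  by [].
exists w; split.
- move=> a; apply: addr_ge0; last by rewrite mulr_ge0.
  by apply: sumr_ge0 => j _; rewrite mulr_ge0// mulr_ge0// ltW.
- have := wE (fun=> 1); under eq_bigr do rewrite mulr1.
  by move=> ->; under eq_bigr do rewrite mulr1; rewrite mulr1 addrC subrK.
- move=> i; rewrite wE val0 mulr0 addr0 (bigD1 i)//= valc eqxx big1 ?addr0; last first.
    by move=> j ji; rewrite valc eq_sym (negbTE ji) mulr0.
  rewrite -mulrA [g i * _]mulrCA divff ?gt_eqF// mulr1 mulrC.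
  case: ltP => h; first by rewrite expr1 ltr0_norm// mulN1r opprK.
  by rewrite expr0 ger0_norm// mul1r.
- move=> i; rewrite wE val0 expr0n mulr0 addr0 (bigD1 i)//= valc eqxx big1 ?addr0; last first.
    by move=> j ji; rewrite valc eq_sym (negbTE ji) expr0n mulr0.
  rewrite exprMn sqrr_sign mul1r.
  rewrite (_ : _ * _ = `|x i| / g i); last by field; rewrite gt_eqF.
  by rewrite ler_pdivrMr// mul1r.
Qed.

Lemma card_atom (p : nat) : (1 < p)%N -> (#|atom p| <= p ^ 4)%N.
Proof.
move=> p1; rewrite !card_prod card_bool !card_ord.
have h : (2 * p <= p * p)%N by rewrite leq_mul2r p1 orbT.
rewrite !expnS expn0 muln1 mulnA leq_mul//.
by apply: leq_trans h; rewrite mul2n -addnn -addn1 leq_add2l ltnW.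
Qed.

Lemma atom_mean_expectation (R : realType) (p m : nat) (w : atom p -> R)
    (x : 'I_p -> R) (i : 'I_p) :
  (0 < m)%N -> \sum_a w a = 1 -> \sum_a w a * atom_val R a i = x i ->
  \sum_(f : {ffun 'I_m -> atom p}) (\prod_l w (f l)) * atom_mean R f i = x i.
Proof.
move=> m0 w1 wx; rewrite /atom_mean.
under eq_bigr do rewrite mulrCA mulr_sumr.
rewrite -mulr_sumr exchange_big/=.
under eq_bigr do rewrite (sum_prod_weights_marginal (fun a => atom_val R a i) _ w1) wx.
by rewrite sumr_const card_ord -[x i *+ _]mulr_natl mulKf// pnatr_eq0 -lt0n.
Qed.

(** Two distinct draws are independent and contribute [x i * x j]; a draw paired with itself sees
    only the diagonal of [A], because an atom has a single nonzero coordinate. Hence the excess is a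
    trace. *)
Lemma atom_mean_qform_expectation (R : realType) (p m : nat) (w : atom p -> R)
    (x : 'I_p -> R) (A : 'I_p -> 'I_p -> R) :
  (0 < m)%N -> (forall a, 0 <= w a) -> \sum_a w a = 1 ->
  (forall i, \sum_a w a * atom_val R a i = x i) ->
  (forall i, \sum_a w a * atom_val R a i ^+ 2 <= 1) ->
  0 <= bform A x x -> (forall i, 0 <= A i i) ->
  \sum_(f : {ffun 'I_m -> atom p})
    (\prod_l w (f l)) * bform A (atom_mean R f) (atom_mean R f) <=
  bform A x x + (\sum_i A i i) / m%:R.
Proof.
move=> m0 w0 w1 wx wv Ax A0.
have mR : (0 : R) < m%:R by rewrite ltr0n.
pose V i := \sum_a w a * atom_val R a i ^+ 2.
have E2 i j : \sum_(f : {ffun 'I_m -> atom p})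
    (\prod_l w (f l)) * (atom_mean R f i * atom_mean R f j) =
    (1 - m%:R^-1) * (x i * x j) + (if i == j then V i / m%:R else 0).
  transitivity (m%:R^-1 ^+ 2 * \sum_(l < m) \sum_(l' < m)
      \sum_(f : {ffun 'I_m -> atom p})
        (\prod_l w (f l)) * (atom_val R (f l) i * atom_val R (f l') j)).
    under [X in _ * X]eq_bigr do rewrite exchange_big/=.
    rewrite exchange_big/= mulr_sumr; apply: eq_bigr => f _.
    rewrite /atom_mean mulrACA -expr2 [LHS]mulrCA; congr (_ * _).
    rewrite mulr_suml mulr_sumr; apply: eq_bigr => l _.
    by rewrite mulr_sumr mulr_sumr; apply: eq_bigr => l' _.
  have El l : \sum_(l' < m) \sum_(f : {ffun 'I_m -> atom p})
        (\prod_l w (f l)) * (atom_val R (f l) i * atom_val R (f l') j) =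
      (m%:R - 1) * (x i * x j) + (if i == j then V i else 0).
    rewrite (bigD1 l)//= addrC; congr (_ + _).
      rewrite (eq_bigr (fun=> x i * x j)); last first.
        move=> l' ll'.
        by rewrite (sum_prod_weights_marginal2 (fun a => atom_val R a i) (fun a => atom_val R a j) w1 ll') !wx.
      rewrite sumr_const -[_ *+ #|_|]mulr_natl; congr (_ * _).
      have := cardC1 l; rewrite card_ord => h.
      rewrite (_ : #|_| = m.-1); last by rewrite -h; apply: eq_card => k; rewrite !inE.
      by rewrite -[in RHS](prednK m0) -natr1 addrK.
    rewrite (sum_prod_weights_marginal (fun a => atom_val R a i * atom_val R a j) l w1).
    have [<-|ij] := eqVneq i j; first by [].
    rewrite big1// => a _; rewrite /atom_val.
    case: eqP => [<-|_]; last by rewrite mul0r mulr0.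
    by rewrite eq_sym (negbTE ij) !mulr0.
  under eq_bigr do rewrite El.
  rewrite sumr_const card_ord -[_ *+ m]mulr_natl.
  by case: eqP => _; field; rewrite gt_eqF.
have -> : \sum_(f : {ffun 'I_m -> atom p})
    (\prod_l w (f l)) * bform A (atom_mean R f) (atom_mean R f) =
    (1 - m%:R^-1) * bform A x x + m%:R^-1 * \sum_i A i i * V i.
  transitivity (\sum_i \sum_j A i j *
      ((1 - m%:R^-1) * (x i * x j) + (if i == j then V i / m%:R else 0))).
    rewrite /bform; under eq_bigr do rewrite mulr_sumr.
    rewrite exchange_big/=; apply: eq_bigr => i _.
    under eq_bigr do rewrite mulr_sumr.
    rewrite exchange_big/=; apply: eq_bigr => j _.
    by rewrite -E2 mulr_sumr; apply: eq_bigr => f _; rewrite mulrCA.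
  rewrite /bform !mulr_sumr -big_split/=; apply: eq_bigr => i _.
  under eq_bigr do rewrite mulrDr.
  rewrite big_split/= mulr_sumr; congr (_ + _).
    by apply: eq_bigr => j _; rewrite mulrCA.
  rewrite (bigD1 i)//= eqxx big1 ?addr0 => [|j /negbTE ji]; first by rewrite mulrA mulrC.
  by rewrite eq_sym ji mulr0.
rewrite lerD//.
  by rewrite ler_piMl// gerDl oppr_le0 invr_ge0 ltW.
rewrite [leLHS]mulrC ler_wpM2r ?invr_ge0 ?(ltW mR)//; apply: ler_sum => i _.
by rewrite ler_piMr//; exact: wv.
Qed.

(* Maurey's empirical method: a point of the half ball is the mean of a random
   [atom_mean], whose quadratic forms exceed those of the point by at most the
   trace divided by the number of samples. *)
Lemma bform_le_of_atom_mean (R : realType) (p q m1 m2 : nat)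
    (M : 'I_p -> 'I_q -> R) (A : 'I_p -> 'I_p -> R) (B : 'I_q -> 'I_q -> R)
    (c1 c2 : R) :
  (0 < p)%N -> (0 < q)%N -> (0 < m1)%N -> (0 < m2)%N -> 0 <= c1 -> 0 <= c2 ->
  (forall x, 0 <= bform A x x) -> (forall i, 0 <= A i i) ->
  (forall y, 0 <= bform B y y) -> (forall i, 0 <= B i i) ->
  (forall (f : {ffun 'I_m1 -> atom p}) (g : {ffun 'I_m2 -> atom q}),
     bform M (atom_mean R f) (atom_mean R g) <=
     c1 * bform A (atom_mean R f) (atom_mean R f) +
     c2 * bform B (atom_mean R g) (atom_mean R g)) ->
  forall x y, half_ball x -> half_ball y ->
  bform M x y <= c1 * (bform A x x + (\sum_i A i i) / m1%:R) +
                 c2 * (bform B y y + (\sum_i B i i) / m2%:R).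
Proof.
move=> p0 q0 m10 m20 c10 c20 A0 Ai B0 Bi H x y hx hy.
have [w [w0 w1 wx wv]] := atom_weights p0 hx.
have [u [u0 u1 ux uv]] := atom_weights q0 hy.
pose W (f : {ffun 'I_m1 -> atom p}) := \prod_l w (f l).
pose U (g : {ffun 'I_m2 -> atom q}) := \prod_l u (g l).
have W0 f : 0 <= W f by apply: prodr_ge0.
have U0 g : 0 <= U g by apply: prodr_ge0.
have W1 : \sum_f W f = 1 by exact: (sum_prod_weights1 (fun=> w1)).
have U1 : \sum_g U g = 1 by exact: (sum_prod_weights1 (fun=> u1)).
have -> : bform M x y = \sum_f \sum_g W f * U g *
    bform M (atom_mean R f) (atom_mean R g).
  transitivity (\sum_i \sum_j M i j *
     ((\sum_f W f * atom_mean R f i) * (\sum_g U g * atom_mean R g j))).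
    apply: eq_bigr => i _; apply: eq_bigr => j _.
    by rewrite (atom_mean_expectation m10 w1 (wx i)) (atom_mean_expectation m20 u1 (ux j)).
  rewrite /bform.
  under [RHS]eq_bigr do under eq_bigr do rewrite mulr_sumr.
  under [RHS]eq_bigr do rewrite exchange_big/=.
  rewrite [RHS]exchange_big/=; apply: eq_bigr => i _.
  under [RHS]eq_bigr do under eq_bigr do rewrite mulr_sumr.
  under [RHS]eq_bigr do rewrite exchange_big/=.
  rewrite [RHS]exchange_big/=; apply: eq_bigr => j _.
  rewrite mulr_suml mulr_sumr; apply: eq_bigr => f _.
  rewrite !mulr_sumr; apply: eq_bigr => g _.
  ring.
apply: (@le_trans _ _ (\sum_f \sum_g W f * U g *
    (c1 * bform A (atom_mean R f) (atom_mean R f) +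
     c2 * bform B (atom_mean R g) (atom_mean R g)))).
  by apply: ler_sum => f _; apply: ler_sum => g _; rewrite ler_wpM2l ?mulr_ge0.
have -> : \sum_f \sum_g W f * U g *
    (c1 * bform A (atom_mean R f) (atom_mean R f) +
     c2 * bform B (atom_mean R g) (atom_mean R g)) =
    c1 * (\sum_f W f * bform A (atom_mean R f) (atom_mean R f)) +
    c2 * (\sum_g U g * bform B (atom_mean R g) (atom_mean R g)).
  transitivity (\sum_f (c1 * (W f * bform A (atom_mean R f) (atom_mean R f)) * \sum_g U g +
      W f * (c2 * \sum_g U g * bform B (atom_mean R g) (atom_mean R g)))).
    apply: eq_bigr => f _; move: (bform A _ _) => a.
    rewrite !mulr_sumr -big_split/=; apply: eq_bigr => g _.
    ring.
  rewrite big_split/= -mulr_suml -mulr_suml W1 U1 mul1r mulr1.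
  by congr (_ + _); rewrite [RHS]mulr_sumr.
rewrite lerD// ler_wpM2l//; first exact: (atom_mean_qform_expectation m10 w0 w1 wx wv).
exact: (atom_mean_qform_expectation m20 u0 u1 ux uv).
Qed.

(** * Sign noise *)

(** Since [exp y * exp (- y / 2) ^ 2 = 1] and [exp (- y / 2) >= 1 - y / 2], the claim reduces to the
    polynomial inequality [(1 + y + 2 y ^ 2) (1 - y / 2) ^ 2 >= 1], whose difference factors. *)
Lemma expR_le_quadratic (R : realType) (y : R) :
  y <= 1 -> expR y <= 1 + y + 2 * y ^+ 2.
Proof.
move=> y1.
have h : expR y * (expR (- (y / 2)) * expR (- (y / 2))) = 1.
  by rewrite -!expRD -[RHS]expR0; congr expR; lra.
have h1 := expR_ge1Dx (- (y / 2)).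
have h2 := expR_gt0 y.
move: (expR y) (expR (- (y / 2))) h h1 h2 => v u h h1 h2.
have h3 : (1 - y / 2) ^+ 2 <= u * u by nra.
have h4 : v * (1 - y / 2) ^+ 2 <= 1 by rewrite -[leRHS]h ler_wpM2l// ltW.
have h5 : 1 <= (1 + y + 2 * y ^+ 2) * (1 - y / 2) ^+ 2.
  rewrite -subr_ge0.
  rewrite (_ : _ - 1 = y ^+ 2 * (2^-1 * ((1 - y) * (5/2 - y)))); last by field.
  by rewrite mulr_ge0 ?sqr_ge0// mulr_ge0// mulr_ge0//; lra.
have h6 : 0 < (1 - y / 2) ^+ 2 by rewrite exprn_gt0//; lra.
by rewrite -(ler_pM2r h6); exact: le_trans h5.
Qed.

(** The linear term stays outside the exponential so that it vanishes exactly when averaged against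
    centered noise. *)
Lemma expR_le_addr_expR_sqr (R : realType) (y : R) :
  expR y <= y + expR (2 * y ^+ 2).
Proof.
have [y1|y1] := leP y 1.
  apply: le_trans (expR_le_quadratic y1) _.
  have := expR_ge1Dx (2 * y ^+ 2); lra.
apply: (@le_trans _ _ (expR (2 * y ^+ 2))); last by rewrite lerDr; lra.
by rewrite ler_expR; nra.
Qed.

(** The bilinear form of [\sum_k a_k g_k^T]. The vectors [a_k] have a dimension [q] of their own
    because three choices occur: the identity matrix of size [n], the clipped samples, and the
    one-bit vectors of the first dither. *)
Definition noise_form (R : realType) (n p q : nat)
    (g : 'I_n * 'I_p -> bool -> R) (a : 'I_n -> 'I_q -> R)
    (s : {ffun 'I_n * 'I_p -> bool}) (x : 'I_q -> R) (y : 'I_p -> R) : R :=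
  \sum_k (\sum_j a k j * x j) * (\sum_i g (k, i) (s (k, i)) * y i).

Lemma noise_mgf (R : realType) (n p q : nat)
    (w g : 'I_n * 'I_p -> bool -> R) (a : 'I_n -> 'I_q -> R) (v : 'I_p -> R)
    (G l : R) (x : 'I_q -> R) (y : 'I_p -> R) :
  (forall c b, 0 <= w c b) -> (forall c, \sum_b w c b = 1) ->
  (forall c, \sum_b w c b * g c b = 0) ->
  (forall c b, g c b ^+ 2 <= G * v c.2) ->
  \sum_(s : {ffun 'I_n * 'I_p -> bool})
    (\prod_c w c (s c)) * expR (l * noise_form g a s x y) <=
  expR (2 * l ^+ 2 * G * (\sum_k (\sum_j a k j * x j) ^+ 2) *
        (\sum_i v i * y i ^+ 2)).
Proof.
move=> w0 w1 wg gv.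
pose al k := \sum_j a k j * x j.
have E s : expR (l * noise_form g a s x y) =
    \prod_c expR (l * (al c.1 * y c.2) * g c (s c)).
  rewrite -expR_sum; congr expR.
  rewrite /noise_form mulr_sumr.
  transitivity (\sum_k \sum_i l * (al k * y i) * g (k, i) (s (k, i))); last first.
    by rewrite pair_bigA; apply: eq_bigr => -[].
  apply: eq_bigr => k _; rewrite mulr_sumr mulr_sumr; apply: eq_bigr => i _.
  by rewrite -/(al k); ring.
under eq_bigr do rewrite E.
rewrite (sum_prod_weights w (fun c b => expR (l * (al c.1 * y c.2) * g c b))).
have -> : 2 * l ^+ 2 * G * (\sum_k al k ^+ 2) * (\sum_i v i * y i ^+ 2) =
    \sum_(c : 'I_n * 'I_p) 2 * (l * (al c.1 * y c.2)) ^+ 2 * (G * v c.2).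
  transitivity (\sum_k \sum_i 2 * (l * (al k * y i)) ^+ 2 * (G * v i)); last first.
    by rewrite pair_bigA; apply: eq_bigr => -[].
  rewrite -mulrA big_distrlr/= mulr_sumr; apply: eq_bigr => k _.
  by rewrite mulr_sumr; apply: eq_bigr => i _; ring.
rewrite expR_sum; apply: ler_prod => c _; apply/andP; split.
  by apply: sumr_ge0 => b _; rewrite mulr_ge0// expR_ge0.
set u := l * _.
apply: (@le_trans _ _ (\sum_b (u * (w c b * g c b) +
                               w c b * expR (2 * u ^+ 2 * (G * v c.2))))).
  apply: ler_sum => b _.
  rewrite (_ : u * (w c b * g c b) = w c b * (u * g c b)); last by ring.
  rewrite -mulrDr ler_wpM2l//; apply: le_trans (expR_le_addr_expR_sqr _) _.
  by rewrite lerD2l ler_expR exprMn -mulrA ler_wpM2l// ler_wpM2l// sqr_ge0.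
by rewrite big_split/= -mulr_sumr wg mulr0 add0r -mulr_suml w1 mul1r.
Qed.

(** Chernoff's bound has exponent [r ^ 2 / (8 G A D)], and [r = c1 A + c2 D] satisfies
    [r ^ 2 >= 4 c1 c2 A D] by the arithmetic-geometric inequality, which leaves
    [c1 c2 / (2 G) = t]. *)
Lemma noise_tail (R : realType) (n p q : nat)
    (w g : 'I_n * 'I_p -> bool -> R) (a : 'I_n -> 'I_q -> R) (v : 'I_p -> R)
    (G t c1 c2 : R) (x : 'I_q -> R) (y : 'I_p -> R) :
  (forall c b, 0 <= w c b) -> (forall c, \sum_b w c b = 1) ->
  (forall c, \sum_b w c b * g c b = 0) ->
  (forall c b, g c b ^+ 2 <= G * v c.2) -> (forall i, 0 <= v i) ->
  0 < G -> 0 <= c1 -> 0 <= c2 -> c1 * c2 = 2 * G * t ->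
  \sum_(s | c1 * (\sum_k (\sum_j a k j * x j) ^+ 2) +
            c2 * (\sum_i v i * y i ^+ 2) < noise_form g a s x y)
    \prod_c w c (s c) <= expR (- t).
Proof.
move=> w0 w1 wg gv v0 G0 c10 c20 cE.
set al := fun k => \sum_j a k j * x j.
set A := \sum_k al k ^+ 2; set D := \sum_i v i * y i ^+ 2.
set r := c1 * A + c2 * D.
have A0 : 0 <= A by apply: sumr_ge0 => k _; rewrite sqr_ge0.
have D0 : 0 <= D by apply: sumr_ge0 => k _; rewrite mulr_ge0 ?sqr_ge0.
have r0 : 0 <= r by rewrite addr_ge0// mulr_ge0.
(* When [A * D] vanishes the form is zero for every pattern: either all [al k] are zero, or [gv]
   forces each [g * y i] to be zero. *)
have [AD|AD] := eqVneq (A * D) 0.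
  rewrite big1 ?expR_ge0// => s; suff -> : noise_form g a s x y = 0 by rewrite ltNge r0.
  move/eqP: AD; rewrite mulf_eq0 => /orP[]/eqP h.
    rewrite /noise_form big1// => k _.
    have /eqP : al k ^+ 2 = 0.
      exact: (psumr_eq0P (fun k _ => sqr_ge0 (al k)) h).
    by rewrite sqrf_eq0 => /eqP; rewrite /al => ->; rewrite mul0r.
  rewrite /noise_form big1// => k _; rewrite [X in _ * X]big1 ?mulr0// => i _.
  have hi : v i * y i ^+ 2 = 0.
    by apply: (psumr_eq0P _ h) => // j _; rewrite mulr_ge0 ?sqr_ge0.
  apply/eqP; rewrite -sqrf_eq0 eq_le sqr_ge0 andbT exprMn.
  apply: (@le_trans _ _ (G * v i * y i ^+ 2)).
    by rewrite ler_wpM2r ?sqr_ge0//; exact: (gv (k, i)).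
  by rewrite -mulrA hi mulr0.
have AD0 : 0 < A * D by rewrite lt_def AD mulr_ge0.
(* The minimiser of [- l r + 2 l ^ 2 G A D]. *)
set l := r / (4 * G * (A * D)).
have l0 : 0 <= l by rewrite divr_ge0// ltW// mulr_gt0// mulr_gt0.
apply: (@le_trans _ _ (expR (- (l * r)) *
   \sum_(s : {ffun 'I_n * 'I_p -> bool})
    (\prod_c w c (s c)) * expR (l * noise_form g a s x y))).
  rewrite mulr_sumr [leRHS](bigID (fun s => r < noise_form g a s x y))/=.
  rewrite -[leLHS]addr0 lerD//; last first.
    apply: sumr_ge0 => s _; rewrite mulr_ge0 ?expR_ge0// mulr_ge0 ?expR_ge0//.
    exact: prodr_ge0.
  apply: ler_sum => s rs.
  rewrite mulrCA -expRD ler_peMr ?prodr_ge0//.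
  by rewrite -expR0 ler_expR addrC subr_ge0 ler_wpM2l// ltW.
apply: (@le_trans _ _ (expR (- (l * r)) * expR (2 * l ^+ 2 * G * A * D))).
  by rewrite ler_wpM2l ?expR_ge0//; exact: noise_mgf.
rewrite -expRD ler_expR.
rewrite (_ : _ + _ = - (r ^+ 2 / (8 * G * (A * D)))); last first.
  move: (AD); rewrite mulf_eq0 negb_or => /andP[An Dn].
  by rewrite /l; field; rewrite An Dn gt_eqF.
have den0 : 0 < 8 * G * (A * D) by rewrite mulr_gt0// mulr_gt0.
rewrite lerN2 ler_pdivlMr//.
rewrite (_ : t * _ = 4 * (2 * G * t) * (A * D)); last by ring.
rewrite -cE /r.
have := sqr_ge0 (c1 * A - c2 * D); nra.
Qed.

Lemma noise_formE (R : realType) (n p q : nat)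
    (g : 'I_n * 'I_p -> bool -> R) (a : 'I_n -> 'I_q -> R)
    (s : {ffun 'I_n * 'I_p -> bool}) (x : 'I_q -> R) (y : 'I_p -> R) :
  noise_form g a s x y =
  bform (fun j i => \sum_k a k j * g (k, i) (s (k, i))) x y.
Proof.
rewrite /noise_form /bform.
under eq_bigr do rewrite mulr_suml.
rewrite exchange_big/=; apply: eq_bigr => j _.
under eq_bigr do rewrite mulr_sumr.
rewrite exchange_big/=; apply: eq_bigr => i _.
rewrite mulr_suml; apply: eq_bigr => k _; ring.
Qed.

Lemma sum_sqr_bform (R : realType) (n q : nat) (a : 'I_n -> 'I_q -> R)
    (x : 'I_q -> R) :
  \sum_k (\sum_j a k j * x j) ^+ 2 = bform (fun i j => \sum_k a k i * a k j) x x.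
Proof.
rewrite /bform; under [RHS]eq_bigr do under eq_bigr do rewrite mulr_suml.
under [RHS]eq_bigr do rewrite exchange_big/=.
rewrite [RHS]exchange_big/=; apply: eq_bigr => k _.
rewrite expr2 mulr_suml; apply: eq_bigr => i _; rewrite mulr_sumr.
by apply: eq_bigr => j _; ring.
Qed.

Lemma sum_diag_bform (R : realType) (p : nat) (v y : 'I_p -> R) :
  \sum_i v i * y i ^+ 2 = bform (fun i j => if i == j then v i else 0) y y.
Proof.
apply: eq_bigr => i _; rewrite (bigD1 i)//= eqxx big1 ?addr0// => j /negbTE ji.
by rewrite eq_sym ji mul0r.
Qed.

(** The tail is applied at every pair of net points, which are counted by [q ^ (4 m1) * p ^ (4 m2)],
    and Maurey's method carries the bound over to the half balls. *)
Lemma noise_form_tail (R : realType) (n p q m1 m2 : nat)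
    (w g : 'I_n * 'I_p -> bool -> R) (a : 'I_n -> 'I_q -> R) (v : 'I_p -> R)
    (G t a' d' : R) :
  (1 < p)%N -> (1 < q)%N -> (0 < m1)%N -> (0 < m2)%N ->
  (forall c b, 0 <= w c b) -> (forall c, \sum_b w c b = 1) ->
  (forall c, \sum_b w c b * g c b = 0) ->
  (forall c b, g c b ^+ 2 <= G * v c.2) -> (forall i, 0 <= v i) ->
  0 < G -> 0 <= t -> 0 < a' -> 0 < d' ->
  (forall x, half_ball x -> \sum_k (\sum_j a k j * x j) ^+ 2 +
     (\sum_k \sum_j a k j ^+ 2) / m1%:R <= a') ->
  (forall y, half_ball y -> \sum_i v i * y i ^+ 2 + (\sum_i v i) / m2%:R <= d') ->
  \sum_(s : {ffun 'I_n * 'I_p -> bool} |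
     ~~ `[< forall x y, half_ball x -> half_ball y ->
         noise_form g a s x y <= 2 * Num.sqrt (2 * G * t * (a' * d')) >])
    \prod_c w c (s c) <=
  (q%:R ^+ 4) ^+ m1 * (p%:R ^+ 4) ^+ m2 * expR (- t).
Proof.
move=> p1 q1 m10 m20 w0 w1 wg gv v0 G0 t0 a0 d0 ha hd.
(* These weights equalise [c1 * a'] and [c2 * d'], which minimises their sum for the prescribed
   product [c1 * c2]. *)
pose c1 := Num.sqrt (2 * G * t * (d' / a')).
pose c2 := Num.sqrt (2 * G * t * (a' / d')).
have Gt0 : 0 <= 2 * G * t by rewrite mulr_ge0// mulr_ge0// ltW.
have c1a : c1 * a' = Num.sqrt (2 * G * t * (a' * d')).
  rewrite -{1}(ger0_norm (ltW a0)) -sqrtr_sqr -sqrtrM; last first.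
    by rewrite mulr_ge0// divr_ge0// ltW.
  by congr Num.sqrt; field; rewrite gt_eqF.
have c2d : c2 * d' = Num.sqrt (2 * G * t * (a' * d')).
  rewrite -{1}(ger0_norm (ltW d0)) -sqrtr_sqr -sqrtrM; last first.
    by rewrite mulr_ge0// divr_ge0// ltW.
  by congr Num.sqrt; field; rewrite gt_eqF.
have cE : c1 * c2 = 2 * G * t.
  have h : c1 * a' * (c2 * d') = 2 * G * t * (a' * d').
    by rewrite c1a c2d -expr2 sqr_sqrtr// mulr_ge0// mulr_ge0// ltW.
  have ne : a' * d' != 0 by rewrite gt_eqF ?mulr_gt0.
  by apply: (mulIf ne); rewrite /= -h mulrACA.
pose M s j i := \sum_k a k j * g (k, i) (s (k, i)).
pose A i j := \sum_k a k i * a k j.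
pose D i j := if i == j then v i else 0.
pose bad (s : {ffun 'I_n * 'I_p -> bool}) (f : {ffun 'I_m1 -> atom q})
    (h : {ffun 'I_m2 -> atom p}) :=
  c1 * (\sum_k (\sum_j a k j * atom_mean R f j) ^+ 2) +
  c2 * (\sum_i v i * atom_mean R h i ^+ 2) <
  noise_form g a s (atom_mean R f) (atom_mean R h).
have badP s : ~~ `[< forall x y, half_ball x -> half_ball y ->
    noise_form g a s x y <= 2 * Num.sqrt (2 * G * t * (a' * d')) >] ->
    [exists f, exists h, bad s f h].
  apply: contraNT; rewrite negb_exists => /forallP nb; apply/asboolP => x y hx hy.
  rewrite noise_formE.
  have := @bform_le_of_atom_mean R q p m1 m2 (M s) A D c1 c2 (ltnW q1) (ltnW p1)
    m10 m20 (sqrtr_ge0 _) (sqrtr_ge0 _).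
  move=> /(_ _ _ _ _ _ x y hx hy) => h.
  apply: le_trans (h _ _ _ _ _) _.
  - by move=> z; rewrite -sum_sqr_bform; apply: sumr_ge0 => k _; rewrite sqr_ge0.
  - by move=> i; apply: sumr_ge0 => k _; rewrite -expr2 sqr_ge0.
  - move=> z; rewrite -sum_diag_bform.
    by apply: sumr_ge0 => k _; rewrite mulr_ge0 ?sqr_ge0.
  - by move=> i; rewrite /D eqxx.
  - move=> f f'; have := nb f; rewrite negb_exists => /forallP/(_ f').
    by rewrite -leNgt -sum_sqr_bform -sum_diag_bform -noise_formE.
  rewrite -sum_sqr_bform -sum_diag_bform.
  have -> : \sum_i D i i = \sum_i v i by apply: eq_bigr => i _; rewrite /D eqxx.
  rewrite mulr_natl mulr2n -{1}c1a -c2d lerD// ler_wpM2l ?sqrtr_ge0//.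
    rewrite (_ : \sum_i A i i = \sum_k \sum_j a k j ^+ 2); last by rewrite exchange_big.
    exact: ha.
  exact: hd.
apply: (@le_trans _ _ (\sum_(f : {ffun 'I_m1 -> atom q})
    \sum_(h : {ffun 'I_m2 -> atom p})
    \sum_(s | bad s f h) \prod_c w c (s c))).
  apply: (@le_trans _ _ (\sum_(s : {ffun 'I_n * 'I_p -> bool})
      \sum_(f : {ffun 'I_m1 -> atom q}) \sum_(h : {ffun 'I_m2 -> atom p})
      if bad s f h then \prod_c w c (s c) else 0)).
    rewrite big_mkcond/=; apply: ler_sum => s _.
    have W0 : 0 <= \prod_c w c (s c) by apply: prodr_ge0.
    case: ifP => [/badP/existsP[f /existsP[h bfh]]|_]; last first.
      by apply: sumr_ge0 => f _; apply: sumr_ge0 => h _; case: ifP.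
    rewrite (bigD1 f)//= (bigD1 h)//= bfh -addrA lerDl addr_ge0//.
      by apply: sumr_ge0 => h' _; case: ifP.
    by apply: sumr_ge0 => f' _; apply: sumr_ge0 => h' _; case: ifP.
  rewrite exchange_big/=; apply: ler_sum => f _.
  rewrite exchange_big/=; apply: ler_sum => h _.
  by rewrite -big_mkcond.
apply: (@le_trans _ _ (\sum_(f : {ffun 'I_m1 -> atom q})
    \sum_(h : {ffun 'I_m2 -> atom p}) expR (- t))).
  apply: ler_sum => f _; apply: ler_sum => h _.
  by apply: (noise_tail a _ _ w0 w1 wg gv v0 G0 _ _ cE); rewrite sqrtr_ge0.
rewrite !sumr_const !cardT -!cardE !card_ffun !card_ord -mulrnA -[expR _ *+ _]mulr_natl.
rewrite ler_wpM2r ?expR_ge0// natrM mulrC -!natrX ler_pM ?ler0n// ler_nat.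
  by rewrite leq_exp2r// card_atom.
by rewrite leq_exp2r// card_atom.
Qed.

(** * Expectation of independent products *)

Import HBNNSimple.

(** The factorisation is given on indicators; linearity extends it to simple functions and monotone
    convergence to nonnegative measurable ones. [H] stands for the product of the other factors. *)
Lemma integral_mul_comp_of_indic d (T : measurableType d) d1
    (S : measurableType d1) (R : realType) (P : probability T R)
    (H : T -> R) (Y : T -> S) (c : R) :
  measurable_fun setT H -> (forall w, 0 <= H w) -> measurable_fun setT Y ->
  0 <= c ->
  (forall B, measurable B ->
    (\int[P]_w (H w * \1_B (Y w))%:E = c%:E * P (Y @^-1` B))%E) ->
  forall h : S -> R, measurable_fun setT h -> (forall s, 0 <= h s) ->
  (\int[P]_w (H w * h (Y w))%:E = c%:E * \int[P]_w (h (Y w))%:E)%E.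
Proof.
move=> mH H0 mY c0 HB h mh h0.
have mh' : measurable_fun setT (EFin \o h) by exact/measurable_EFinP.
pose g := nnsfun_approx measurableT mh'.
have g_cvg s : (fun n => (g n s)%:E) @ \oo --> (h s)%:E.
  by have /= := @cvg_nnsfun_approx _ _ _ _ measurableT _ mh' (fun x _ => h0 x) s Logic.I.
have g_nd s : nondecreasing_seq (fun n => g n s).
  by move=> m n mn; exact/lefP/nd_nnsfun_approx.
have mgY n : measurable_fun setT (fun w => g n (Y w)) by exact: measurableT_comp.
have simple n : (\int[P]_w (H w * g n (Y w))%:E = c%:E * \int[P]_w (g n (Y w))%:E)%E.
  have mB y : measurable (g n @^-1` [set y]) by [].
  have mBY y : measurable (Y @^-1` (g n @^-1` [set y])).
    by rewrite -[X in measurable X]setTI; exact: mY.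
  have mI y : measurable_fun setT (fun w => \1_(g n @^-1` [set y]) (Y w) : R).
    by apply: measurableT_comp => //; exact: measurable_indic.
  transitivity (\int[P]_w \sum_(y \in range (g n)) (y * (H w * \1_(g n @^-1` [set y]) (Y w)))%:E)%E.
    apply: eq_integral => w _; rewrite fimfunE fsumEFin//; congr _%:E.
    by rewrite mulr_fsumr; apply: eq_fsbigr => y _; rewrite mulrCA.
  rewrite ge0_integral_fsum//; last 2 first.
  - by move=> y; apply/measurable_EFinP; do 2 apply: measurable_funM => //.
  - move=> y w _; rewrite lee_fin mulrCA mulr_ge0//.
    by have := nnfun_muleindic_ge0 (g n) y (Y w); rewrite lee_fin.
  transitivity (\sum_(y \in range (g n)) (c%:E * (y%:E * P (Y @^-1` (g n @^-1` [set y])))))%E.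
    apply: eq_fsbigr => y /[!inE] -[s _ <-].
    under eq_integral do rewrite EFinM.
    rewrite ge0_integralZl_EFin//.
    - by rewrite HB// muleCA.
    - by move=> w _; rewrite lee_fin mulr_ge0.
    - by apply/measurable_EFinP; apply: measurable_funM.
  transitivity (c%:E * \sum_(y \in range (g n)) (y%:E * P (Y @^-1` (g n @^-1` [set y]))))%E.
    rewrite ge0_mule_fsumr// => y.
    have [[s _ <-]|ny] := pselect (range (g n) y); first by rewrite mule_ge0// lee_fin.
    rewrite (_ : _ @^-1` _ = set0) ?measure0 ?mule0//.
    by apply/seteqP; split => // w /= hw; apply: ny; exists (Y w).
  congr (_ * _)%E; apply/esym.
  transitivity (\int[P]_w \sum_(y \in range (g n)) (y * \1_(g n @^-1` [set y]) (Y w))%:E)%E.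
    by apply: eq_integral => w _; rewrite fimfunE fsumEFin.
  rewrite ge0_integral_fsum//; last 2 first.
  - by move=> y; apply/measurable_EFinP; apply: measurable_funM.
  - by move=> y w _; exact: nnfun_muleindic_ge0.
  apply: eq_fsbigr => y /[!inE] -[s _ <-].
  under eq_integral do rewrite EFinM.
  rewrite ge0_integralZl_EFin//; last by apply/measurable_EFinP.
  congr (_ * _)%E.
  rewrite (_ : (fun w => _) = EFin \o \1_(Y @^-1` (g n @^-1` [set g n s])))//.
  by rewrite integral_indic// setIT.
have lim1 : (\int[P]_w (H w * g n (Y w))%:E)%E @[n --> \oo] -->
    (\int[P]_w (H w * h (Y w))%:E)%E.
  rewrite [X in _ --> X](_ : _ = \int[P]_w (limn (fun n => (H w * g n (Y w))%:E)))%E; last first.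
    apply: eq_integral => w _; apply/esym/cvg_lim => //.
    under eq_fun do rewrite EFinM.
    by rewrite EFinM; apply: cvgeZl.
  apply: cvg_monotone_convergence => //.
  - by move=> n; apply/measurable_EFinP; apply: measurable_funM.
  - by move=> n w _; rewrite lee_fin mulr_ge0.
  - by move=> w _ m n mn; rewrite lee_fin ler_wpM2l//; exact: g_nd.
have lim2 : (\int[P]_w (g n (Y w))%:E)%E @[n --> \oo] -->
    (\int[P]_w (h (Y w))%:E)%E.
  rewrite [X in _ --> X](_ : _ = \int[P]_w (limn (fun n => (g n (Y w))%:E)))%E; last first.
    by apply: eq_integral => w _; apply/esym/cvg_lim.
  apply: cvg_monotone_convergence => //.
  - by move=> n; apply/measurable_EFinP.
  - by move=> n w _; rewrite lee_fin.
  - by move=> w _ m n mn; rewrite lee_fin; exact: g_nd.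
have lim3 : (\int[P]_w (H w * g n (Y w))%:E)%E @[n --> \oo] -->
    (c%:E * \int[P]_w (h (Y w))%:E)%E.
  by rewrite (funext simple); apply: cvgeZl.
exact: (cvg_unique _ lim1 lim3).
Qed.

Lemma expectation_prod_independent d (T : measurableType d) d1
    (S : measurableType d1) (R : realType) (P : probability T R) (I : finType)
    (X : I -> T -> S) (f : I -> S -> R) :
  (forall i, measurable_fun setT (X i)) -> mutually_independent P X ->
  (forall i, measurable_fun setT (f i)) -> (forall i s, 0 <= f i s) ->
  (forall i, (\int[P]_w (f i (X i w))%:E < +oo)%E) ->
  (\int[P]_w (\prod_i f i (X i w))%:E = \prod_i \int[P]_w (f i (X i w))%:E)%E.
Proof.
move=> mX indX mf f0 flty.
(* The factors outside [A] are indicators; they are replaced one at a time. *)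
suff H : forall (A : {set I}) (h : I -> S -> R),
    (forall i, measurable_fun setT (h i)) -> (forall i s, 0 <= h i s) ->
    (forall i, \int[P]_w (h i (X i w))%:E < +oo)%E ->
    (forall i, i \notin A -> exists2 B, measurable B & h i = \1_B) ->
    (\int[P]_w (\prod_i h i (X i w))%:E = \prod_i \int[P]_w (h i (X i w))%:E)%E.
  by apply: (H [set: I]%SET) => // i; rewrite inE.
move=> A; have [m] := ubnP #|A|; elim: m A => // m IH A /ltnSE Am h mh h0 hlty hA.
have [A0|[j jA]] := set_0Vmem A.
  have /choice[B HB] : forall i, exists B, measurable B /\ h i = \1_B.
    by move=> i; have [|B mB ->] := hA i; [rewrite A0 inE|exists B].
  transitivity (P (\bigcap_(i in [set` [set: I]%SET]) (X i @^-1` B i))).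
    rewrite -[X in _ = P X]setIT -integral_indic//; last first.
      apply: fin_bigcap_measurable => // i _.
      by rewrite -[X in measurable X]setTI; apply: mX => //; case: (HB i).
    apply: eq_integral => w _; congr _%:E; rewrite indicE.
    have [/set_mem wB|/negP wB] := boolP (w \in _).
      rewrite big1// => i _; rewrite (HB i).2 indicE mem_set//.
      by apply: wB; rewrite /= inE.
    have [i nB] : exists i, ~ B i (X i w).
      apply: contrapT => H; apply: wB; apply/mem_set => i _ /=.
      by apply: contrapT => nB; apply: H; exists i.
    by rewrite (bigD1 i)//= (HB i).2 indicE memNset ?mul0r.
  rewrite indX; last by move=> i; case: (HB i).
  rewrite (eq_bigl predT); last by move=> i; rewrite inE.
  apply: eq_bigr => i _; rewrite (HB i).2.
  rewrite (_ : (fun w => _) = EFin \o \1_(X i @^-1` B i))//.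
  rewrite integral_indic ?setIT//.
  by rewrite -[X in measurable X]setTI; apply: mX => //; case: (HB i).
pose e i := fine (\int[P]_w (h i (X i w))%:E)%E.
have eE i : (\int[P]_w (h i (X i w))%:E)%E = (e i)%:E.
  rewrite fineK// ge0_fin_numE//.
  by apply: integral_ge0 => w _; rewrite lee_fin.
pose c := \prod_(i | i != j) e i.
pose H w := \prod_(i | i != j) h i (X i w).
have mhX i : measurable_fun setT (fun w => h i (X i w)) by exact: measurableT_comp.
have mH : measurable_fun setT H.
  rewrite /H; under eq_fun do rewrite big_mkcond/=.
  by apply: measurable_prod => i _; case: (i != j).
have H0 w : 0 <= H w by apply: prodr_ge0.
have c0 : 0 <= c.
  apply: prodr_ge0 => i _; rewrite fine_ge0//.
  by apply: integral_ge0 => w _; rewrite lee_fin.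
have key B : measurable B ->
    (\int[P]_w (H w * \1_B (X j w))%:E = c%:E * P (X j @^-1` B))%E.
  move=> mB; pose h' i := if i == j then \1_B else h i.
  have mXB : measurable (X j @^-1` B) by rewrite -[X in measurable X]setTI; exact: mX.
  have intB : (\int[P]_w (h' j (X j w))%:E = P (X j @^-1` B))%E.
    rewrite /h' eqxx (_ : (fun w => _) = EFin \o \1_(X j @^-1` B))//.
    by rewrite integral_indic ?setIT.
  have := IH (A :\ j) _ h' _ _ _ _.
  rewrite (bigD1 j)//= intB => IH'.
  transitivity (\int[P]_w (\prod_i h' i (X i w))%:E)%E.
    apply: eq_integral => w _; congr _%:E.
    rewrite (bigD1 j)//= /h' eqxx mulrC; congr (_ * _).
    by apply: eq_bigr => i /negbTE ->.
  rewrite IH'.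
  - rewrite muleC; congr (_ * _)%E; rewrite /c -prodEFin.
    by apply: eq_bigr => i /negbTE ij; rewrite /h' ij eE.
  - by apply: leq_trans Am; rewrite [in X in (_ < X)%N](cardsD1 j) jA.
  - by move=> i; rewrite /h'; case: eqP => // _; exact: measurable_indic.
  - by move=> i s; rewrite /h'; case: eqP => // _; rewrite indicE.
  - move=> i; have [->|ij] := eqVneq i j; first by rewrite intB (le_lt_trans (probability_le1 P mXB))// ltry.
    by rewrite /h' (negbTE ij).
  - move=> i; rewrite !inE negb_and negbK /h' => /orP[/eqP ->|iA].
      by rewrite eqxx; exists B.
    by case: eqP => [_|_]; [exists B|exact: hA].
transitivity (\int[P]_w (H w * h j (X j w))%:E)%E.
  by apply: eq_integral => w _; congr _%:E; rewrite (bigD1 j)//= mulrC.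
rewrite (integral_mul_comp_of_indic mH H0 (mX j) c0 key (mh j) (h0 j)).
rewrite [RHS](bigD1 j)//= muleC; congr (_ * _)%E.
by rewrite /c -prodEFin; apply: eq_bigr => i _; rewrite eE.
Qed.

(** * Covariance and subgaussian tails *)

Definition tdot (R : realType) (p : nat) (x : p.-tuple R) (z : 'I_p -> R) : R :=
  \sum_i tnth x i * z i.

Lemma measurable_tdot (R : realType) (p : nat) (z : 'I_p -> R) :
  measurable_fun setT (fun x : p.-tuple R => tdot x z).
Proof.
apply: measurable_sum => i; apply: measurable_funM => //.
exact: measurable_tnth.
Qed.

Lemma dotv_colv (R : realType) (p : nat) (x : p.-tuple R) (z : 'I_p -> R) :
  dotv (colv x) (\col_i z i) = tdot x z.
Proof. by apply: eq_bigr => i _; rewrite !mxE. Qed.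

Lemma measurable_comp_RV d (T : measurableType d) (R : realType)
    (P : probability T R) d1 (S : measurableType d1) (X : {RV P >-> S})
    d2 (S2 : measurableType d2) (h : S -> S2) :
  measurable_fun setT h -> measurable_fun setT (fun w => h (X w)).
Proof. by move=> mh; apply: measurableT_comp. Qed.

Lemma covmx_integrable d (T : measurableType d) (R : realType)
    (P : probability T R) (p : nat) (X : {RV P >-> p.-tuple R}) (i j : 'I_p) :
  square_integrable P X ->
  P.-integrable setT (fun w => (tnth (X w) i * tnth (X w) j)%:E).
Proof. by move=> sX; apply/Lfun1_integrable; exact: (Lfun2_mul_Lfun1 (sX i) (sX j)). Qed.

Lemma covmxE d (T : measurableType d) (R : realType)
    (P : probability T R) (p : nat) (X : {RV P >-> p.-tuple R}) (i j : 'I_p) :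
  square_integrable P X ->
  (\int[P]_w (tnth (X w) i * tnth (X w) j)%:E = (covmx P X i j)%:E)%E.
Proof.
move=> sX; rewrite mxE unlock -[LHS]fineK; last first.
  by apply: integrable_fin_num => //; exact: covmx_integrable.
congr (fine _)%:E; apply: eq_integral => w _.
by rewrite mxE big_ord1 !mxE.
Qed.

Lemma tdotM (R : realType) (p : nat) (x : p.-tuple R) (z z' : 'I_p -> R) :
  tdot x z * tdot x z' = bform (fun i j => tnth x i * tnth x j) z z'.
Proof.
rewrite /tdot big_distrlr/=; apply: eq_bigr => i _; apply: eq_bigr => j _.
ring.
Qed.

Lemma tdotM_integrable d (T : measurableType d) (R : realType)
    (P : probability T R) (p : nat) (X : {RV P >-> p.-tuple R})
    (z z' : 'I_p -> R) :
  square_integrable P X ->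
  P.-integrable setT (fun w => (tdot (X w) z * tdot (X w) z')%:E) /\
  (\int[P]_w (tdot (X w) z * tdot (X w) z')%:E = (bform (covmx P X) z z')%:E)%E.
Proof.
move=> sX.
have H i j : P.-integrable setT
    (fun w => ((z i * z' j)%:E * (tnth (X w) i * tnth (X w) j)%:E)%E).
  by apply: integrableZl => //; exact: covmx_integrable.
have E w : (tdot (X w) z * tdot (X w) z')%:E = (\sum_i \sum_j
    (z i * z' j)%:E * (tnth (X w) i * tnth (X w) j)%:E)%E.
  rewrite tdotM /bform -sumEFin; apply: eq_bigr => i _.
  by rewrite -sumEFin; apply: eq_bigr => j _; rewrite -EFinM mulrC.
split.
  under eq_fun do rewrite E.
  by apply: integrable_sum => // i _; apply: integrable_sum => // j _.
under eq_integral do rewrite E.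
rewrite integral_sum//; last by move=> i; apply: integrable_sum => // j _.
rewrite /bform -sumEFin; apply: eq_bigr => i _.
rewrite integral_sum//= -sumEFin; apply: eq_bigr => j _.
rewrite integralZl//; last exact: covmx_integrable.
by rewrite covmxE// -EFinM mulrC.
Qed.

Lemma covmx_sym d (T : measurableType d) (R : realType)
    (P : probability T R) (p : nat) (X : T -> p.-tuple R) (i j : 'I_p) :
  covmx P X i j = covmx P X j i.
Proof.
rewrite !mxE; congr fine; congr expectation.body; apply/funext => w.
by rewrite !mxE !big_ord1 !mxE mulrC.
Qed.

Lemma covmx_ge0 d (T : measurableType d) (R : realType)
    (P : probability T R) (p : nat) (X : {RV P >-> p.-tuple R})
    (z : 'I_p -> R) :
  square_integrable P X -> 0 <= bform (covmx P X) z z.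
Proof.
move=> sX; rewrite -lee_fin -(tdotM_integrable z z sX).2.
by apply: integral_ge0 => w _; rewrite lee_fin -expr2 sqr_ge0.
Qed.

(** The Orlicz norm is an infimum, so [K] times the standard deviation need not itself be
    admissible. Passing to [K + 1] makes the comparison strict and yields an admissible [t] below
    [(K + 1) * sqrt b]. Any [b > 0] above the variance is allowed, which covers directions of
    variance zero. *)
Lemma subgaussian_exp d (T : measurableType d) (R : realType)
    (P : probability T R) (K : R) (p : nat) (X : {RV P >-> p.-tuple R})
    (z : 'I_p -> R) (b : R) :
  0 < K -> square_integrable P X -> subgaussian P K X ->
  0 < b -> bform (covmx P X) z z <= b ->
  (\int[P]_w (expR (tdot (X w) z ^+ 2 / ((K + 1) ^+ 2 * b)))%:E <= 2%:E)%E.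
Proof.
move=> K0 sX sgX b0 zb.
have := sgX (\col_i z i).
have -> : (fun w => dotv (colv (X w)) (\col_i z i)) = (fun w => tdot (X w) z).
  by apply/funext => w; rewrite dotv_colv.
have -> : (fun w => dotv (colv (X w)) (\col_i z i) ^+ 2) = (fun w => tdot (X w) z * tdot (X w) z).
  by apply/funext => w; rewrite dotv_colv expr2.
have -> : ('E_P[fun w => (tdot (X w) z * tdot (X w) z)%R] =
    (bform (covmx P X) z z)%:E)%E by rewrite unlock (tdotM_integrable z z sX).2.
rewrite /psi2norm /=.
set s := Num.sqrt _; set a := ereal_inf _; rewrite -EFinM => h.
have lt1 : K * s < (K + 1) * Num.sqrt b.
  have : s <= Num.sqrt b by rewrite ler_wsqrtr.
  have : 0 < Num.sqrt b by rewrite sqrtr_gt0.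
  have : 0 <= s by rewrite sqrtr_ge0.
  nra.
have : (a < ((K + 1) * Num.sqrt b)%:E)%E by rewrite (le_lt_trans h)// lte_fin.
move=> /ereal_inf_lt[_ [t [t0 Et] <-]]; rewrite lte_fin => tb.
rewrite unlock in Et; apply: le_trans Et.
have mt : measurable_fun setT (fun w => tdot (X w) z).
  exact: (measurable_comp_RV X (measurable_tdot z)).
have mexp c : measurable_fun setT (fun w => (expR (tdot (X w) z ^+ 2 / c))%:E).
  apply/measurable_EFinP; apply: measurableT_comp => //.
  by apply: measurable_funM => //; exact: measurable_funX.
apply: ge0_le_integral => //.
move=> w _; rewrite lee_fin ler_expR ler_wpM2l ?sqr_ge0//.
have Kb : 0 < (K + 1) ^+ 2 * b by rewrite mulr_gt0// exprn_gt0// addr_gt0.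
rewrite lef_pV2 ?posrE ?exprn_gt0//.
rewrite -[b](sqr_sqrtr (ltW b0)) -exprMn lerXn2r ?nnegrE ?(ltW t0) ?(ltW tb)//.
by rewrite mulr_ge0// addr_ge0// ltW.
Qed.

(** A pointwise second-order bound becomes a bound on the exponential moment: integrate it, then use
    [1 + y <= exp y]. *)
Lemma integral_expR_le d (T : measurableType d) (R : realType)
    (P : probability T R) (V W : T -> R) (l v c B : R) :
  P.-integrable setT (fun w => (V w)%:E) -> (\int[P]_w (V w)%:E = v%:E)%E ->
  measurable_fun setT W -> (forall w, 0 <= W w) ->
  (\int[P]_w (W w)%:E <= B%:E)%E -> 0 <= c ->
  (forall w, expR (l * V w) <= 1 + l * V w + c * W w) ->
  (\int[P]_w (expR (l * V w))%:E <= (expR (l * v + c * B))%:E)%E.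
Proof.
move=> iV vE mW W0 WB c0 H.
have mV : measurable_fun setT V by apply/measurable_EFinP; case/integrableP: iV.
have iW : P.-integrable setT (fun w => (W w)%:E).
  apply/integrableP; split; first exact/measurable_EFinP.
  under eq_integral do rewrite /= ger0_norm//.
  by rewrite (le_lt_trans WB)// ltry.
have ilV : P.-integrable setT (fun w => (l%:E * (V w)%:E)%E) by exact: integrableZl.
have icW : P.-integrable setT (fun w => (c%:E * (W w)%:E)%E) by exact: integrableZl.
have i1 : P.-integrable setT (fun=> 1%E : \bar R) by exact: finite_measure_integrable_cst.
have i1V : P.-integrable setT (fun w => (1 + l%:E * (V w)%:E)%E) by exact: integrableD.
apply: (@le_trans _ _ (\int[P]_w ((1 + l%:E * (V w)%:E) + c%:E * (W w)%:E))%E).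
  apply: ge0_le_integral => //.
  - by apply/measurable_EFinP; apply: measurableT_comp => //; exact: measurable_funM.
  - have : P.-integrable setT (fun w => ((1 + l%:E * (V w)%:E) + c%:E * (W w)%:E)%E).
      exact: integrableD.
    by move/integrableP => [].
  - by move=> w _; rewrite -!EFinM -!EFinD lee_fin.
rewrite integralD// integralD// integral_cst//.
rewrite [X in (X + _ + _)%E](_ : _ = 1%E); last by rewrite mul1e; exact: probability_setT.
rewrite integralZl// integralZl// vE.
apply: (@le_trans _ _ (1 + l%:E * v%:E + c%:E * B%:E)%E).
  by rewrite leeD2l// lee_wpmul2l.
rewrite -!EFinM -!EFinD lee_fin.
by have := expR_ge1Dx (l * v + c * B); rewrite addrA.
Qed.

Lemma expR_le_taylor (R : realType) (y : R) :
  expR y <= 1 + y + 2 * y ^+ 2 * expR `|y|.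
Proof.
have e1 : 1 <= expR `|y| by rewrite -expR0 ler_expR.
have [y1|y1] := leP y 1.
  apply: le_trans (expR_le_quadratic y1) _.
  by rewrite lerD2l ler_peMr// mulr_ge0// sqr_ge0.
rewrite gtr0_norm; last by lra.
have h : expR y <= 2 * y ^+ 2 * expR y by rewrite ler_peMl ?expR_ge0//; nra.
lra.
Qed.

Lemma sqr_le_expR (R : realType) (y : R) : 0 <= y -> y ^+ 2 <= 4 * expR y.
Proof.
move=> y0; have h := expR_ge1Dx (y / 2).
have -> : expR y = expR (y / 2) * expR (y / 2).
  by rewrite -expRD; congr expR; lra.
nra.
Qed.

Lemma expR_mean_le (R : realType) (a b : R) :
  expR ((a + b) / 2) <= (expR a + expR b) / 2.
Proof.
have -> : expR a = expR (a / 2) * expR (a / 2) by rewrite -expRD; congr expR; lra.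
have -> : expR b = expR (b / 2) * expR (b / 2) by rewrite -expRD; congr expR; lra.
have -> : expR ((a + b) / 2) = expR (a / 2) * expR (b / 2).
  by rewrite -expRD; congr expR; lra.
have := sqr_ge0 (expR (a / 2) - expR (b / 2)); nra.
Qed.

(** The factor [(a b) ^ 2] costs [16 exp (|a b| / 2)], and [|l| <= 1/2] leaves one more
    [exp (|a b| / 2)]. Together they give [exp |a b|], bounded by the mean of [exp (a ^ 2)] and
    [exp (b ^ 2)]. *)
Lemma expR_product_le (R : realType) (a b l : R) :
  `|l| <= 2^-1 ->
  expR (l * (a * b)) <= 1 + l * (a * b) + 16 * l ^+ 2 * (expR (a ^+ 2) + expR (b ^+ 2)).
Proof.
move=> l2; apply: le_trans (expR_le_taylor _) _; rewrite lerD2l.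
have ab : `|a * b| <= (a ^+ 2 + b ^+ 2) / 2.
  rewrite ler_norml; apply/andP; split.
    have := sqr_ge0 (a + b); nra.
  have := sqr_ge0 (a - b); nra.
have h1 : `|a * b| ^+ 2 <= 16 * expR (`|a * b| / 2).
  have := @sqr_le_expR R (`|a * b| / 2); rewrite divr_ge0// => /(_ isT).
  have -> : (`|a * b| / 2) ^+ 2 = `|a * b| ^+ 2 / 4 by field.
  lra.
have h2 : expR `|l * (a * b)| <= expR (`|a * b| / 2).
  by rewrite ler_expR normrM mulrC ler_wpM2l.
have h3 : expR (`|a * b| / 2) * expR (`|a * b| / 2) <= (expR (a ^+ 2) + expR (b ^+ 2)) / 2.
  rewrite -expRD; apply: le_trans (expR_mean_le _ _); rewrite ler_expR; lra.
have h4 : (a * b) ^+ 2 * expR `|l * (a * b)| <= 8 * (expR (a ^+ 2) + expR (b ^+ 2)).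
  rewrite -(real_normK (num_real (a * b))).
  apply: (@le_trans _ _ (16 * expR (`|a * b| / 2) * expR (`|a * b| / 2))).
    by apply: ler_pM.
  by rewrite -mulrA; lra.
rewrite exprMn (_ : 2 * _ * _ = 2 * l ^+ 2 * ((a * b) ^+ 2 * expR `|l * (a * b)|)); last by ring.
rewrite (_ : 16 * l ^+ 2 * _ = 2 * l ^+ 2 * (8 * (expR (a ^+ 2) + expR (b ^+ 2)))); last by ring.
by rewrite ler_wpM2l// mulr_ge0// sqr_ge0.
Qed.

(** A product of two subgaussian forms is subexponential, hence the restriction on [l]. The constant
    is [64 = 16 * (2 + 2)], each square having exponential moment at most 2. *)
Lemma subgaussian_bernstein d (T : measurableType d) (R : realType)
    (P : probability T R) (K : R) (p : nat) (X : {RV P >-> p.-tuple R})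
    (z z' : 'I_p -> R) (b l : R) :
  0 < K -> square_integrable P X -> subgaussian P K X ->
  0 < b -> bform (covmx P X) z z <= b -> bform (covmx P X) z' z' <= b ->
  `|l| <= 2^-1 ->
  (\int[P]_w (expR (l * ((tdot (X w) z * tdot (X w) z' - bform (covmx P X) z z')
     / ((K + 1) ^+ 2 * b))))%:E <= (expR (64 * l ^+ 2))%:E)%E.
Proof.
move=> K0 sX sgX b0 zb zb' l2.
set kb := (K + 1) ^+ 2 * b; set S := bform _ _ _.
have kb0 : 0 < kb by rewrite mulr_gt0// exprn_gt0// addr_gt0.
have [i1 E1] := tdotM_integrable z z' sX.
have m1 y : measurable_fun setT (fun w => tdot (X w) y).
  exact: (measurable_comp_RV X (measurable_tdot y)).
have me y : measurable_fun setT (fun w => expR (tdot (X w) y ^+ 2 / kb)).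
  apply: measurableT_comp => //.
  by apply: measurable_funM => //; exact: measurable_funX.
have mP : measurable_fun setT (fun w => tdot (X w) z * tdot (X w) z').
  exact: measurable_funM.
have H : (\int[P]_w (expR (l * (tdot (X w) z * tdot (X w) z' / kb)))%:E <=
    (expR (l * (S / kb) + 16 * l ^+ 2 * 4))%:E)%E.
  apply: (@integral_expR_le _ _ _ _ _
    (fun w => expR (tdot (X w) z ^+ 2 / kb) + expR (tdot (X w) z' ^+ 2 / kb))).
  - under eq_fun do rewrite EFinM; exact: integrableZr.
  - under eq_integral do rewrite EFinM.
    by rewrite integralZr// E1 -EFinM.
  - exact: measurable_funD.
  - by move=> w; rewrite addr_ge0// expR_ge0.
  - under eq_integral do rewrite EFinD.
    rewrite ge0_integralD//.
    + apply: (@le_trans _ _ (2%:E + 2%:E)%E); last by rewrite -EFinD lee_fin; lra.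
      by apply: leeD; exact: subgaussian_exp.
    + exact/measurable_EFinP.
    + exact/measurable_EFinP.
  - by rewrite mulr_ge0// sqr_ge0.
  - move=> w; set x := tdot (X w) z; set y := tdot (X w) z'.
    have r0 : 0 < Num.sqrt kb by rewrite sqrtr_gt0.
    have r2 : Num.sqrt kb ^+ 2 = kb by rewrite sqr_sqrtr// ltW.
    have := @expR_product_le R (x / Num.sqrt kb) (y / Num.sqrt kb) l l2.
    have E u v : u / Num.sqrt kb * (v / Num.sqrt kb) = u * v / kb.
      by rewrite -[in RHS]r2; field; rewrite gt_eqF.
    by rewrite !expr2 !E -!expr2.
(* Centering multiplies by [exp (- l S / kb)], which cancels the linear term in [H]. *)
have -> : (fun w => (expR (l * ((tdot (X w) z * tdot (X w) z' - S) / kb)))%:E) =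
    (fun w => ((expR (- (l * (S / kb))))%:E *
      (expR (l * (tdot (X w) z * tdot (X w) z' / kb)))%:E)%E).
  by apply/funext => w; rewrite -EFinM -expRD; congr (expR _)%:E; ring.
rewrite ge0_integralZl_EFin ?expR_ge0//.
- apply: le_trans (lee_wpmul2l _ H) _; first by rewrite lee_fin expR_ge0.
  rewrite -EFinM -expRD lee_fin ler_expR; lra.
- apply/measurable_EFinP; apply: measurableT_comp => //.
  by apply: measurable_funM => //; exact: measurable_funM.
Qed.

(** For the lower tail the exponent [- l v] is nonpositive, so the quadratic bound on the
    exponential is available for every [l >= 0]; [v ^ 2] is absorbed by [4 exp v]. *)
Lemma subgaussian_lower_mgf d (T : measurableType d) (R : realType)
    (P : probability T R) (K : R) (p : nat) (X : {RV P >-> p.-tuple R})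
    (z : 'I_p -> R) (l : R) :
  0 < K -> square_integrable P X -> subgaussian P K X ->
  0 < bform (covmx P X) z z -> 0 <= l ->
  (\int[P]_w (expR (- l * (tdot (X w) z ^+ 2 /
     ((K + 1) ^+ 2 * bform (covmx P X) z z))))%:E <=
   (expR (- l / (K + 1) ^+ 2 + 16 * l ^+ 2))%:E)%E.
Proof.
move=> K0 sX sgX b0 l0; set b := bform _ _ _ in b0 *.
set kb := (K + 1) ^+ 2 * b.
have k0 : 0 < (K + 1) ^+ 2 by rewrite exprn_gt0// addr_gt0.
have kb0 : 0 < kb by rewrite mulr_gt0.
have [i1 E1] := tdotM_integrable z z sX.
have m1 : measurable_fun setT (fun w => tdot (X w) z).
  exact: (measurable_comp_RV X (measurable_tdot z)).
have me : measurable_fun setT (fun w => expR (tdot (X w) z ^+ 2 / kb)).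
  apply: measurableT_comp => //.
  by apply: measurable_funM => //; exact: measurable_funX.
rewrite (_ : - l / _ + _ = - l * (b / kb) + 8 * l ^+ 2 * 2); last first.
  by rewrite /kb; field; rewrite gt_eqF// gt_eqF// addr_gt0.
apply: (@integral_expR_le _ _ _ _ _ (fun w => expR (tdot (X w) z ^+ 2 / kb))).
- by under eq_fun do rewrite expr2 EFinM; exact: integrableZr.
- under eq_integral do rewrite expr2 EFinM.
  by rewrite integralZr// E1 -EFinM.
- by [].
- by move=> w; rewrite expR_ge0.
- exact: subgaussian_exp.
- by rewrite mulr_ge0// sqr_ge0.
- move=> w; set v := _ / kb.
  have v0 : 0 <= v by rewrite divr_ge0 ?sqr_ge0// ltW.
  apply: le_trans (expR_le_quadratic _) _; first by nra.
  rewrite lerD2l exprMn sqrrN.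
  have := sqr_le_expR v0; have := sqr_ge0 l; nra.
Qed.

Lemma exp_markov d (T : measurableType d) (R : realType)
    (P : probability T R) (f : T -> R) (s c : R) :
  measurable_fun setT f -> (\int[P]_w (expR (f w))%:E <= c%:E)%E ->
  (P [set w | (s <= f w)%R] <= (c * expR (- s))%:E)%E.
Proof.
move=> mf fc; set A := [set w | _].
have mA : measurable A by rewrite -[A]setTI; exact: measurable_fun_le.
have -> : P A = (\int[P]_w (\1_A w)%:E)%E by rewrite integral_indic// setIT.
have me : measurable_fun setT (fun w => (expR (f w))%:E).
  by apply/measurable_EFinP; exact: measurableT_comp.
apply: (@le_trans _ _ (\int[P]_w ((expR (- s))%:E * (expR (f w))%:E))%E).
  apply: ge0_le_integral => //.
  - by apply/measurable_EFinP; exact: measurable_indic.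
  - exact: measurable_funeM.
  - move=> w _; rewrite -EFinM lee_fin indicE.
    case: (boolP (w \in A)) => [/set_mem sf|_]; last by rewrite mulr_ge0 ?expR_ge0.
    by rewrite -expRD -expR0 ler_expR addrC subr_ge0.
rewrite ge0_integralZl_EFin ?expR_ge0//.
by rewrite EFinM muleC; apply: lee_wpmul2r.
Qed.

Lemma subgaussian_tail d (T : measurableType d) (R : realType)
    (P : probability T R) (K : R) (p : nat) (X : {RV P >-> p.-tuple R})
    (z : 'I_p -> R) (b u : R) :
  0 < K -> square_integrable P X -> subgaussian P K X ->
  0 < b -> bform (covmx P X) z z <= b ->
  (P [set w | ((K + 1) ^+ 2 * b * u <= tdot (X w) z ^+ 2)%R] <= (2 * expR (- u))%:E)%E.
Proof.
move=> K0 sX sgX b0 zb; set kb := (K + 1) ^+ 2 * b.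
have kb0 : 0 < kb by rewrite mulr_gt0// exprn_gt0// addr_gt0.
have -> : [set w | kb * u <= tdot (X w) z ^+ 2] =
    [set w | u <= tdot (X w) z ^+ 2 / kb].
  by apply/seteqP; split => w /=; rewrite ler_pdivlMr// mulrC.
apply: exp_markov; last exact: subgaussian_exp.
apply: measurable_funM => //; apply: measurable_funX.
exact: (measurable_comp_RV X (measurable_tdot z)).
Qed.

Lemma tdot_eq0 d (T : measurableType d) (R : realType)
    (P : probability T R) (p : nat) (X : {RV P >-> p.-tuple R}) (z : 'I_p -> R) :
  square_integrable P X -> bform (covmx P X) z z = 0 ->
  (P [set w | (tdot (X w) z != 0)%R] = 0)%E.
Proof.
move=> sX z0; have [i1 E1] := tdotM_integrable z z sX.
have mt : measurable_fun setT (fun w => tdot (X w) z).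
  exact: (measurable_comp_RV X (measurable_tdot z)).
rewrite z0 in E1.
have : ae_eq P setT (fun w => (tdot (X w) z * tdot (X w) z)%:E) (cst 0%E).
  apply/(ae_eq_integral_abs P measurableT).
    by apply/measurable_EFinP; exact: measurable_funM.
  rewrite -[RHS]E1; apply: eq_integral => w _.
  by rewrite gee0_abs// lee_fin -expr2 sqr_ge0.
move=> [N [mN N0 NS]]; apply/eqP; rewrite eq_le measure_ge0 andbT -N0.
apply: le_measure; rewrite ?inE//.
  rewrite (_ : [set w | _] = ~` ((fun w => tdot (X w) z) @^-1` [set 0])).
    by apply: measurableC; rewrite -[X in measurable X]setTI; apply: mt.
  by apply/seteqP; split => w /=; [move/eqP|move=> /eqP].
move=> w /= wz; apply: NS => /= /(_ I)[] /eqP.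
by rewrite mulf_eq0 orbb (negbTE wz).
Qed.

Lemma integral_same_law d (T : measurableType d) d' (T' : measurableType d')
    d1 (S : measurableType d1) (R : realType)
    (P : probability T R) (X : T -> S) (P' : probability T' R) (X' : T' -> S)
    (h : S -> R) :
  measurable_fun setT X -> measurable_fun setT X' -> same_law P X P' X' ->
  measurable_fun setT h -> (forall s, 0 <= h s) ->
  (\int[P]_w (h (X w))%:E = \int[P']_w (h (X' w))%:E)%E.
Proof.
move=> mX mX' PX mh h0.
have mh' : measurable_fun setT (EFin \o h) by exact/measurable_EFinP.
have h0' : {in [set: S], forall y, (0%R <= (EFin \o h) y)%E}.
  by move=> s _; rewrite lee_fin.
have := ge0_integral_pushforward mX P measurableT mh' h0'.
have := ge0_integral_pushforward mX' P' measurableT mh' h0'.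
rewrite !preimage_setT => <- <-.
by apply: eq_measure_integral => A mA _; exact: PX.
Qed.

Lemma chernoff_independent d (T : measurableType d) d1
    (S : measurableType d1) (R : realType) (P : probability T R) (I : finType)
    (X : I -> T -> S) (f : I -> S -> R) (c : I -> R) (s : R) :
  (forall i, measurable_fun setT (X i)) -> mutually_independent P X ->
  (forall i, measurable_fun setT (f i)) ->
  (forall i, (\int[P]_w (expR (f i (X i w)))%:E <= (expR (c i))%:E)%E) ->
  (P [set w | (s <= \sum_i f i (X i w))%R] <= (expR (\sum_i c i - s))%:E)%E.
Proof.
move=> mX indX mf fc.
have mfe i : measurable_fun setT (fun x => expR (f i x)) by exact: measurableT_comp.
rewrite expRD; apply: exp_markov.
  by apply: measurable_sum => i; exact: measurableT_comp (mf i) (mX i).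
under eq_integral do rewrite expR_sum.
rewrite (@expectation_prod_independent _ _ _ _ _ _ _ X (fun i x => expR (f i x)))//.
- pose e i := fine (\int[P]_w (expR (f i (X i w)))%:E)%E.
  have e0 i : (0 <= \int[P]_w (expR (f i (X i w)))%:E)%E.
    by apply: integral_ge0 => w _; rewrite lee_fin expR_ge0.
  have eE i : (\int[P]_w (expR (f i (X i w)))%:E)%E = (e i)%:E.
    by rewrite fineK// ge0_fin_numE// (le_lt_trans (fc i))// ltry.
  rewrite (eq_bigr (fun i => (e i)%:E)) => [|i _]; last exact: eE.
  rewrite prodEFin lee_fin expR_sum; apply: ler_prod => i _.
  by rewrite fine_ge0//= -lee_fin -eE.
- by move=> i; rewrite (le_lt_trans (fc i))// ltry.
Qed.

(** * Concentration of the samples *)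

Lemma measurable_le_set d (T : measurableType d) (R : realType) (f g : T -> R) :
  measurable_fun setT f -> measurable_fun setT g ->
  measurable [set w | f w <= g w].
Proof. by move=> mf mg; rewrite -[X in measurable X]setTI; exact: measurable_fun_le. Qed.

Lemma measurable_lt_set d (T : measurableType d) (R : realType) (f g : T -> R) :
  measurable_fun setT f -> measurable_fun setT g ->
  measurable [set w | f w < g w].
Proof.
move=> mf mg; rewrite (_ : [set w | _] = ~` [set w | g w <= f w]).
  by apply: measurableC; exact: measurable_le_set.
by apply/seteqP; split => w /=; rewrite ltNge => /negP.
Qed.

Definition unitv (R : realType) (p : nat) (i j : 'I_p) : R := (j == i)%:R.

Lemma tdot_unitv (R : realType) (p : nat) (x : p.-tuple R) (i : 'I_p) :
  tdot x (unitv R i) = tnth x i.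
Proof.
rewrite /tdot (bigD1 i)//= /unitv eqxx mulr1 big1 ?addr0// => j /negbTE ->.
by rewrite mulr0.
Qed.

Lemma bform_unitv (R : realType) (p : nat) (A : 'I_p -> 'I_p -> R) (i j : 'I_p) :
  bform A (unitv R i) (unitv R j) = A i j.
Proof.
rewrite /bform (bigD1 i)//= (bigD1 j)//= /unitv !eqxx !mulr1.
rewrite big1 ?addr0 => [|k /negbTE ->]; last by rewrite !mulr0.
rewrite big1 ?addr0// => k /negbTE ->.
by rewrite big1// => l _; rewrite mul0r mulr0.
Qed.

Lemma finite_union_bound d (T : measurableType d) (R : realType)
    (P : probability T R) (L : finType) (Q : pred L) (B : L -> set T) (e : L -> R) :
  (forall l, Q l -> measurable (B l)) -> (forall l, Q l -> (P (B l) <= (e l)%:E)%E) ->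
  measurable [set w | exists2 l, Q l & B l w] /\
  (P [set w | exists2 l, Q l & B l w] <= (\sum_(l | Q l) e l)%:E)%E.
Proof.
move=> mB PB.
have -> : [set w | exists2 l, Q l & B l w] = \big[setU/set0]_(l | Q l) B l.
  apply/seteqP; split => w /=.
    by move=> [l Ql Blw]; rewrite (bigD1 l)//=; left.
  elim/big_ind : _ => [|A1 A2 H1 H2 [/H1|/H2]|l Ql Blw]//.
  by exists l.
suff [H1 H2] : measurable (\big[setU/set0]_(l | Q l) B l) /\
    (P (\big[setU/set0]_(l | Q l) B l) <= \sum_(l | Q l) (e l)%:E)%E.
  by split => //; rewrite -sumEFin.
elim/big_ind2 : _ => [|A1 e1 A2 e2 [m1 h1] [m2 h2]|l Ql].
- by rewrite measure0.
- split; first exact: measurableU.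
  by apply: le_trans (measureU2 _ m1 m2) _; exact: leeD.
- by split; [exact: mB|exact: PB].
Qed.

Lemma sample_tail d0 (T0 : measurableType d0) (R : realType)
    (P0 : probability T0 R) (K : R) (p : nat) (X : {RV P0 >-> p.-tuple R})
    d (T : measurableType d) (P : probability T R) (Y : T -> p.-tuple R)
    (i : 'I_p) (u : R) :
  0 < K -> square_integrable P0 X -> subgaussian P0 K X -> same_law P Y P0 X ->
  (P [set w | (u * ((K + 1) ^+ 2 * covmx P0 X i i) < tnth (Y w) i ^+ 2)%R] <=
   (2 * expR (- u))%:E)%E.
Proof.
move=> K0 sX sgX YX; pose S := covmx P0 X.
pose B := [set x : p.-tuple R | u * ((K + 1) ^+ 2 * S i i) < tnth x i ^+ 2].
have mB : measurable B.
  apply: measurable_lt_set => //.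
  by apply: measurable_funX; exact: measurable_tnth.
have -> : [set w | u * ((K + 1) ^+ 2 * S i i) < tnth (Y w) i ^+ 2] = Y @^-1` B by [].
rewrite YX//.
have mX A : measurable A -> measurable (X @^-1` A).
  by move=> mA; rewrite -[X in measurable X]setTI; exact: measurable_funP.
(* With zero variance the coordinate vanishes almost surely, and the strict inequality defining the
   event then fails. *)
have [S0|S0] := eqVneq (S i i) 0.
  have bS : bform S (unitv R i) (unitv R i) = 0 by rewrite bform_unitv.
  apply: (@le_trans _ _ 0%E); last by rewrite lee_fin mulr_ge0// expR_ge0.
  have <- := tdot_eq0 sX bS.
  apply: le_measure; rewrite ?inE; first exact: mX.
    rewrite (_ : [set w | _] = ~` ((fun w => tdot (X w) (unitv R i)) @^-1` [set 0])).
      apply: measurableC; rewrite -[X in measurable X]setTI.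
      exact: (measurable_comp_RV X (measurable_tdot _)).
    by apply/seteqP; split => w /=; [move/eqP|move=> /eqP].
  move=> w; rewrite /B /= S0 !mulr0 tdot_unitv => h.
  by apply: contraTneq h => ->; rewrite expr0n/= ltxx.
have Sp : 0 < S i i.
  rewrite lt_def S0/=; have := covmx_ge0 (unitv R i) sX.
  by rewrite bform_unitv.
have := @subgaussian_tail _ _ _ P0 K p X (unitv R i) (S i i) u K0 sX sgX Sp.
rewrite bform_unitv => /(_ (lexx _)); apply: le_trans.
apply: le_measure; rewrite ?inE; first exact: mX.
  apply: measurable_le_set => //.
  by apply: measurable_funX; exact: (measurable_comp_RV X (measurable_tdot _)).
by move=> w; rewrite /B /= tdot_unitv mulrC => /ltW.
Qed.

Lemma sample_lower_tail d0 (T0 : measurableType d0) (R : realType)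
    (P0 : probability T0 R) (K : R) (p n : nat) (X : {RV P0 >-> p.-tuple R})
    d (T : measurableType d) (P : probability T R)
    (Xs : 'I_n.+1 -> {RV P >-> p.-tuple R}) (i : 'I_p) (k : 'I_n) :
  0 < K -> square_integrable P0 X -> subgaussian P0 K X ->
  (forall j, same_law P (Xs j) P0 X) ->
  mutually_independent P (fun j => Xs j : T -> p.-tuple R) ->
  0 < covmx P0 X i i ->
  (P [set w | (\sum_(j < n.+1 | (j < k.+1)%N) tnth (Xs j w) i ^+ 2 <=
       k.+1%:R * covmx P0 X i i / 2)%R] <=
   (expR (- (k.+1%:R / (256 * (K + 1) ^+ 4))))%:E)%E.
Proof.
move=> K0 sX sgX law ind S0; set s := covmx P0 X i i in S0 *.
set k2 := (K + 1) ^+ 2.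
have K1 : 0 < K + 1 by rewrite addr_gt0.
have k20 : 0 < k2 by rewrite exprn_gt0.
(* The minimiser of [- l / (2 k2) + 16 l ^ 2], the exponent per sample once the threshold is
   included. *)
pose l := (64 * k2)^-1.
have l0 : 0 <= l by rewrite invr_ge0 mulr_ge0// ltW.
pose f (j : 'I_n.+1) (x : p.-tuple R) :=
  if (j < k.+1)%N then - l * (tdot x (unitv R i) ^+ 2 / (k2 * s)) else 0.
pose c (j : 'I_n.+1) := if (j < k.+1)%N then - l / k2 + 16 * l ^+ 2 else 0.
have mf j : measurable_fun setT (f j).
  rewrite /f; case: (j < k.+1)%N => //.
  apply: measurable_funM => //; apply: measurable_funM => //.
  by apply: measurable_funX; exact: measurable_tdot.
apply: (@le_trans _ _ (P [set w | (- (l * k.+1%:R / (2 * k2)) <=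
    \sum_j f j (Xs j w))%R])); last first.
  apply: le_trans (chernoff_independent (c := c) _ _ ind mf _) _.
  - by move=> j; exact: measurable_funP.
  - move=> j; rewrite /f /c; case: (j < k.+1)%N; last first.
      by rewrite expR0 integral_cst// mul1e; exact: probability_le1.
    pose h (x : p.-tuple R) := expR (- l * (tdot x (unitv R i) ^+ 2 / (k2 * s))).
    rewrite (@integral_same_law _ _ _ _ _ _ _ P (Xs j) P0 X h)//.
    + have := @subgaussian_lower_mgf _ _ _ P0 K p X (unitv R i) l K0 sX sgX.
      by rewrite bform_unitv => /(_ S0 l0).
    + apply: measurableT_comp => //.
      apply: measurable_funM => //; apply: measurable_funM => //.
      by apply: measurable_funX; exact: measurable_tdot.
    + by move=> x; rewrite expR_ge0.
  rewrite lee_fin ler_expR -big_mkcond/=.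
  rewrite -(big_ord_widen n.+1 (fun=> - l / k2 + 16 * l ^+ 2)) ?ltnS ?(ltnW (ltn_ord k))//.
  rewrite sumr_const card_ord -[_ *+ k.+1]mulr_natl.
  rewrite (_ : (K + 1) ^+ 4 = k2 ^+ 2); last by rewrite -exprM.
  rewrite le_eqVlt; apply/orP; left; apply/eqP.
  by rewrite /l; field; rewrite gt_eqF.
apply: le_measure; rewrite ?inE.
- apply: measurable_le_set => //; under eq_fun do rewrite big_mkcond/=.
  apply: measurable_sum => j; case: (j < k.+1)%N => //; apply: measurable_funX.
  exact: (measurable_comp_RV (Xs j) (measurable_tnth _)).
- apply: measurable_le_set => //; apply: measurable_sum => j.
  exact: (measurable_comp_RV (Xs j) (mf j)).
move=> w /= h.
rewrite /f -big_mkcond/=; under eq_bigr do rewrite tdot_unitv.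
rewrite -mulr_sumr -mulr_suml mulNr lerN2.
rewrite -mulrA ler_wpM2l// ler_pdivrMr ?mulr_gt0//.
apply: le_trans h _; rewrite le_eqVlt; apply/orP; left; apply/eqP.
by field; rewrite gt_eqF.
Qed.

Lemma sum_inv_sqr_le (R : realType) (n : nat) :
  \sum_(k < n) (k.+1%:R ^+ 2)^-1 <= 2 :> R.
Proof.
case: n => [|n]; first by rewrite big_ord0.
(* Strengthened by [- 1 / (n + 1)], so that the induction telescopes. *)
suff : \sum_(k < n.+1) (k.+1%:R ^+ 2)^-1 <= 2 - n.+1%:R^-1 :> R.
  by move/le_trans; apply; rewrite gerBl.
elim: n => [|n IH]; first by rewrite big_ord1 expr1n invr1; lra.
rewrite big_ord_recr/=; apply: le_trans (lerD IH (lexx _)) _.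
rewrite -[n.+2%:R]natr1; set x : R := n.+1%:R.
have x0 : 0 < x by rewrite ltr0n.
rewrite -subr_ge0.
rewrite (_ : _ - _ = (x * (x + 1) ^+ 2)^-1); last first.
  by field; rewrite !gt_eqF// addr_gt0.
by rewrite invr_ge0 mulr_ge0 ?ltW// exprn_gt0// addr_gt0.
Qed.

(** An exceedance has probability at most [2 / (k + 1) ^ 2], and the exponential of an indicator is
    at most 1 plus 3 times it, so the exponential moment is at most [exp (6 / (k + 1) ^ 2)]. The
    inverse squares sum to at most 2, whence the 12. *)
Lemma sample_exceedance_count d0 (T0 : measurableType d0) (R : realType)
    (P0 : probability T0 R) (K : R) (p n : nat) (X : {RV P0 >-> p.-tuple R})
    d (T : measurableType d) (P : probability T R)
    (Xs : 'I_n.+1 -> {RV P >-> p.-tuple R}) (i : 'I_p) (u : R) :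
  0 < K -> square_integrable P0 X -> subgaussian P0 K X ->
  (forall j, same_law P (Xs j) P0 X) ->
  mutually_independent P (fun j => Xs j : T -> p.-tuple R) ->
  (P [set w | (12 + u <= \sum_(k < n) (2 * ln k.+1%:R *
       ((K + 1) ^+ 2 * covmx P0 X i i) < tnth (Xs (lift ord0 k) w) i ^+ 2)%R%:R)%R] <=
   (expR (- u))%:E)%E.
Proof.
move=> K0 sX sgX law ind; set v := (K + 1) ^+ 2 * _.
pose g (k : 'I_n) (x : p.-tuple R) : R :=
  (2 * ln k.+1%:R * v < tnth x i ^+ 2)%R%:R.
have mgb k : measurable [set x : p.-tuple R | 2 * ln k.+1%:R * v < tnth x i ^+ 2].
  by apply: measurable_lt_set => //; apply: measurable_funX; exact: measurable_tnth.
have gE k : g k = \1_[set x : p.-tuple R | 2 * ln k.+1%:R * v < tnth x i ^+ 2].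
  apply/funext => x; rewrite /g indicE; congr ((nat_of_bool _)%:R); apply/idP/idP => [h|].
    by apply/mem_set.
  by move/set_mem.
have mg k : measurable_fun setT (g k) by rewrite gE; exact: measurable_indic.
(* Sample 0 is not counted; it receives the constant 0 so that the independence of the whole family
   applies as it stands. *)
pose f (j : 'I_n.+1) x := if unlift ord0 j is Some k then g k x else 0.
pose c (j : 'I_n.+1) : R := if unlift ord0 j is Some k then 6 * (k.+1%:R ^+ 2)^-1 else 0.
have mf j : measurable_fun setT (f j) by rewrite /f; case: (unlift _ _).
have E w : \sum_j f j (Xs j w) = \sum_(k < n) g k (Xs (lift ord0 k) w).
  rewrite big_ord_recl {1}/f unlift_none add0r.
  by apply: eq_bigr => k _; rewrite /f liftK.
have -> : [set w | 12 + u <= \sum_(k < n) (2 * ln k.+1%:R * v <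
     tnth (Xs (lift ord0 k) w) i ^+ 2)%R%:R] =
   [set w | 12 + u <= \sum_j f j (Xs j w)].
  by apply/seteqP; split => w /=; rewrite E.
apply: le_trans (chernoff_independent (c := c) _ _ ind mf _) _.
- by move=> j; exact: measurable_funP.
- move=> j; rewrite /f /c; case: (unlift _ _) => [k|]; last first.
    by rewrite expR0 integral_cst// mul1e; exact: probability_le1.
  set A := [set w | (2 * ln k.+1%:R * v < tnth (Xs j w) i ^+ 2)%R].
  have mA : measurable A.
    apply: measurable_lt_set => //; apply: measurable_funX.
    exact: (measurable_comp_RV (Xs j) (measurable_tnth i)).
  have PA : (P A <= (2 * expR (- (2 * ln k.+1%:R)))%:E)%E.
    exact: sample_tail (law j).
  apply: (@le_trans _ _ (\int[P]_w (1%:E + 3%:E * (\1_A w)%:E))%E).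
    apply: ge0_le_integral => //.
    + apply/measurable_EFinP; apply: measurableT_comp => //.
      exact: (measurable_comp_RV (Xs j) (mg k)).
    + apply: emeasurable_funD => //; apply: measurable_funeM.
      by apply/measurable_EFinP; exact: measurable_indic.
    + move=> w _; rewrite -EFinM -EFinD lee_fin gE !indicE.
      have -> : (Xs j w \in [set x : p.-tuple R | 2 * ln k.+1%:R * v < tnth x i ^+ 2])
          = (w \in A) by apply/idP/idP => /set_mem h; apply/mem_set.
      case: (w \in A); last by rewrite /= expR0 mulr0 addr0.
      by have := @expR_le_quadratic R 1 (lexx _); rewrite /=; lra.
  rewrite ge0_integralD//; last first.
    by apply: measurable_funeM; apply/measurable_EFinP; exact: measurable_indic.
  rewrite integral_cst// [X in (X + _)%E](_ : _ = 1%E); last first.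
    by rewrite mul1e; exact: probability_setT.
  rewrite ge0_integralZl_EFin//; last first.
    by apply/measurable_EFinP; exact: measurable_indic.
  rewrite integral_indic// setIT.
  apply: (@le_trans _ _ (1%:E + 3%:E * (2 * expR (- (2 * ln k.+1%:R)))%:E)%E).
    by rewrite leeD2l// lee_wpmul2l// lee_fin.
  rewrite -EFinM -EFinD lee_fin.
  have -> : expR (- (2 * ln k.+1%:R)) = (k.+1%:R ^+ 2)^-1 :> R.
    by rewrite expRN expRM_natl lnK// posrE ltr0n.
  move: (k.+1%:R ^+ 2)^-1 => y; have := expR_ge1Dx (6 * y); lra.
rewrite lee_fin ler_expR big_ord_recl {1}/c unlift_none add0r.
under eq_bigr do rewrite /c liftK.
rewrite -mulr_sumr; have := sum_inv_sqr_le R n; lra.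
Qed.

Lemma sample_bernstein d0 (T0 : measurableType d0) (R : realType)
    (P0 : probability T0 R) (K : R) (p n : nat) (X : {RV P0 >-> p.-tuple R})
    d (T : measurableType d) (P : probability T R)
    (Xs : 'I_n.+1 -> {RV P >-> p.-tuple R}) (z z' : 'I_p -> R) (b t : R) :
  0 < K -> square_integrable P0 X -> subgaussian P0 K X ->
  (forall j, same_law P (Xs j) P0 X) ->
  mutually_independent P (fun j => Xs j : T -> p.-tuple R) ->
  (0 < n)%N -> 0 < t ->
  0 < b -> bform (covmx P0 X) z z <= b -> bform (covmx P0 X) z' z' <= b ->
  (P [set w | (((K + 1) ^+ 2 * (65 * Num.sqrt (n%:R * t) + 130 * t)) * b <=
       \sum_(k < n) (tdot (Xs (lift ord0 k) w) z * tdot (Xs (lift ord0 k) w) z'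
                     - bform (covmx P0 X) z z'))%R] <=
   (expR (- t))%:E)%E.
Proof.
move=> K0 sX sgX law ind n0 t0 b0 zb zb'; set s := bform _ z z'.
set k2 := (K + 1) ^+ 2.
have K1 : 0 < K + 1 by rewrite addr_gt0.
have k20 : 0 < k2 by rewrite exprn_gt0.
have kb0 : 0 < k2 * b by rewrite mulr_gt0.
have nR : (0 : R) < n%:R by rewrite ltr0n.
(* The choice is [sqrt (t / n)] if this is at most 1/2, and 1/2 otherwise. In the first case the
   quadratic term is [64 t] against [65 t]; in the second it is below [64 t], against
   [130 t / 2]. *)
have [l [l0 l2 lE]] : exists l : R, [/\ 0 < l, l <= 2^-1 &
    64 * l ^+ 2 * n%:R - l * (65 * Num.sqrt (n%:R * t) + 130 * t) <= - t].
  have sq : Num.sqrt (n%:R * t) ^+ 2 = n%:R * t by rewrite sqr_sqrtr// mulr_ge0// ltW.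
  have [tn|tn] := leP (4 * t) n%:R; last first.
    exists 2^-1; split; [lra|lra|].
    have := sqrtr_ge0 (n%:R * t); lra.
  have st0 : 0 < Num.sqrt (n%:R * t) by rewrite sqrtr_gt0 mulr_gt0.
  set q := Num.sqrt _ in sq st0 *.
  exists (q / n%:R); split; first by rewrite divr_gt0.
    rewrite ler_pdivrMr//; nra.
  rewrite (_ : 64 * _ * _ = 64 * t); last first.
    by rewrite exprMn sq; field; rewrite gt_eqF.
  rewrite (_ : q / n%:R * _ = 65 * t + 130 * (q * t / n%:R)); last first.
    rewrite (_ : 65 * t = 65 * (n%:R * t) / n%:R); last by field; rewrite gt_eqF.
    by rewrite -sq; field; rewrite gt_eqF.
  have : 0 <= q * t / n%:R by rewrite divr_ge0 ?mulr_ge0// ltW.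
  lra.
pose g (x : p.-tuple R) : R := l * ((tdot x z * tdot x z' - s) / (k2 * b)).
have mg : measurable_fun setT g.
  apply: measurable_funM => //; apply: measurable_funM => //.
  apply: measurable_funB => //.
  by apply: measurable_funM; exact: measurable_tdot.
pose f (j : 'I_n.+1) x := if unlift ord0 j is Some k then g x else 0.
pose c (j : 'I_n.+1) : R := if unlift ord0 j is Some k then 64 * l ^+ 2 else 0.
have mf j : measurable_fun setT (f j) by rewrite /f; case: (unlift _ _).
have E w : \sum_j f j (Xs j w) = l / (k2 * b) * \sum_(k < n)
    (tdot (Xs (lift ord0 k) w) z * tdot (Xs (lift ord0 k) w) z' - s).
  rewrite big_ord_recl {1}/f unlift_none add0r mulr_sumr.
  by apply: eq_bigr => k _; rewrite /f liftK /g mulrCA [RHS]mulrC mulrCA -mulrA.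
have -> : [set w | k2 * (65 * Num.sqrt (n%:R * t) + 130 * t) * b <=
    \sum_(k < n) (tdot (Xs (lift ord0 k) w) z * tdot (Xs (lift ord0 k) w) z' - s)] =
   [set w | l * (65 * Num.sqrt (n%:R * t) + 130 * t) <= \sum_j f j (Xs j w)].
  have lkb : 0 < l / (k2 * b) by rewrite divr_gt0.
  have H w : (k2 * (65 * Num.sqrt (n%:R * t) + 130 * t) * b <= \sum_(k < n)
      (tdot (Xs (lift ord0 k) w) z * tdot (Xs (lift ord0 k) w) z' - s)) =
      (l * (65 * Num.sqrt (n%:R * t) + 130 * t) <= \sum_j f j (Xs j w)).
    rewrite E -(ler_pM2l lkb); congr (_ <= _).
    by field; rewrite !gt_eqF.
  by apply/seteqP; split => w /=; rewrite H.
apply: le_trans (chernoff_independent (c := c) _ _ ind mf _) _.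
- by move=> j; exact: measurable_funP.
- move=> j; rewrite /f /c; case: (unlift _ _) => [k|]; last first.
    by rewrite expR0 integral_cst// mul1e; exact: probability_le1.
  rewrite (@integral_same_law _ _ _ _ _ _ _ P (Xs j) P0 X (fun x => expR (g x)))//.
  + apply: subgaussian_bernstein => //.
    by rewrite gtr0_norm.
  + exact: measurableT_comp.
rewrite lee_fin ler_expR big_ord_recl {1}/c unlift_none add0r.
under eq_bigr do rewrite /c liftK.
by rewrite sumr_const card_ord -[_ *+ n]mulr_natr.
Qed.

(** * Dithering *)

Definition clip (R : realType) (x l : R) : R := Num.max (- l) (Num.min x l).

Lemma normr_clip (R : realType) (x l : R) : 0 <= l -> `|clip x l| <= l.
Proof.
move=> l0; rewrite ler_norml /clip le_max lexx/= ge_max ge_min lexx orbT andbT.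
by lra.
Qed.

Lemma clip_id (R : realType) (x l : R) : `|x| <= l -> clip x l = x.
Proof.
rewrite ler_norml => /andP[h1 h2]; rewrite /clip (min_idPl h2).
exact/max_idPr.
Qed.

Lemma normr_sub_clip (R : realType) (x l : R) : 0 <= l -> `|x - clip x l| <= `|x|.
Proof.
move=> l0; rewrite /clip; case: (lerP x l) => xl.
  case: (lerP (- l) x) => h; first by rewrite subrr normr0.
  rewrite !ler0_norm; lra.
case: (lerP (- l) l) => h; last lra.
rewrite !ger0_norm; lra.
Qed.

Lemma normr_clip_le (R : realType) (x l : R) : 0 <= l -> `|clip x l| <= `|x|.
Proof.
move=> l0; rewrite /clip; case: (lerP x l) => xl.
  case: (lerP (- l) x) => h; first by [].
  rewrite !ler0_norm; lra.
case: (lerP (- l) l) => h; last lra.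
rewrite !ger0_norm; lra.
Qed.

(** The sign is 1 exactly when [u >= - x / l]; the probability of this is half the length of an
    interval cut by [[-1, 1]], and the cut is what turns [x] into its clipping. *)
Lemma uniform_sign_mean (R : realType) (x l : R) : 0 <= l ->
  l * (2 * fine (uniform_prob (@ltrN11 R) [set u | 0 <= x + l * u]) - 1) = clip x l.
Proof.
move=> l0; have [->|ln0] := eqVneq l 0.
  rewrite mul0r /clip oppr0; apply/esym/max_idPl.
  by rewrite ge_min lexx orbT.
have lp : 0 < l by rewrite lt_def ln0.
set U := [set u | _].
have UE u : U u <-> - x / l <= u.
  rewrite /U /= ler_pdivrMr// mulrC; split => h; lra.
have [h1|h1] := leP (- x / l) (-1).
  rewrite /uniform_prob (integral_uniform_pdf1 (ltrN11 R)); last first.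
    by move=> u /=; rewrite in_itv/= => /andP[u1 _]; apply/UE; exact: le_trans u1.
  rewrite /= /clip; have lx : l <= x by move: h1; rewrite ler_pdivrMr//; lra.
  rewrite (min_idPr lx); rewrite (max_idPr _); lra.
have [h2|h2] := leP (- x / l) 1; last first.
  rewrite /uniform_prob integral_uniform_pdf.
  rewrite (_ : U `&` _ = set0); last first.
    apply/seteqP; split => u //= -[/UE u1]; rewrite in_itv/= => /andP[_ u2].
    by move: (lt_le_trans h2 (le_trans u1 u2)); rewrite ltxx.
  rewrite integral_set0/= /clip.
  have lx : x <= - l by move: h2; rewrite ltr_pdivlMr//; lra.
  rewrite (min_idPl _); last lra.
  rewrite (max_idPl _); lra.
rewrite /uniform_prob integral_uniform_pdf.
rewrite (_ : U `&` _ = `[- x / l, 1]%classic); last first.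
  apply/seteqP; split => u /=; rewrite !in_itv/=.
    by move=> [/UE ->/= /andP[_ ->]].
  by move=> /andP[u1 ->]; split; [exact/UE|rewrite (le_trans (ltW h1) u1)].
rewrite (eq_integral (fun=> (2^-1)%:E)); last first.
  move=> u; rewrite inE/= in_itv/= => /andP[u1 u2].
  by rewrite /uniform_pdf u2 (le_trans (ltW h1) u1)/= opprK.
rewrite integral_cst//= lebesgue_measure_itv/= lte_fin.
have E : l * (- (- x / l)) = x by field.
have xl : x < l by move: h1; rewrite ltr_pdivlMr//; lra.
have lx : - l <= x by move: h2; rewrite ler_pdivrMr//; lra.
rewrite /clip (min_idPl (ltW xl)) (max_idPr lx).
(* When [- x / l = 1] the interval is a point, and the length formula takes its other branch. *)
case: ltP => h3 /=; first by field.
have {h2 h3} h : - x / l = 1 by apply/le_anti; rewrite h2 h3.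
rewrite mulr0; move: E; rewrite h; lra.
Qed.

Definition up_prob (R : realType) (x l : R) (b : bool) : R :=
  let q := fine (uniform_prob (@ltrN11 R) [set u | 0 <= x + l * u]) in
  if b then q else 1 - q.

Lemma measurable_up (R : realType) (x l : R) :
  measurable [set u : R | 0 <= x + l * u].
Proof.
by apply: measurable_le_set => //; apply: measurable_funD => //; exact: measurable_funM.
Qed.

Lemma up_probE (R : realType) (x l : R) (b : bool) :
  uniform_prob (@ltrN11 R) [set u | (0 <= x + l * u)%R = b] = (up_prob x l b)%:E.
Proof.
rewrite /up_prob; set U := [set u | 0 <= x + l * u].
have mU : measurable U by exact: measurable_up.
have fU : uniform_prob (@ltrN11 R) U \is a fin_num by exact: fin_num_measure.
case: b; first by rewrite fineK//; congr uniform_prob.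
rewrite EFinB fineK//.
rewrite (_ : [set u | _] = ~` U); first exact: probability_setC.
by apply/seteqP; split => u; rewrite /U /=; [move=> ->|move=> /negP/negbTE].
Qed.

Lemma up_prob_ge0 (R : realType) (x l : R) (b : bool) : 0 <= up_prob x l b.
Proof. by rewrite -lee_fin -up_probE measure_ge0. Qed.

Lemma up_prob_sum (R : realType) (x l : R) : \sum_b up_prob x l b = 1.
Proof. by rewrite big_bool /up_prob /= addrC subrK. Qed.

(** Centered at the clipping, the exact mean of the one-bit value, so that the clipping error
    remains a deterministic quantity once the sample is fixed. *)
Definition noise (R : realType) (x l : R) (b : bool) : R :=
  (if b then l else - l) - clip x l.

Lemma noise_mean (R : realType) (x l : R) : 0 <= l ->
  \sum_b up_prob x l b * noise x l b = 0.
Proof.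
move=> l0; rewrite big_bool /up_prob /noise /= -(uniform_sign_mean x l0).
by set q := fine _; ring.
Qed.

Lemma noise_sqr_le (R : realType) (x l : R) (b : bool) : 0 <= l ->
  noise x l b ^+ 2 <= 4 * l ^+ 2.
Proof.
move=> l0; rewrite /noise; have := normr_clip x l0.
by rewrite ler_norml => /andP[h1 h2]; case: b; nra.
Qed.

(** Each pair of sign patterns is a box event for the dithers, whose probability is an exact product
    over indices, coordinates and both families. This is how the dithers are replaced by a finite
    weighted sum over patterns. *)
Lemma dither_patterns d (T : measurableType d) (R : realType)
    (P : probability T R) (n p : nat)
    (tau taub : 'I_n -> {RV P >-> p.-tuple R}) (x l : 'I_n * 'I_p -> R)
    (Q : pred ({ffun 'I_n * 'I_p -> bool} * {ffun 'I_n * 'I_p -> bool})) :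
  (forall k, uniform_cube P (tau k)) -> (forall k, uniform_cube P (taub k)) ->
  mutually_independent P
    (fun s : 'I_n + 'I_n =>
       (match s with inl k => tau k | inr k => taub k end) : T -> p.-tuple R) ->
  let sg (t : 'I_n -> {RV P >-> p.-tuple R}) w :=
    [ffun c => 0 <= x c + l c * tnth (t c.1 w) c.2] in
  measurable [set w | Q (sg tau w, sg taub w)] /\
  (P [set w | Q (sg tau w, sg taub w)] <=
   (\sum_(s | Q s) (\prod_c up_prob (x c) (l c) (s.1 c)) *
                   (\prod_c up_prob (x c) (l c) (s.2 c)))%:E)%E.
Proof.
move=> utau utaub ind sg.
pose V (s : {ffun 'I_n * 'I_p -> bool}) k i := [set u | (0 <= x (k, i) + l (k, i) * u)%R = s (k, i)].
have mV s k i : measurable (V s k i).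
  rewrite /V; case: (s (k, i)); first exact: measurable_up.
  rewrite (_ : [set u | _] = ~` [set u | 0 <= x (k, i) + l (k, i) * u]).
    by apply: measurableC; exact: measurable_up.
  by apply/seteqP; split => u /=; [move=> ->|move=> /negP/negbTE].
pose box s k := [set t : p.-tuple R | forall i, V s k i (tnth t i)].
have mbox s k : measurable (box s k).
  rewrite (_ : box s k = \bigcap_(i in [set: 'I_p]) (@tnth p R)^~ i @^-1` V s k i).
    apply: fin_bigcap_measurable => // i _; rewrite -[X in measurable X]setTI.
    exact: measurable_tnth.
  by apply/seteqP; split => t /=; [move=> h i _; exact: h|move=> h i; exact: (h i I)].
have sgP (t : 'I_n -> {RV P >-> p.-tuple R}) w s :
    sg t w = s <-> forall k, box s k (t k w).
  split => [<- k i|h]; first by rewrite /V /= ffunE.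
  by apply/ffunP => -[k i]; rewrite ffunE /=; exact: (h k i).
pose B (s : {ffun 'I_n * 'I_p -> bool} * {ffun 'I_n * 'I_p -> bool}) :=
  [set w | sg tau w = s.1 /\ sg taub w = s.2].
pose C (s : {ffun 'I_n * 'I_p -> bool} * {ffun 'I_n * 'I_p -> bool}) (c : 'I_n + 'I_n) :=
  match c with inl k => box s.1 k | inr k => box s.2 k end.
have mC s c : measurable (C s c) by case: c => k; exact: mbox.
pose t (c : 'I_n + 'I_n) : T -> p.-tuple R :=
  match c with inl k => tau k | inr k => taub k end.
have mt c : measurable_fun setT (t c) by case: c => k; exact: measurable_funP.
have BE s : B s = \bigcap_(c in [set` [set: 'I_n + 'I_n]%SET]) (t c @^-1` C s c).
  apply/seteqP; split => w /=.
    by move=> [/sgP h1 /sgP h2] [] k _; [exact: h1|exact: h2].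
  move=> h; split; apply/sgP => k; [apply: (h (inl k))|apply: (h (inr k))];
    by rewrite /= inE.
have mB s : measurable (B s).
  rewrite BE; apply: fin_bigcap_measurable => // c _.
  by rewrite -[X in measurable X]setTI; exact: mt.
have PB s : P (B s) = ((\prod_c up_prob (x c) (l c) (s.1 c)) *
                   (\prod_c up_prob (x c) (l c) (s.2 c)))%:E.
  rewrite BE ind//.
  have H (u : 'I_n -> {RV P >-> p.-tuple R}) (s' : {ffun 'I_n * 'I_p -> bool}) :
      (forall k, uniform_cube P (u k)) ->
      (\prod_(k < n) P (u k @^-1` box s' k) = (\prod_c up_prob (x c) (l c) (s' c))%:E)%E.
    move=> uu; rewrite -prodEFin.
    transitivity (\prod_(k < n) \prod_(i < p) (up_prob (x (k, i)) (l (k, i)) (s' (k, i)))%:E)%E.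
      apply: eq_bigr => k _; rewrite (uu k (V s' k))//.
      by apply: eq_bigr => i _; rewrite -up_probE.
    by rewrite pair_bigA/=; apply: eq_bigr => -[].
  rewrite EFinM -(H _ _ utau) -(H _ _ utaub) big_sumType.
  by congr (_ * _)%E; apply: eq_big => // k; rewrite inE.
have -> : [set w | Q (sg tau w, sg taub w)] = [set w | exists2 s, Q s & B s w].
  apply/seteqP; split => w /=; first by move=> h; exists (sg tau w, sg taub w).
  by move=> [[s1 s2] h [/= -> ->]].
by apply: finite_union_bound => // s _; rewrite PB.
Qed.

(** * The event of good samples *)

(** The added multiple of the identity only doubles the trace, and when the trace is positive it
    makes the form vanish at [z = 0] alone. Bernstein's inequality needs a positive scale; where the
    scale vanishes the empirical form is now zero for every sample, and not just almost surely. *)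
Definition net_form (R : realType) (p : nat) (S : 'I_p -> 'I_p -> R)
    (z : 'I_p -> R) : R :=
  bform S z z + (\sum_i S i i) / p%:R * \sum_i z i ^+ 2.

(* The second clause makes the running second moment, hence the dithering scale,
   large from a time of order [theta] on; the third counts the samples which that
   scale would clip; the last is the empirical covariance on the Maurey net. *)
Definition good_sample (R : realType) (n p m : nat) (K theta : R)
    (S : 'I_p -> 'I_p -> R) (x : 'I_n.+1 -> p.-tuple R) : Prop :=
  [/\ forall j i, tnth (x j) i ^+ 2 <= 3 * theta * ((K + 1) ^+ 2 * S i i),
      forall i (k : 'I_n), 0 < S i i -> 768 * (K + 1) ^+ 4 * theta <= k.+1%:R ->
        k.+1%:R * S i i / 2 < \sum_(j < n.+1 | (j < k.+1)%N) tnth (x j) i ^+ 2,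
      forall i, \sum_(k < n) (2 * ln k.+1%:R * ((K + 1) ^+ 2 * S i i) <
        tnth (x (lift ord0 k)) i ^+ 2)%R%:R < 12 + 3 * theta &
      forall f g : {ffun 'I_m -> atom p},
        let z := atom_mean R f in let z' := atom_mean R g in
        let t := 3 * theta * m%:R in let b := net_form S z + net_form S z' in
        0 < b ->
        \sum_(k < n) (tdot (x (lift ord0 k)) z * tdot (x (lift ord0 k)) z'
                     - bform S z z') <
        ((K + 1) ^+ 2 * (65 * Num.sqrt (n%:R * t) + 130 * t)) * b].

(** Each clause fails with probability at most [exp (- 2 theta)]. For the first three a single
    failure costs at most [2 exp (- 3 theta)], and [p ^ 2 n ^ 2 <= exp theta] absorbs the union
    together with the 2. The net clause carries [m] in its exponent to pay for its [p ^ (8 m)]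
    pairs. *)
Lemma good_sample_prob d0 (T0 : measurableType d0) (R : realType)
    (P0 : probability T0 R) (K theta : R) (p n m : nat)
    (X : {RV P0 >-> p.-tuple R})
    d (T : measurableType d) (P : probability T R)
    (Xs : 'I_n.+1 -> {RV P >-> p.-tuple R}) :
  0 < K -> square_integrable P0 X -> subgaussian P0 K X ->
  (forall j, same_law P (Xs j) P0 X) ->
  mutually_independent P (fun j => Xs j : T -> p.-tuple R) ->
  (1 < n)%N -> (1 < p)%N -> (0 < m)%N -> 4 <= theta ->
  p%:R <= expR (theta / 8) -> n%:R <= expR (theta / 8) ->
  let G := [set x : (n.+1).-tuple (p.-tuple R) |
              good_sample m K theta (covmx P0 X) (tnth x)] in
  measurable G /\
  ((1 - expR (- theta))%:E <= P ((fun w => [tuple Xs j w | j < n.+1]) @^-1` G))%E.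
Proof.
move=> K0 sX sgX law ind n1 p1 m0 th4 hp hn G.
pose S := covmx P0 X.
have K1 : 0 < K + 1 by rewrite addr_gt0.
have th0 : 0 < theta by lra.
pose U w := [tuple Xs j w | j < n.+1].
have mU : measurable_fun setT U.
  apply/measurable_fun_tnthP => j.
  rewrite (_ : _ \o _ = Xs j); first exact: measurable_funP.
  by apply/funext => w /=; rewrite tnth_mktuple.
(* The law of the tuple of samples, so that [G] is an event of the tuple space, over which the
   probabilities of sections can be integrated. *)
pose mu : probability ((n.+1).-tuple (p.-tuple R)) R := distribution P
  (HB.pack U (isMeasurableFun.Build _ _ _ _ U mU) : {RV P >-> _}).
have muE (A : set ((n.+1).-tuple (p.-tuple R))) : mu A = P (U @^-1` A) by [].
have mtn j i : measurable_fun setT (fun x : (n.+1).-tuple (p.-tuple R) => tnth (tnth x j) i).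
  exact: measurableT_comp (measurable_tnth i) (measurable_tnth j).
have mtd j z : measurable_fun setT (fun x : (n.+1).-tuple (p.-tuple R) => tdot (tnth x j) z).
  exact: measurableT_comp (measurable_tdot z) (measurable_tnth j).
pose B1 (c : 'I_n.+1 * 'I_p) := [set x : (n.+1).-tuple (p.-tuple R) |
  3 * theta * ((K + 1) ^+ 2 * S c.2 c.2) < tnth (tnth x c.1) c.2 ^+ 2].
pose B2 (c : 'I_p * 'I_n) := [set x : (n.+1).-tuple (p.-tuple R) |
  \sum_(j < n.+1 | (j < c.2.+1)%N) tnth (tnth x j) c.1 ^+ 2 <= c.2.+1%:R * S c.1 c.1 / 2].
pose B3 (i : 'I_p) := [set x : (n.+1).-tuple (p.-tuple R) |
  12 + 3 * theta <= \sum_(k < n) (2 * ln k.+1%:R * ((K + 1) ^+ 2 * S i i) <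
        tnth (tnth x (lift ord0 k)) i ^+ 2)%R%:R].
pose t := 3 * theta * m%:R.
pose b (c : {ffun 'I_m -> atom p} * {ffun 'I_m -> atom p}) :=
  net_form S (atom_mean R c.1) + net_form S (atom_mean R c.2).
pose B4 (c : {ffun 'I_m -> atom p} * {ffun 'I_m -> atom p}) :=
  [set x : (n.+1).-tuple (p.-tuple R) |
   (K + 1) ^+ 2 * (65 * Num.sqrt (n%:R * t) + 130 * t) * b c <=
   \sum_(k < n) (tdot (tnth x (lift ord0 k)) (atom_mean R c.1) *
                 tdot (tnth x (lift ord0 k)) (atom_mean R c.2)
                     - bform S (atom_mean R c.1) (atom_mean R c.2))].
have mB1 c : measurable (B1 c).
  by apply: measurable_lt_set => //; exact: measurable_funX.
have mB2 c : measurable (B2 c).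
  apply: measurable_le_set => //; under eq_fun do rewrite big_mkcond/=.
  apply: measurable_sum => j; case: (j < c.2.+1)%N => //.
  exact: measurable_funX.
have mB3 c : measurable (B3 c).
  apply: measurable_le_set => //; apply: measurable_sum => k.
  set A := [set x : (n.+1).-tuple (p.-tuple R) | 2 * ln k.+1%:R * ((K + 1) ^+ 2 * S c c) <
        tnth (tnth x (lift ord0 k)) c ^+ 2].
  rewrite (_ : (fun x => _) = \1_A).
    by apply: measurable_indic; apply: measurable_lt_set => //; exact: measurable_funX.
  apply/funext => x; rewrite indicE; congr ((nat_of_bool _)%:R).
  by apply/idP/idP => [h|/set_mem//]; apply/mem_set.
have mB4 c : measurable (B4 c).
  apply: measurable_le_set => //; apply: measurable_sum => k.
  by apply: measurable_funB => //; exact: measurable_funM.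
have PB1 c : (mu (B1 c) <= (2 * expR (- (3 * theta)))%:E)%E.
  rewrite muE.
  rewrite (_ : U @^-1` _ = [set w | 3 * theta * ((K + 1) ^+ 2 * S c.2 c.2) <
      tnth (Xs c.1 w) c.2 ^+ 2]); first exact: sample_tail (law _).
  by apply/seteqP; split => w; rewrite /B1 /U /= tnth_mktuple.
have PB2 (c : 'I_p * 'I_n) : (0 < S c.1 c.1) && (768 * (K + 1) ^+ 4 * theta <= c.2.+1%:R) ->
    (mu (B2 c) <= (expR (- (3 * theta)))%:E)%E.
  move=> /andP[S0 hk]; rewrite muE.
  rewrite (_ : U @^-1` _ = [set w | \sum_(j < n.+1 | (j < c.2.+1)%N) tnth (Xs j w) c.1 ^+ 2
      <= c.2.+1%:R * S c.1 c.1 / 2]); last first.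
    apply/funext => w; rewrite /B2 /U /preimage /=; congr (is_true (_ <= _)).
    by apply: eq_bigr => j _; rewrite tnth_mktuple.
  apply: le_trans (sample_lower_tail _ K0 sX sgX law ind S0) _.
  rewrite lee_fin ler_expR lerN2 ler_pdivlMr ?mulr_gt0 ?exprn_gt0//; lra.
have PB3 i : (mu (B3 i) <= (expR (- (3 * theta)))%:E)%E.
  rewrite muE.
  rewrite (_ : U @^-1` _ = [set w | 12 + 3 * theta <= \sum_(k < n)
     (2 * ln k.+1%:R * ((K + 1) ^+ 2 * S i i) <
        tnth (Xs (lift ord0 k) w) i ^+ 2)%R%:R]); first exact: sample_exceedance_count.
  apply/funext => w; rewrite /B3 /U /preimage /=; congr (is_true (_ <= _)).
  by apply: eq_bigr => k _; rewrite tnth_mktuple.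
have tr0 : 0 <= (\sum_i S i i) / p%:R.
  rewrite divr_ge0// sumr_ge0// => i _.
  by have := covmx_ge0 (unitv R i) sX; rewrite bform_unitv.
have nf_ge z : 0 <= bform S z z <= net_form S z.
  rewrite covmx_ge0//= /net_form lerDl mulr_ge0// sumr_ge0// => i _.
  exact: sqr_ge0.
have PB4 c : 0 < b c -> (mu (B4 c) <= (expR (- t))%:E)%E.
  move=> b0; rewrite muE.
  rewrite (_ : U @^-1` _ = [set w | (K + 1) ^+ 2 * (65 * Num.sqrt (n%:R * t) + 130 * t) * b c <=
   \sum_(k < n) (tdot (Xs (lift ord0 k) w) (atom_mean R c.1) *
                 tdot (Xs (lift ord0 k) w) (atom_mean R c.2)
                     - bform S (atom_mean R c.1) (atom_mean R c.2))]); last first.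
    apply/funext => w; rewrite /B4 /U /preimage /=; congr (is_true (_ <= _)).
    by apply: eq_bigr => k _; rewrite !tnth_mktuple.
  have := nf_ge (atom_mean R c.1); have := nf_ge (atom_mean R c.2).
  move=> /andP[h1 h2] /andP[h3 h4].
  apply: sample_bernstein => //.
  - exact: ltnW.
  - by rewrite mulr_gt0 ?ltr0n// mulr_gt0.
  - by apply: le_trans h4 _; rewrite lerDl; exact: le_trans h2.
  - by apply: le_trans h2 _; rewrite lerDr; exact: le_trans h4.
have [M1 Q1] := finite_union_bound (Q := predT) (fun c _ => mB1 c) (fun c _ => PB1 c).
have [M2 Q2] := finite_union_bound (fun c _ => mB2 c) PB2.
have [M3 Q3] := finite_union_bound (Q := predT) (fun c _ => mB3 c) (fun c _ => PB3 c).
have [M4 Q4] := finite_union_bound (fun c _ => mB4 c) PB4.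
set E1 := [set w | _] in M1 Q1.
set E2 := [set w | _] in M2 Q2.
set E3 := [set w | _] in M3 Q3.
set E4 := [set w | _] in M4 Q4.
have GE : G = ~` (E1 `|` E2 `|` (E3 `|` E4)).
  apply/seteqP; split => x.
    move=> [g1 g2 g3 g4] [[[c _]|[c /andP[c1 c2]]]|[[c _]|[c c0]]].
    - by rewrite /B1 /= ltNge g1.
    - by rewrite /B2 /= leNgt g2.
    - by rewrite /B3 /= leNgt g3.
    - by rewrite /B4 /= leNgt g4.
  rewrite /setC /= => h; split.
  - move=> j i; rewrite leNgt; apply/negP => hb; apply: h.
    by left; left; exists (j, i).
  - move=> i k S0 hk; rewrite ltNge; apply/negP => hb; apply: h.
    by left; right; exists (i, k) => //; rewrite S0.
  - move=> i; rewrite ltNge; apply/negP => hb; apply: h.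
    by right; left; exists i.
  - move=> f g /= b0; rewrite ltNge; apply/negP => hb; apply: h.
    by right; right; exists (f, g).
have mE : measurable (E1 `|` E2 `|` (E3 `|` E4)).
  by apply: measurableU; apply: measurableU.
split; first by rewrite GE; exact: measurableC.
rewrite -/(U) -(muE G) GE probability_setC// EFinB leeB//.
have p0R : (0 : R) <= p%:R by rewrite ler0n.
have n0R : (0 : R) <= n%:R by rewrite ler0n.
have p2R : (2 : R) <= p%:R by rewrite ler_nat.
have n2R : (2 : R) <= n%:R by rewrite ler_nat.
apply: (@le_trans _ _ (4 * expR (- (2 * theta)))%:E); last first.
  rewrite lee_fin.
  have -> : expR (- (2 * theta)) = expR (- theta) * expR (- theta).
    by rewrite -expRD; congr expR; ring.
  rewrite mulrA ler_piMl ?expR_ge0// expRN ler_pdivrMr ?expR_gt0// mul1r.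
  by have := expR_ge1Dx theta; lra.
have e3 : expR (- (3 * theta)) = expR (- (2 * theta)) * expR (- theta).
  by rewrite -expRD; congr expR; ring.
set a := expR (- theta) in e3 *; set a2 := expR (- (2 * theta)) in e3 *.
have a20 : 0 < a2 by exact: expR_gt0.
have a0 : 0 < a by exact: expR_gt0.
have pe : p%:R ^+ 2 * n%:R ^+ 2 * a <= 1.
  apply: (@le_trans _ _ (expR (theta / 8) ^+ 2 * expR (theta / 8) ^+ 2 * a)).
    rewrite ler_wpM2r ?(ltW a0)// ler_pM ?exprn_ge0// lerXn2r ?nnegrE ?expR_ge0//.
  rewrite -!expRM_natl -!expRD -[leRHS]expR0 ler_expR /a; lra.
have R1 : (mu E1 <= a2%:E)%E.
  apply: le_trans Q1 _; rewrite lee_fin sumr_const -[_ *+ _]mulr_natl.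
  rewrite (_ : #|_| = (n.+1 * p)%N); last by rewrite card_prod !card_ord.
  rewrite e3 natrM -natr1.
  apply: (@le_trans _ _ (p%:R ^+ 2 * n%:R ^+ 2 * a * a2)); last by rewrite ler_piMl// ltW.
  rewrite (_ : _ * (2 * _) = ((n%:R + 1) * p%:R * 2) * a * a2); last by ring.
  rewrite ler_wpM2r ?(ltW a20)// ler_wpM2r ?(ltW a0)//.
  by rewrite -mulrA [leRHS]mulrC ler_pM ?mulr_ge0 ?addr_ge0//; nra.
have R2 : (mu E2 <= a2%:E)%E.
  apply: le_trans Q2 _; rewrite lee_fin.
  apply: (@le_trans _ _ (\sum_(c : 'I_p * 'I_n) expR (- (3 * theta)))).
    rewrite [leRHS](bigID (fun c : 'I_p * 'I_n => (0 < S c.1 c.1) &&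
      (768 * (K + 1) ^+ 4 * theta <= c.2.+1%:R)))/= lerDl.
    by apply: sumr_ge0 => c _; rewrite expR_ge0.
  rewrite sumr_const -[_ *+ _]mulr_natl.
  rewrite (_ : #|_| = (p * n)%N); last by rewrite card_prod !card_ord.
  rewrite e3 natrM.
  apply: (@le_trans _ _ (p%:R ^+ 2 * n%:R ^+ 2 * a * a2)); last by rewrite ler_piMl// ltW.
  rewrite (_ : _ * (a2 * _) = (p%:R * n%:R) * a * a2); last by ring.
  rewrite ler_wpM2r ?(ltW a20)// ler_wpM2r ?(ltW a0)// ler_pM//; nra.
have R3 : (mu E3 <= a2%:E)%E.
  apply: le_trans Q3 _; rewrite lee_fin sumr_const -[_ *+ _]mulr_natl card_ord e3.
  apply: (@le_trans _ _ (p%:R ^+ 2 * n%:R ^+ 2 * a * a2)); last by rewrite ler_piMl// ltW.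
  rewrite (_ : _ * (a2 * _) = p%:R * a * a2); last by ring.
  rewrite ler_wpM2r ?(ltW a20)// ler_wpM2r ?(ltW a0)//.
  by rewrite -[leLHS]mulr1 ler_pM//; nra.
have R4 : (mu E4 <= a2%:E)%E.
  apply: le_trans Q4 _; rewrite lee_fin.
  apply: (@le_trans _ _ (\sum_(c : {ffun 'I_m -> atom p} * {ffun 'I_m -> atom p}) expR (- t))).
    rewrite [leRHS](bigID (fun c => 0 < b c))/= lerDl.
    by apply: sumr_ge0 => c _; rewrite expR_ge0.
  rewrite sumr_const -[_ *+ _]mulr_natl card_prod card_ffun card_ord.
  apply: (@le_trans _ _ (((p ^ 4) ^ m * (p ^ 4) ^ m)%:R * expR (- t))).
    rewrite ler_wpM2r ?expR_ge0// ler_nat.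
    by apply: leq_mul; rewrite leq_exp2r// card_atom.
  rewrite -expnD -expnM natrX addnn -mul2n.
  apply: (@le_trans _ _ (expR (theta / 8) ^+ (4 * (2 * m)) * expR (- t))).
    by rewrite ler_wpM2r ?expR_ge0// lerXn2r ?nnegrE ?expR_ge0.
  rewrite -expRM_natl -expRD ler_expR /t !natrM.
  have : (1 : R) <= m%:R by rewrite ler1n.
  nra.
apply: le_trans (measureU2 _ _ _) _; [exact: measurableU|exact: measurableU|].
apply: (@le_trans _ _ ((a2%:E + a2%:E) + (a2%:E + a2%:E))%E).
  by apply: leeD; (apply: le_trans (measureU2 _ _ _) _ => //; exact: leeD).
by rewrite -!EFinD lee_fin; lra.
Qed.

(** * The error for a fixed sample *)

Lemma cauchy_schwarz_sum (R : realType) (n : nat) (a b : 'I_n -> R) (U W : R) :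
  0 < U -> 0 < W -> \sum_k a k ^+ 2 <= U -> \sum_k b k ^+ 2 <= W ->
  \sum_k a k * b k <= Num.sqrt (U * W).
Proof.
move=> U0 W0 aU bW; set c := Num.sqrt (U * W).
have c0 : 0 < c by rewrite sqrtr_gt0 mulr_gt0.
have c2 : c ^+ 2 = U * W by rewrite sqr_sqrtr// ltW// mulr_gt0.
(* Weights that balance the two sums: each contributes at most [c]. *)
have H k : a k * b k <= (c / U * a k ^+ 2 + c / W * b k ^+ 2) / 2.
  have -> : c / W = U / c.
    have Wn : W != 0 by rewrite gt_eqF.
    have cn : c != 0 by rewrite gt_eqF.
    by apply/eqP; rewrite eqr_div// -expr2 c2.
  have := sqr_ge0 (c * a k - U * b k).
  have : 0 < (c * U)^-1 by rewrite invr_gt0 mulr_gt0.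
  move=> h1 /(mulr_ge0 (ltW h1)).
  have -> : (c * U)^-1 * (c * a k - U * b k) ^+ 2 =
      c / U * a k ^+ 2 + U / c * b k ^+ 2 - 2 * (a k * b k).
    by field; rewrite !gt_eqF.
  lra.
apply: le_trans (ler_sum _ (fun k _ => H k)) _.
rewrite -mulr_suml big_split/= -!mulr_sumr.
have h1 : c / U * \sum_k a k ^+ 2 <= c.
  apply: (@le_trans _ _ (c / U * U)); first by rewrite ler_wpM2l// ltW// divr_gt0.
  by rewrite divfK// gt_eqF.
have h2 : c / W * \sum_k b k ^+ 2 <= c.
  apply: (@le_trans _ _ (c / W * W)); first by rewrite ler_wpM2l// ltW// divr_gt0.
  by rewrite divfK// gt_eqF.
lra.
Qed.

Lemma half_ball_dot_sqr_le (R : realType) (p : nat) (a x : 'I_p -> R) :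
  half_ball x -> (\sum_i a i * x i) ^+ 2 <= \sum_i a i ^+ 2.
Proof.
move=> hx.
(* The increment [e] makes the bound on a possibly zero sum positive, as [cauchy_schwarz_sum]
   requires; it is sent to 0 at the end. *)
have H e : 0 < e -> `|\sum_i a i * x i| <= Num.sqrt ((\sum_i a i ^+ 2 + e) * 1).
  move=> e0; have A0 : 0 < \sum_i a i ^+ 2 + e.
    by rewrite ltr_wpDl// sumr_ge0// => i _; exact: sqr_ge0.
  have hx1 : \sum_i x i ^+ 2 <= 1 by move: hx; rewrite /half_ball; lra.
  rewrite ler_norml lerNl; apply/andP; split.
    rewrite -sumrN; under eq_bigr do rewrite -mulNr.
    apply: cauchy_schwarz_sum => //.
    by under eq_bigr do rewrite sqrrN; rewrite lerDl ltW.
  by apply: cauchy_schwarz_sum => //; rewrite lerDl ltW.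
apply/ler_addgt0Pr => e e0.
have := H e e0; rewrite mulr1 -(real_normK (num_real (\sum_i _))) => h.
have A0 : 0 <= \sum_i a i ^+ 2 + e.
  by rewrite addr_ge0 ?(ltW e0)// sumr_ge0// => i _; exact: sqr_ge0.
by rewrite -(sqr_sqrtr A0) lerXn2r ?nnegrE ?sqrtr_ge0.
Qed.

(** Duality: the form is tested on its own vector of values, scaled to norm 1/2. *)
Lemma sum_sqr_of_noise_form (R : realType) (n p : nat)
    (g : 'I_n * 'I_p -> bool -> R) (s : {ffun 'I_n * 'I_p -> bool}) (h : R)
    (y : 'I_p -> R) :
  0 <= h ->
  (forall x : 'I_n -> R, half_ball x ->
     noise_form g (fun k j => (j == k)%:R) s x y <= h) ->
  \sum_k (\sum_i g (k, i) (s (k, i)) * y i) ^+ 2 <= 4 * h ^+ 2.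
Proof.
move=> h0 H; set u := fun k => \sum_i g (k, i) (s (k, i)) * y i.
have E x : noise_form g (fun k j => (j == k)%:R) s x y = \sum_k x k * u k.
  apply: eq_bigr => k _; congr (_ * _); rewrite (bigD1 k)//= eqxx mul1r.
  by rewrite big1 ?addr0// => j /negbTE ->; rewrite mul0r.
set Z := \sum_k u k ^+ 2.
have Z0 : 0 <= Z by apply: sumr_ge0 => k _; exact: sqr_ge0.
have [->|Zn] := eqVneq Z 0; first by rewrite mulr_ge0// sqr_ge0.
have q0 : 0 < Num.sqrt Z by rewrite sqrtr_gt0 lt_def Zn.
have q2 : Num.sqrt Z ^+ 2 = Z by rewrite sqr_sqrtr.
set q := Num.sqrt Z in q0 q2.
have := H (fun k => u k / (2 * q)); rewrite E.
have -> : \sum_k u k / (2 * q) * u k = q / 2.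
  rewrite (eq_bigr (fun k => (2 * q)^-1 * u k ^+ 2)) => [|k _]; last by ring.
  by rewrite -mulr_sumr -/Z -q2; field; rewrite gt_eqF.
have hb : half_ball (fun k => u k / (2 * q)).
  rewrite /half_ball (eq_bigr (fun k => (4 * q ^+ 2)^-1 * u k ^+ 2)) => [|k _]; last first.
    by field; rewrite gt_eqF.
  rewrite -mulr_sumr -/Z -q2 invfM -mulrA mulVf ?mulr1// expf_neq0// gt_eqF//.
move=> /(_ hb) => hq; rewrite -q2; nra.
Qed.

Lemma sqrtr_le_scaled (R : realType) (X u w : R) :
  0 <= u -> X <= u ^+ 2 * w -> Num.sqrt X <= u * Num.sqrt w.
Proof.
move=> u0 Xu; apply: le_trans (ler_wsqrtr Xu) _.
by rewrite sqrtrM ?sqr_ge0// sqrtr_sqr ger0_norm.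
Qed.

Lemma scaled_product_le (R : realType) (k k' v u x : R) :
  0 <= k -> k <= k' -> 0 <= v -> v <= u -> 0 <= x ->
  k * v * u * x <= k' * u * u * x.
Proof.
move=> k0 kk v0 vu x0; have u0 := le_trans v0 vu.
by rewrite ler_wpM2r// ler_wpM2r// ler_pM.
Qed.

Lemma sum_sqrD_le (R : realType) (n : nat) (a b : 'I_n -> R) :
  \sum_k (a k + b k) ^+ 2 <= 2 * (\sum_k a k ^+ 2) + 2 * (\sum_k b k ^+ 2).
Proof.
rewrite !mulr_sumr -big_split/=; apply: ler_sum => k _.
by have := sqr_ge0 (a k - b k); nra.
Qed.

(** The net costs at most [exp (theta (m1 + m2) / 2)], against a tail of
    [exp (- 3 theta (m1 + m2))]. *)
Lemma net_union_small (R : realType) (q p m1 m2 : nat) (theta : R) :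
  4 <= theta -> (0 < m1)%N -> q%:R <= expR (theta / 8) -> p%:R <= expR (theta / 8) ->
  (q%:R ^+ 4) ^+ m1 * (p%:R ^+ 4) ^+ m2 *
    expR (- (3 * theta * (m1 + m2)%:R)) <= expR (- theta).
Proof.
move=> th m10 hq hp.
have m1R : (1 : R) <= m1%:R by rewrite ler1n.
have m2R : (0 : R) <= m2%:R by rewrite ler0n.
apply: (@le_trans _ _ ((expR (theta / 8) ^+ 4) ^+ m1 * (expR (theta / 8) ^+ 4) ^+ m2 *
    expR (- (3 * theta * (m1 + m2)%:R)))).
  rewrite ler_wpM2r ?expR_ge0//.
  by rewrite ler_pM ?exprn_ge0// !lerXn2r ?nnegrE ?exprn_ge0 ?expR_ge0.
rewrite -!expRM_natl -!expRD ler_expR natrD; nra.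
Qed.

(** Write [Y = T + g] and [Y' = T + g'] for the one-bit vectors of the two dithers, with [T] the
    clipped samples. Then [Y Y' = Y g' + g T + T T]. Three events are excluded: [H] fails if the
    noise matrix of [g] is large in norm, [B1] if the form in [g] and [T] is, and [B2] if the form
    in [Y] and [g'] is, the last one for a first pattern fixed in [H]. *)
Lemma onebit_error_bound (R : realType) (n p m : nat) (theta l kap s c0 : R)
    (S : 'I_p -> 'I_p -> R) (x lam : 'I_n * 'I_p -> R) :
  (1 < n)%N -> (1 < p)%N -> (0 < m)%N -> 10 ^+ 4 <= c0 -> 4 <= theta -> 1 <= kap -> 2^-1 <= l ->
  0 < s -> p%:R <= expR (theta / 8) -> n%:R <= expR (theta / 8) ->
  (forall i, 0 <= S i i <= s) -> \sum_i S i i <= m%:R * s ->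
  (forall c, 0 <= lam c) ->
  (forall c, lam c ^+ 2 <= 12 * kap ^+ 2 * l * theta * S c.2 c.2) ->
  (forall c, x c ^+ 2 <= 3 * theta * kap * S c.2 c.2) ->
  (forall i, \sum_k (x (k, i) - clip (x (k, i)) (lam (k, i))) ^+ 2 <=
             c0 * kap ^+ 3 * theta ^+ 2 * S i i) ->
  let q := Num.sqrt (m%:R * (n%:R + m%:R)) in
  (forall z, half_ball z -> \sum_k (\sum_i x (k, i) * z i) ^+ 2 <=
     c0 * kap * theta * (n%:R + m%:R) * s) ->
  (forall z z', half_ball z -> half_ball z' ->
     \sum_k (\sum_i x (k, i) * z i) * (\sum_i x (k, i) * z' i) -
     n%:R * bform S z z' <= c0 * kap * theta * s * q) ->
  exists Q : pred ({ffun 'I_n * 'I_p -> bool} * {ffun 'I_n * 'I_p -> bool}),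
    \sum_(b | Q b) (\prod_c up_prob (x c) (lam c) (b.1 c)) *
                   (\prod_c up_prob (x c) (lam c) (b.2 c)) <= 3 * expR (- theta) /\
    forall b, ~~ Q b -> forall z z', half_ball z -> half_ball z' ->
     \sum_k (\sum_i (if b.1 (k, i) then lam (k, i) else - lam (k, i)) * z i) *
            (\sum_i (if b.2 (k, i) then lam (k, i) else - lam (k, i)) * z' i) -
     n%:R * bform S z z' <= 17 * c0 * kap ^+ 3 * l * theta ^+ 2 * s * q.
Proof.
move=> n1 p1 m0 c4 th4 kap1 l2 s0 hp hn hS trS lam0 hlam hx he q0.
have c00 : 0 < c0 by apply: lt_le_trans c4; rewrite exprn_gt0.
have th0 : 0 < theta by apply: lt_le_trans th4.
have kap0 : 0 < kap by apply: lt_le_trans kap1.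
have l0 : 0 < l by apply: lt_le_trans l2; rewrite invr_gt0.
have n0 : (0 < n)%N by exact: ltnW.
have p0 : (0 < p)%N by exact: ltnW.
have mR : (0 : R) < m%:R by rewrite ltr0n.
have nR : (0 : R) < n%:R by rewrite ltr0n.
have [N NE] : exists N : R, N = n%:R + m%:R by exists (n%:R + m%:R).
rewrite /q0 -NE {q0}; set q := Num.sqrt (m%:R * N); move=> hX hD.
have N0 : 0 < N by rewrite NE addr_gt0.
(* [u] is the target rate; [a] is the rate of the clipping error, free of the logarithm [l]. *)
have [u uE] : exists u, u = kap ^+ 3 * l * theta ^+ 2 by eexists.
have [a aE] : exists a, a = kap ^+ 3 * theta ^+ 2 by eexists.
have u0 : 0 < u by rewrite uE !mulr_gt0// exprn_gt0.
have k3 : kap <= kap ^+ 3 by rewrite exprS ler_peMr ?(ltW kap0)// exprn_ege1.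
have k23 : kap ^+ 2 <= kap ^+ 3 by rewrite [leRHS]exprS ler_peMl// sqr_ge0.
have t12 : theta <= theta ^+ 2.
  by rewrite expr2 ler_peMr ?(ltW th0)// (le_trans _ th4)// ler1n.
have a0 : 0 < a by rewrite aE mulr_gt0// exprn_gt0.
have f1 : a <= 2 * u.
  have -> : u = a * l by rewrite uE aE; ring.
  have h : 2^-1 * a <= l * a by rewrite ler_wpM2r// ltW.
  by move: h; clear; rewrite (mulrC a); lra.
have f2 : kap ^+ 2 * l * theta ^+ 2 <= u.
  by rewrite uE -(mulrA (kap ^+ 2)) -(mulrA (kap ^+ 3)) ler_wpM2r// mulr_ge0 ?exprn_ge0// ltW.
have f5 : kap * theta <= a by rewrite aE ler_pM// ltW.
have f3 : kap * theta <= 2 * u by exact: le_trans f1.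
have f4 : kap ^+ 2 * l * theta <= u.
  by apply: le_trans f2; rewrite ler_wpM2l// mulr_ge0 ?sqr_ge0// ltW.
have f6 : kap * theta <= u.
  have h : 1 <= l * theta.
    by apply: (@le_trans _ _ (2^-1 * 4)); [clear; lra|rewrite ler_pM// invr_ge0].
  rewrite uE (_ : _ * l * _ = kap ^+ 3 * theta * (l * theta)); last by ring.
  apply: (@le_trans _ _ (kap ^+ 3 * theta)); first by rewrite ler_wpM2r// ltW.
  by rewrite ler_peMr// mulr_ge0 ?exprn_ge0// ltW.
pose Tr c := clip (x c) (lam c).
pose e c := x c - Tr c.
pose w c b := up_prob (x c) (lam c) b.
pose g c b := noise (x c) (lam c) b.
pose v i := S i i.
have v0 i : 0 <= v i by have /andP[] := hS i.
have vs i : v i <= s by have /andP[] := hS i.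
have w0 c b : 0 <= w c b by exact: up_prob_ge0.
have w1 c : \sum_b w c b = 1 by exact: up_prob_sum.
have wg c : \sum_b w c b * g c b = 0 by exact: noise_mean.
(* The 4 of [noise_sqr_le] times the 12 in the bound on the scale. *)
pose G := 48 * kap ^+ 2 * l * theta.
have G0 : 0 < G by rewrite /G !mulr_gt0// exprn_gt0.
have gv c b : g c b ^+ 2 <= G * v c.2.
  apply: le_trans (noise_sqr_le _ _ (lam0 c)) _.
  have h : 4 * lam c ^+ 2 <= 4 * (12 * kap ^+ 2 * l * theta * S c.2 c.2).
    by rewrite ler_wpM2l.
  by apply: le_trans h _; rewrite /G /v le_eqVlt; apply/orP; left; apply/eqP; ring.
have hd y : half_ball y -> \sum_i v i * y i ^+ 2 + (\sum_i v i) / m%:R <= 2 * s.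
  move=> hy.
  have h1 : \sum_i v i * y i ^+ 2 <= s * 4^-1.
    apply: (@le_trans _ _ (\sum_i s * y i ^+ 2)).
      by apply: ler_sum => i _; rewrite ler_wpM2r// sqr_ge0.
    by rewrite -mulr_sumr ler_wpM2l// ltW.
  have h2 : (\sum_i v i) / m%:R <= s by rewrite ler_pdivrMr// mulrC.
  by apply: le_trans (lerD h1 h2) _; move: s0; clear; lra.
have Ns0 : 0 <= N * s by rewrite mulr_ge0// ltW.
have mN : m%:R <= N by rewrite NE lerDr ltW.
have nN : n%:R <= N by rewrite NE lerDl ltW.
have mNs : m%:R * s <= N * s by rewrite ler_wpM2r ?(ltW s0).
have hE z : half_ball z ->
    \sum_k (\sum_i - e (k, i) * z i) ^+ 2 <= c0 * a * (m%:R * s).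
  move=> hz; apply: (@le_trans _ _ (\sum_k \sum_i e (k, i) ^+ 2)).
    apply: ler_sum => k _; apply: le_trans (half_ball_dot_sqr_le _ hz) _.
    by apply: ler_sum => i _; rewrite sqrrN.
  rewrite exchange_big/=.
  apply: (@le_trans _ _ (\sum_i c0 * kap ^+ 3 * theta ^+ 2 * v i)).
    by apply: ler_sum => i _; exact: he.
  by rewrite -mulr_sumr -(mulrA c0) -aE ler_wpM2l// mulr_ge0// ltW.
have hTx z : half_ball z -> \sum_k (\sum_i Tr (k, i) * z i) ^+ 2 <=
    4 * c0 * a * (N * s).
  move=> hz.
  have hx2 := hX z hz.
  have he2 : \sum_k (\sum_i - e (k, i) * z i) ^+ 2 <= c0 * a * (m%:R * s).
    exact: hE.
  have -> : \sum_k (\sum_i Tr (k, i) * z i) ^+ 2 =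
      \sum_k (\sum_i x (k, i) * z i + \sum_i - e (k, i) * z i) ^+ 2.
    apply: eq_bigr => k _; congr (_ ^+ 2); rewrite -big_split/=.
    by apply: eq_bigr => i _; rewrite /e; ring.
  apply: le_trans (sum_sqrD_le _ _) _.
  apply: (@le_trans _ _ (2 * (c0 * a * (N * s)) + 2 * (c0 * a * (N * s)))).
    rewrite lerD// ler_wpM2l//.
      apply: le_trans hx2 _; rewrite -!(mulrA c0) -(mulrA _ N) ler_wpM2l ?(ltW c00)//.
      exact: ler_wpM2r.
    by apply: le_trans he2 _; rewrite ler_wpM2l// mulr_ge0// ltW.
  by rewrite le_eqVlt; apply/orP; left; apply/eqP; ring.
(* The identity matrix turns the noise form into the norm of the noise. Averages of [n] atoms are
   used on its side, so that its trace term is [n / n = 1]; hence the [n + m] in [tH]. *)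
pose aH (k j : 'I_n) : R := (j == k)%:R.
pose aT k i := Tr (k, i).
pose aY (b : {ffun 'I_n * 'I_p -> bool}) k i := if b (k, i) then lam (k, i) else - lam (k, i).
pose tH := 3 * theta * (n + m)%:R.
pose tT := 3 * theta * (m + m)%:R.
(* [21 = 16 + 4 + 1]: the clipped samples through [a <= 2 u], the noise of the first dither, and the
   trace term. *)
pose A' := 21 * c0 * u * (N * s).
have uc : u <= c0 * u.
  by rewrite ler_peMl ?(ltW u0)//; apply: le_trans c4; rewrite exprn_ege1// ler1n.
have uN0 : 0 <= u * (N * s) by rewrite mulr_ge0// ltW.
have cuN : u * (N * s) <= c0 * u * (N * s) by exact: ler_wpM2r.
pose H (b : {ffun 'I_n * 'I_p -> bool}) := `[< forall z y, half_ball z -> half_ball y ->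
  noise_form g aH b z y <= 2 * Num.sqrt (2 * G * tH * (2 * (2 * s))) >].
pose B1 (b : {ffun 'I_n * 'I_p -> bool}) := `[< forall z y, half_ball z -> half_ball y ->
  noise_form g aT b z y <= 2 * Num.sqrt (2 * G * tT * (A' * (2 * s))) >].
pose B2 (b b' : {ffun 'I_n * 'I_p -> bool}) := `[< forall z y, half_ball z -> half_ball y ->
  noise_form g (aY b) b' z y <= 2 * Num.sqrt (2 * G * tT * (A' * (2 * s))) >].
have tH0 : 0 <= tH by rewrite !mulr_ge0// ltW.
have tT0 : 0 <= tT by rewrite !mulr_ge0// ltW.
have A'0 : 0 < A' by rewrite /A' !mulr_gt0.
have s20 : 0 < 2 * s by rewrite mulr_gt0.
pose W (b : {ffun 'I_n * 'I_p -> bool}) := \prod_c w c (b c).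
have W0 b : 0 <= W b by apply: prodr_ge0.
have W1 : \sum_b W b = 1 by exact: sum_prod_weights1.
have PH : \sum_(b | ~~ H b) W b <= expR (- theta).
  apply: le_trans _ (net_union_small m th4 n0 hn hp).
  apply: noise_form_tail => // z hz.
  have -> : \sum_k (\sum_j aH k j * z j) ^+ 2 = \sum_k z k ^+ 2.
    apply: eq_bigr => k _; congr (_ ^+ 2); rewrite (bigD1 k)//= /aH eqxx mul1r.
    by rewrite big1 ?addr0// => j /negbTE ->; rewrite mul0r.
  have -> : \sum_k \sum_j aH k j ^+ 2 = n%:R.
    rewrite (eq_bigr (fun=> 1)) ?sumr_const ?card_ord// => k _.
    rewrite (bigD1 k)//= /aH eqxx expr1n big1 ?addr0// => j /negbTE ->.
    by rewrite expr0n.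
  rewrite divff ?gt_eqF//; move: hz; rewrite /half_ball; clear; lra.
have trT : (\sum_k \sum_i aT k i ^+ 2) / m%:R <= 3 * (kap * theta) * (N * s).
  rewrite ler_pdivrMr//.
  apply: (@le_trans _ _ (\sum_(k < n) \sum_i 3 * theta * kap * v i)).
    apply: ler_sum => k _; apply: ler_sum => i _; apply: le_trans (hx (k, i)).
    rewrite -(real_normK (num_real (aT k i))) -(real_normK (num_real (x _))).
    by rewrite lerXn2r ?nnegrE//; exact: normr_clip_le.
  rewrite sumr_const card_ord -mulr_sumr -[_ *+ n]mulr_natl.
  apply: (@le_trans _ _ (n%:R * (3 * theta * kap * (m%:R * s)))).
    by rewrite ler_wpM2l ?(ltW nR)// ler_wpM2l// !mulr_ge0// ltW.
  rewrite (_ : _ * (_ * (m%:R * s)) = 3 * (kap * theta) * ((n%:R * s) * m%:R)); last by ring.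
  rewrite -(mulrA _ (N * s)) ler_wpM2l// ?mulr_ge0// ?(ltW kap0) ?(ltW th0)//.
  by rewrite ler_wpM2r ?(ltW mR)// ler_wpM2r ?(ltW s0).
have PB1 : \sum_(b | ~~ B1 b) W b <= expR (- theta).
  apply: le_trans _ (net_union_small m th4 m0 hp hp).
  apply: noise_form_tail => // z hz.
  apply: le_trans (lerD (hTx z hz) trT) _.
  have h1 := ler_wpM2l (ltW c00) (ler_wpM2r Ns0 f1); have h3 := ler_wpM2r Ns0 f3.
  rewrite /A'; move: h1 h3 cuN uN0; clear; lra.
have hEta b y : H b -> half_ball y ->
    \sum_k (\sum_i g (k, i) (b (k, i)) * y i) ^+ 2 <= 2 * c0 * u * (N * s).
  move=> /asboolP Hb hy.
  apply: le_trans (sum_sqr_of_noise_form _ (fun z hz => Hb z y hz hy)) _.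
    by rewrite mulr_ge0// sqrtr_ge0.
  rewrite exprMn sqr_sqrtr; last by rewrite !mulr_ge0// ltW.
  rewrite /G /tH natrD -NE.
  (* [9 * 2 ^ 11 <= 2 * c0] is the tightest demand on [c0] in this proof. *)
  rewrite (_ : 4 * _ = 9 * 2 ^+ 11 * (kap ^+ 2 * l * theta ^+ 2) * (N * s)); last by ring.
  rewrite ler_wpM2r//; apply: ler_pM => //.
  - by rewrite !mulr_ge0 ?sqr_ge0// ltW.
  - by move: c4; clear; lra.
have trY b : (\sum_k \sum_i aY b k i ^+ 2) / m%:R <= 12 * u * (N * s).
  rewrite ler_pdivrMr//.
  apply: (@le_trans _ _ (\sum_(k < n) \sum_i 12 * kap ^+ 2 * l * theta * v i)).
    apply: ler_sum => k _; apply: ler_sum => i _; apply: le_trans (hlam (k, i)).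
    by rewrite /aY; case: ifP; rewrite ?sqrrN.
  rewrite sumr_const card_ord -mulr_sumr -[_ *+ n]mulr_natl.
  apply: (@le_trans _ _ (n%:R * (12 * u * (m%:R * s)))).
    rewrite ler_wpM2l ?(ltW nR)//; apply: ler_pM => //.
    - by rewrite !mulr_ge0 ?sqr_ge0// ltW.
    - by apply: sumr_ge0.
    - by rewrite -!(mulrA 12) ler_wpM2l.
  rewrite (_ : _ * (_ * (m%:R * s)) = 12 * u * ((n%:R * s) * m%:R)); last by ring.
  rewrite -(mulrA _ (N * s)) ler_wpM2l// ?mulr_ge0// ?(ltW u0)//.
  by rewrite ler_wpM2r ?(ltW mR)// ler_wpM2r ?(ltW s0).
have YE b k i : aY b k i = Tr (k, i) + g (k, i) (b (k, i)).
  by rewrite /aY /g /noise -/(Tr (k, i)) addrCA subrr addr0.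
have PB2 b : H b -> \sum_(b' | ~~ B2 b b') W b' <= expR (- theta).
  move=> Hb; apply: le_trans _ (net_union_small m th4 m0 hp hp).
  apply: noise_form_tail => // z hz.
  have h1 : \sum_k (\sum_i aY b k i * z i) ^+ 2 <=
      2 * (4 * c0 * a * (N * s)) + 2 * (2 * c0 * u * (N * s)).
    have -> : \sum_k (\sum_i aY b k i * z i) ^+ 2 =
      \sum_k (\sum_i Tr (k, i) * z i + \sum_i g (k, i) (b (k, i)) * z i) ^+ 2.
      apply: eq_bigr => k _; congr (_ ^+ 2); rewrite -big_split/=.
      by apply: eq_bigr => i _; rewrite YE mulrDl.
    apply: le_trans (sum_sqrD_le _ _) _.
    by rewrite lerD// ler_wpM2l//; [exact: hTx|exact: hEta].
  apply: le_trans (lerD h1 (trY b)) _.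
  have h2 := ler_wpM2l (ltW c00) (ler_wpM2r Ns0 f1).
  have h3 : 12 * (u * (N * s)) <= c0 * (u * (N * s)).
    by rewrite ler_wpM2r//; move: c4; clear; lra.
  rewrite /A'; move: h2 h3; clear; lra.
(* The second pattern is summed first, with the first one fixed; [B2] is controlled only for first
   patterns in [H]. *)
exists (fun b => [|| ~~ H b.1, ~~ B1 b.1 | H b.1 && ~~ B2 b.1 b.2]); split.
  pose F (b b' : {ffun 'I_n * 'I_p -> bool}) : R :=
    (~~ H b)%:R + (~~ B1 b)%:R + (H b && ~~ B2 b b')%:R.
  apply: (@le_trans _ _ (\sum_b \sum_b' F b b' * (W b * W b'))).
    rewrite pair_bigA/= big_mkcond/=; apply: ler_sum => -[b b'] _ /=.
    have WW : 0 <= W b * W b' by rewrite mulr_ge0.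
    change ((if [|| ~~ H b, ~~ B1 b | H b && ~~ B2 b b'] then W b * W b' else 0) <=
      F b b' * (W b * W b')); rewrite /F.
    by move: WW; move: (W b * W b') => w'; clear; case: (H b); case: (B1 b); case: (B2 b b') => /=; lra.
  rewrite (eq_bigr (fun b => (~~ H b)%:R * W b + (~~ B1 b)%:R * W b +
      (H b)%:R * W b * \sum_(b' | ~~ B2 b b') W b')); last first.
    move=> b _.
    rewrite (eq_bigr (fun b' => ((~~ H b)%:R * W b + (~~ B1 b)%:R * W b) * W b' +
      (H b)%:R * W b * (if ~~ B2 b b' then W b' else 0))); last first.
      by move=> b' _; rewrite /F; case: (H b); case: (B2 b b') => /=; ring.
    by rewrite big_split/= -!mulr_sumr W1 mulr1 -big_mkcond.
  rewrite !big_split/=.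
  have E (C : pred {ffun 'I_n * 'I_p -> bool}) : \sum_b (C b)%:R * W b = \sum_(b | C b) W b.
    by rewrite [RHS]big_mkcond; apply: eq_bigr => b _; case: (C b); rewrite ?mul1r ?mul0r.
  have h3 : \sum_b (H b)%:R * W b * \sum_(b' | ~~ B2 b b') W b' <= expR (- theta).
    apply: (@le_trans _ _ (\sum_b W b * expR (- theta))); last first.
      by rewrite -mulr_suml W1 mul1r.
    apply: ler_sum => b _; case: (boolP (H b)) => Hb; last first.
      by rewrite mul0r mul0r mulr_ge0 ?expR_ge0.
    by rewrite mul1r ler_wpM2l//; exact: PB2.
  rewrite (E (fun b => ~~ H b)) (E (fun b => ~~ B1 b)).
  by apply: le_trans (lerD (lerD PH PB1) h3) _; clear; lra.
move=> [b b'] nQ z z' hz hz'.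
have [Hb /asboolP hB1 /asboolP hB2] : [/\ H b, B1 b & B2 b b'].
  change (is_true (~~ [|| ~~ H b, ~~ B1 b | H b && ~~ B2 b b'])) in nQ.
  by move: nQ; case: (H b); case: (B1 b); case: (B2 b b').
have q0 : 0 <= q by exact: sqrtr_ge0.
have hs : 2 * Num.sqrt (2 * G * tT * (A' * (2 * s))) <= 4 * c0 * u * s * q.
  have : Num.sqrt (2 * G * tT * (A' * (2 * s))) <= 2 * c0 * u * s * q.
    apply: sqrtr_le_scaled; first by rewrite !mulr_ge0// ltW.
    rewrite /tT natrD /G /A'.
    rewrite (_ : _ * (_ * (2 * s)) = (48 * 504 * c0) * (kap ^+ 2 * l * theta ^+ 2) * u * s ^+ 2 * (m%:R * N)); last by ring.
    rewrite (_ : (2 * c0 * u * s) ^+ 2 * _ = (4 * c0 * c0) * u * u * s ^+ 2 * (m%:R * N)); last by ring.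
    have c1 : 48 * 504 * c0 <= 4 * c0 * c0.
      by rewrite ler_wpM2r ?(ltW c00)//; move: c4; clear; lra.
    apply: ler_wpM2r; first by rewrite mulr_ge0// ltW.
    have c0' : 0 <= 48 * 504 * c0 by move: c00; clear; lra.
    apply: (scaled_product_le c0' c1 _ f2 (sqr_ge0 s)).
    by rewrite !mulr_ge0 ?sqr_ge0// ltW.
  by clear; lra.
have hcs (U V : 'I_n -> R) : \sum_k U k ^+ 2 <= c0 * a * (m%:R * s) ->
    \sum_k V k ^+ 2 <= 4 * c0 * a * (N * s) -> \sum_k U k * V k <= 2 * c0 * a * s * q.
  move=> hU hV.
  apply: le_trans (cauchy_schwarz_sum _ _ hU hV) _; try by rewrite !mulr_gt0.
  apply: sqrtr_le_scaled; first by rewrite !mulr_ge0// ltW.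
  by rewrite le_eqVlt; apply/orP; left; apply/eqP; ring.
have hXx y : half_ball y -> \sum_k (\sum_i x (k, i) * y i) ^+ 2 <= 4 * c0 * a * (N * s).
  move=> hy; apply: le_trans (hX y hy) _; rewrite -(mulrA _ N).
  rewrite ler_wpM2r// -(mulrA c0) -(mulrA 4) -[leLHS]mul1r; apply: ler_pM => //.
  - by rewrite !mulr_ge0// ltW.
  - by rewrite ler1n.
  - by rewrite ler_wpM2l// ltW.
pose Xk k (y : 'I_p -> R) := \sum_i x (k, i) * y i.
pose Tk k (y : 'I_p -> R) := \sum_i Tr (k, i) * y i.
pose Ek k (y : 'I_p -> R) := \sum_i - e (k, i) * y i.
have TX k y : Tk k y = Xk k y + Ek k y.
  rewrite /Tk /Xk /Ek -big_split/=; apply: eq_bigr => i _; rewrite /e; ring.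
have YT (c : {ffun 'I_n * 'I_p -> bool}) k y : \sum_i (if c (k, i) then lam (k, i) else - lam (k, i)) * y i =
    Tk k y + \sum_i g (k, i) (c (k, i)) * y i.
  rewrite /Tk -big_split/=; apply: eq_bigr => i _.
  by rewrite -[if _ then _ else _]/(aY c k i) YE mulrDl.
(* Replacing the clipped samples by the true ones in [T T] leaves two cross terms with the excess
   [Ek], treated by Cauchy-Schwarz. *)
have -> : \sum_k (\sum_i (if b (k, i) then lam (k, i) else - lam (k, i)) * z i) *
            (\sum_i (if b' (k, i) then lam (k, i) else - lam (k, i)) * z' i) =
   noise_form g (aY b) b' z z' + noise_form g aT b z' z +
   (\sum_k Ek k z * Tk k z' + \sum_k Ek k z' * Xk k z + \sum_k Xk k z * Xk k z').
  rewrite /noise_form -!big_split/=; apply: eq_bigr => k _.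
  rewrite -[\sum_j aT k j * z' j]/(Tk k z') /aY !YT !TX; ring.
have h1 := hB1 z' z hz' hz; have h2 := hB2 z z' hz hz'.
have h3 := hD z z' hz hz'.
have h4 : \sum_k Ek k z * Tk k z' <= 2 * c0 * a * s * q.
  by apply: hcs; [exact: hE|exact: hTx].
have h5 : \sum_k Ek k z' * Xk k z <= 2 * c0 * a * s * q.
  by apply: hcs; [exact: hE|exact: hXx].
have sq0 : 0 <= s * q by rewrite mulr_ge0// ltW.
have g1 : a * (s * q) <= 2 * u * (s * q) by exact: ler_wpM2r.
have g2 : kap * theta * (s * q) <= u * (s * q) by exact: ler_wpM2r.
have g1' := ler_wpM2l (ltW c00) g1; have g2' := ler_wpM2l (ltW c00) g2.
(* [17 = 4 + 4 + 4 + 4 + 1]: two noise forms, two excess terms, and the empirical covariance. *)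
have -> : 17 * c0 * kap ^+ 3 * l * theta ^+ 2 * s * q = 17 * (c0 * (u * (s * q))).
  by rewrite uE; ring.
have := le_trans h1 hs; have := le_trans h2 hs; move: h3 h4 h5 g1' g2'.
rewrite -[\sum_k _ * _]/(\sum_k Xk k z * Xk k z').
move: (noise_form _ _ _ _ _) (noise_form _ _ _ _ _) => r1 r2.
move: (\sum_k Xk k z * Xk k z') (\sum_k Ek k z * Tk k z') (\sum_k Ek k z' * Xk k z) => r3 r4 r5.
move: (bform _ _ _) (n%:R) => r6 r7; clear; lra.
Qed.

(** * The adaptive scale *)

(** The diagonal entry of [Lambda] for the constant [2 * (K + 1)] chosen in the theorem. *)
Definition scale (R : realType) (n p : nat) (K : R) (xs : 'I_n.+1 -> p.-tuple R)
    (c : 'I_n * 'I_p) : R :=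
  2 * (K + 1) * Num.sqrt (ln c.1.+1%:R) *
  Num.sqrt (c.1.+1%:R^-1 * \sum_(j < n.+1 | (j < c.1.+1)%N) tnth (xs j) c.2 ^+ 2).

Definition obs (R : realType) (n p : nat) (xs : 'I_n.+1 -> p.-tuple R)
    (c : 'I_n * 'I_p) : R := tnth (xs (lift ord0 c.1)) c.2.

Lemma scale_ge0 (R : realType) (n p : nat) (K : R) (xs : 'I_n.+1 -> p.-tuple R) c :
  0 < K -> 0 <= scale K xs c.
Proof.
by move=> K0; rewrite !mulr_ge0 ?sqrtr_ge0// addr_ge0// ltW.
Qed.

Lemma scale_sqr (R : realType) (n p : nat) (K : R) (xs : 'I_n.+1 -> p.-tuple R) c :
  scale K xs c ^+ 2 = 4 * (K + 1) ^+ 2 * ln c.1.+1%:R *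
    (c.1.+1%:R^-1 * \sum_(j < n.+1 | (j < c.1.+1)%N) tnth (xs j) c.2 ^+ 2).
Proof.
rewrite /scale !exprMn !sqr_sqrtr.
- by rewrite -natrX.
- by rewrite mulr_ge0 ?invr_ge0// sumr_ge0// => j _; exact: sqr_ge0.
- by rewrite ln_ge0// ler1n.
Qed.

Lemma sum_ord_lt_const (R : realType) (n : nat) (k : 'I_n) (b : R) :
  \sum_(j < n.+1 | (j < k.+1)%N) b = k.+1%:R * b.
Proof.
rewrite -(big_ord_widen n.+1 (fun=> b)) ?ltnS ?(ltnW (ltn_ord k))//.
by rewrite sumr_const card_ord -[LHS]mulr_natl.
Qed.

Lemma count_ord_lt (R : realType) (n : nat) (y : R) :
  0 <= y -> \sum_(k < n) (k.+1%:R < y)%R%:R <= y.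
Proof.
move=> y0.
have H m : \sum_(k < m) (k.+1%:R < y)%R%:R <= m%:R :> R.
  rewrite -[leRHS]mulr1 mulr_natl -[X in _ *+ X](card_ord m) -sumr_const.
  by apply: ler_sum => k _; case: (_ < y).
elim: n => [|n IH]; first by rewrite big_ord0.
have [h|h] := ltP n.+1%:R y; first by apply: le_trans (H _) (ltW h).
by rewrite big_ord_recr/= ltNge h addr0.
Qed.

Lemma good_sample_scale (R : realType) (n p m : nat) (K theta : R)
    (S : 'I_p -> 'I_p -> R) (xs : 'I_n.+1 -> p.-tuple R) (c : 'I_n * 'I_p) :
  0 < K -> 0 <= theta -> 0 <= S c.2 c.2 -> good_sample m K theta S xs ->
  scale K xs c ^+ 2 <=
    12 * ((K + 1) ^+ 2) ^+ 2 * ln n%:R * theta * S c.2 c.2.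
Proof.
move=> K0 th0 S0 [g1 _ _ _].
have k0 : 0 <= (K + 1) ^+ 2 by exact: sqr_ge0.
rewrite scale_sqr; set a := _^-1 * _.
have a0 : 0 <= a.
  by rewrite mulr_ge0 ?invr_ge0// sumr_ge0// => j _; exact: sqr_ge0.
have ha : a <= 3 * theta * ((K + 1) ^+ 2 * S c.2 c.2).
  rewrite /a ler_pdivrMl ?ltr0n// -sum_ord_lt_const.
  by apply: ler_sum => j _; exact: g1.
have hl : ln c.1.+1%:R <= ln n%:R :> R.
  by rewrite ler_ln ?posrE ?ltr0n ?ler_nat ?ltn_ord// (leq_ltn_trans _ (ltn_ord c.1)).
have hl0 : 0 <= ln c.1.+1%:R :> R by rewrite ln_ge0// ler1n.
rewrite (_ : 12 * _ * _ * _ * _ = 4 * (K + 1) ^+ 2 * ln n%:R *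
   (3 * theta * ((K + 1) ^+ 2 * S c.2 c.2))); last by ring.
apply: ler_pM => //; first by rewrite mulr_ge0// mulr_ge0.
by apply: ler_wpM2l => //; rewrite mulr_ge0.
Qed.

Lemma good_sample_excess (R : realType) (n p m : nat) (K theta : R)
    (S : 'I_p -> 'I_p -> R) (xs : 'I_n.+1 -> p.-tuple R) (i : 'I_p) :
  0 < K -> 4 <= theta -> 0 <= S i i -> good_sample m K theta S xs ->
  \sum_k (obs xs (k, i) - clip (obs xs (k, i)) (scale K xs (k, i))) ^+ 2 <=
  10 ^+ 4 * ((K + 1) ^+ 2) ^+ 3 * theta ^+ 2 * S i i.
Proof.
move=> K0 th4 S0 [g1 g2 g3 _].
have th0 : 0 < theta by apply: lt_le_trans th4.
have [kap kE] : exists kap, kap = (K + 1) ^+ 2 by eexists.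
have kap1 : 1 <= kap by rewrite kE exprn_ege1// lerDr ltW.
have kap0 : 0 < kap by apply: lt_le_trans kap1.
rewrite -kE in g1 g3 *.
have kE4 : (K + 1) ^+ 4 = kap ^+ 2 by rewrite kE -exprM.
rewrite kE4 in g2.
pose b := 3 * theta * (kap * S i i).
have b0 : 0 <= b by rewrite !mulr_ge0// ltW.
have key k : (obs xs (k, i) - clip (obs xs (k, i)) (scale K xs (k, i))) ^+ 2 <=
    b * ((k.+1%:R < 768 * kap ^+ 2 * theta)%R%:R +
         (2 * ln k.+1%:R * (kap * S i i) < tnth (xs (lift ord0 k)) i ^+ 2)%R%:R).
  set x := obs _ _; set lam := scale _ _ _.
  have xb : x ^+ 2 <= b by exact: g1.
  have lam0 : 0 <= lam by exact: scale_ge0.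
  have ex : (x - clip x lam) ^+ 2 <= x ^+ 2.
    rewrite -(real_normK (num_real (x - _))) -(real_normK (num_real x)).
    by rewrite lerXn2r ?nnegrE//; exact: normr_sub_clip.
  have exb := le_trans ex xb.
  case: ltP => h1 /=.
    apply: le_trans exb _; rewrite -[leLHS]mulr1 ler_wpM2l// lerDl.
    by case: (_ < _).
  rewrite add0r; case: ltP => h2 /=; first by rewrite mulr1.
  rewrite mulr0.
  suff -> : clip x lam = x by rewrite subrr expr0n.
  apply: clip_id; rewrite -(@ler_pXn2r _ 2%N) ?nnegrE// real_normK ?num_real//.
  apply: le_trans h2 _.
  have [Si|Si] := eqVneq (S i i) 0; first by rewrite Si !mulr0 sqr_ge0.
  have Sp : 0 < S i i by rewrite lt_def Si.
  have h3 := g2 i k Sp h1.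
  rewrite /lam scale_sqr -kE /=; set sm := \sum_(j < _ | _) _ in h3 *.
  have hl0 : 0 <= ln k.+1%:R :> R by rewrite ln_ge0// ler1n.
  (* The factor [4 * kap] is the square of [2 * (K + 1)]; against half the variance it gives exactly
     the exceedance level [2 ln (k + 1) * kap * S i i]. *)
  rewrite (_ : 2 * _ * _ = 4 * kap * ln k.+1%:R * (S i i / 2)); last by field.
  apply: ler_wpM2l; first by rewrite !mulr_ge0// ltW.
  by rewrite ler_pdivlMl ?ltr0n// mulrA ltW.
apply: le_trans (ler_sum _ (fun k _ => key k)) _.
rewrite -mulr_sumr big_split/=.
have c1 := @count_ord_lt R n (768 * kap ^+ 2 * theta).
have {}c1 := c1 (mulr_ge0 (mulr_ge0 (ler0n _ _) (sqr_ge0 _)) (ltW th0)).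
have c2 := ltW (g3 i).
have k2 : kap <= kap ^+ 2 by rewrite expr2 ler_peMr// ltW.
have t1 : theta <= kap ^+ 2 * theta.
  by rewrite ler_peMl ?(ltW th0)// exprn_ege1.
(* Early times and exceedances number at most [768 kap ^ 2 theta + 12 + 3 theta], and
   [12 <= 3 theta]. *)
apply: (@le_trans _ _ (b * (774 * (kap ^+ 2 * theta)))).
  rewrite ler_wpM2l//; move: (lerD c1 c2) t1 th4.
  move: (\sum_(k < n) _) (\sum_(k < n) _) => A B.
  rewrite -(mulrA 768); move: (kap ^+ 2 * theta) => y; clear; lra.
rewrite /b (_ : _ * (774 * _) = (3 * 774) * (kap ^+ 3 * theta ^+ 2 * S i i)); last by ring.
rewrite -!(mulrA (10 ^+ 4)); apply: ler_wpM2r; last by clear; lra.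
by rewrite !mulr_ge0 ?exprn_ge0// ltW.
Qed.

(** Maurey's method is applied with the regularised form [A] on both sides. On the half ball [A] is
    at most [s / 2], and its trace over [m] is at most [2 s], so the two sides give [5 cc s]. *)
Lemma good_sample_covariance (R : realType) (n p m : nat) (K theta s : R)
    (S : 'I_p -> 'I_p -> R) (xs : 'I_n.+1 -> p.-tuple R) :
  (0 < n)%N -> (0 < p)%N -> (0 < m)%N ->
  0 < K -> 4 <= theta -> 0 < s -> (forall z, 0 <= bform S z z) ->
  (forall z, half_ball z -> bform S z z <= s / 4) -> (forall i, 0 <= S i i <= s) ->
  0 < \sum_i S i i -> \sum_i S i i <= m%:R * s -> good_sample m K theta S xs ->
  let q := Num.sqrt (m%:R * (n%:R + m%:R)) in
  (forall z z', half_ball z -> half_ball z' ->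
     \sum_k (\sum_i obs xs (k, i) * z i) * (\sum_i obs xs (k, i) * z' i) -
     n%:R * bform S z z' <= 10 ^+ 4 * (K + 1) ^+ 2 * theta * s * q) /\
  (forall z, half_ball z -> \sum_k (\sum_i obs xs (k, i) * z i) ^+ 2 <=
     10 ^+ 4 * (K + 1) ^+ 2 * theta * (n%:R + m%:R) * s).
Proof.
move=> n0 p0 m0 K0 th4 s0 S0 Ss Sii tr0 trS [_ _ _ g4] q.
have th0 : 0 < theta by apply: lt_le_trans th4.
have nR : (0 : R) < n%:R by rewrite ltr0n.
have pR : (0 : R) < p%:R by rewrite ltr0n.
have mR : (0 : R) < m%:R by rewrite ltr0n.
have [kap kE] : exists kap, kap = (K + 1) ^+ 2 by eexists.
have kap1 : 1 <= kap by rewrite kE exprn_ege1// lerDr ltW.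
have kap0 : 0 < kap by apply: lt_le_trans kap1.
rewrite -kE in g4 *.
pose t := 3 * theta * m%:R.
pose cc := kap * (65 * Num.sqrt (n%:R * t) + 130 * t).
have t0 : 0 <= t by rewrite !mulr_ge0// ltW.
have cc0 : 0 <= cc.
  by rewrite mulr_ge0 ?(ltW kap0)// addr_ge0// mulr_ge0// sqrtr_ge0.
pose del := (\sum_i S i i) / p%:R.
have del0 : 0 < del by rewrite divr_gt0.
pose A i j := S i j + (if i == j then del else 0).
have AE z : bform A z z = net_form S z.
  rewrite /net_form -/del mulr_sumr sum_diag_bform /bform -big_split/=.
  apply: eq_bigr => i _; rewrite -big_split/=; apply: eq_bigr => j _.
  by rewrite -mulrDl.
have z2 (z : 'I_p -> R) : 0 <= \sum_i z i ^+ 2.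
  by apply: sumr_ge0 => i _; exact: sqr_ge0.
have A0 z : 0 <= bform A z z by rewrite AE addr_ge0// mulr_ge0// ltW.
have Aii i : 0 <= A i i.
  by rewrite /A eqxx addr_ge0 ?(ltW del0)//; have /andP[] := Sii i.
have trA : \sum_i A i i = 2 * \sum_i S i i.
  rewrite /A; under eq_bigr do rewrite eqxx.
  rewrite big_split/= sumr_const card_ord -[_ *+ p]mulr_natr divfK ?gt_eqF//.
  by rewrite mulr_natl mulr2n.
have qm : m%:R <= q.
  rewrite -[leLHS](ger0_norm (ltW mR)) -sqrtr_sqr ler_wsqrtr// expr2.
  by rewrite ler_wpM2l ?(ltW mR)// lerDr ltW.
have qn : q <= n%:R + m%:R.
  have h : 0 <= n%:R + m%:R :> R by rewrite addr_ge0.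
  rewrite -[leRHS](ger0_norm h) -sqrtr_sqr ler_wsqrtr// expr2.
  by rewrite ler_wpM2r// lerDr ltW.
(* [455 = 65 + 3 * 130], with [3 <= theta] used under the square root. *)
have ccq : cc <= 455 * (kap * theta * q).
  have h1 : Num.sqrt (n%:R * t) <= theta * q.
    apply: sqrtr_le_scaled; first exact: ltW.
    rewrite /t (_ : n%:R * _ = 3 * theta * (m%:R * n%:R)); last by ring.
    apply: ler_pM; rewrite ?mulr_ge0 ?(ltW th0) ?(ltW mR) ?(ltW nR)//.
      rewrite expr2 ler_wpM2r ?(ltW th0)//; apply: le_trans th4.
      by rewrite ler_nat.
    by rewrite ler_wpM2l ?(ltW mR)// lerDl ltW.
  have h2 : t <= 3 * (theta * q) by rewrite /t -mulrA ler_wpM2l// ler_wpM2l// ltW.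
  rewrite /cc (_ : 455 * _ = kap * (455 * (theta * q))); last by ring.
  rewrite ler_wpM2l ?(ltW kap0)//.
  by move: h1 h2; clear; lra.
have D1 z z' : half_ball z -> half_ball z' ->
    \sum_k (\sum_i obs xs (k, i) * z i) * (\sum_i obs xs (k, i) * z' i) -
    n%:R * bform S z z' <= 5 * cc * s.
  move=> hz hz'.
  pose M i j := (\sum_(k < n) obs xs (k, i) * obs xs (k, j)) - n%:R * S i j.
  have ME y y' : bform M y y' =
      \sum_k (\sum_i obs xs (k, i) * y i) * (\sum_i obs xs (k, i) * y' i) -
      n%:R * bform S y y'.
    have -> : \sum_k (\sum_i obs xs (k, i) * y i) * (\sum_i obs xs (k, i) * y' i) =
        \sum_i \sum_j \sum_(k < n) obs xs (k, i) * obs xs (k, j) * (y i * y' j).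
      under eq_bigr do rewrite big_distrlr/=.
      rewrite exchange_big/=; apply: eq_bigr => i _.
      rewrite exchange_big/=; apply: eq_bigr => j _.
      by apply: eq_bigr => k _; ring.
    rewrite /bform mulr_sumr -sumrB; apply: eq_bigr => i _.
    rewrite mulr_sumr -sumrB; apply: eq_bigr => j _.
    by rewrite /M mulrBl mulr_suml mulrA.
  rewrite -ME.
  have H := @bform_le_of_atom_mean R p p m m M A A cc cc p0 p0 m0 m0 cc0 cc0
    A0 Aii A0 Aii.
  have {}H := H _ z z' hz hz'.
  apply: le_trans (H _) _.
    move=> f g; rewrite !AE -mulrDr.
    set zf := atom_mean R f; set zg := atom_mean R g.
    have [b0|b0] := ltP 0 (net_form S zf + net_form S zg).
      have := ltW (g4 f g b0).
      by rewrite ME sumrB sumr_const card_ord -[bform _ _ _ *+ n]mulr_natl.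
    have nf y : 0 <= net_form S y by rewrite -AE.
    have nz y : net_form S y = 0 -> forall i, y i = 0.
      rewrite /net_form -/del => /eqP.
      rewrite paddr_eq0 ?S0//; last exact: mulr_ge0 (ltW del0) (z2 y).
      move=> /andP[_]; rewrite mulf_eq0 (gt_eqF del0)/= => /eqP h i.
      apply/eqP; rewrite -sqrf_eq0; apply/eqP.
      exact: (psumr_eq0P (fun i _ => sqr_ge0 (y i)) h).
    have zf0 : net_form S zf = 0.
      by apply/le_anti; rewrite nf andbT; have := nf zg; move: b0; clear; lra.
    have -> : bform M zf zg = 0.
      rewrite /bform big1// => i _; rewrite big1// => j _.
      by rewrite (nz _ zf0) mul0r mulr0.
    by apply: mulr_ge0 => //; exact: addr_ge0.
  have hA y : half_ball y -> bform A y y + (\sum_i A i i) / m%:R <= s / 2 + 2 * s.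
    move=> hy; apply: lerD.
      rewrite AE /net_form -/del (_ : s / 2 = s / 4 + s / 4); last by clear; field.
      apply: lerD; first exact: Ss.
      apply: (@le_trans _ _ (s * 4^-1)); last by [].
      apply: ler_pM => //; first exact: ltW.
      rewrite /del ler_pdivrMr// mulr_natr -[X in _ *+ X](card_ord p) -sumr_const.
      by apply: ler_sum => i _; have /andP[] := Sii i.
    rewrite trA -mulrA ler_wpM2l// ler_pdivrMr//; by rewrite mulrC.
  have := lerD (ler_wpM2l cc0 (hA z hz)) (ler_wpM2l cc0 (hA z' hz')).
  by move/le_trans; apply; clear; lra.
have D2 z z' : half_ball z -> half_ball z' ->
    \sum_k (\sum_i obs xs (k, i) * z i) * (\sum_i obs xs (k, i) * z' i) -
    n%:R * bform S z z' <= 2275 * (kap * theta * q * s).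
  move=> hz hz'; apply: le_trans (D1 z z' hz hz') _.
  by have := ler_wpM2r (ltW s0) ccq; clear; lra.
have X0 : 0 <= kap * theta * q * s.
  by rewrite !mulr_ge0 ?sqrtr_ge0// ltW.
split => [z z' hz hz'|z hz].
  apply: le_trans (D2 z z' hz hz') _.
  by move: X0; move: q {qm qn ccq D2} => q; clear; lra.
have := D2 z z hz hz; under eq_bigr do rewrite -expr2.
have h1 : kap * theta * q * s <= kap * theta * (n%:R + m%:R) * s.
  by rewrite ler_wpM2r ?(ltW s0)// ler_wpM2l// mulr_ge0// ltW.
have h2 : n%:R * bform S z z <= kap * theta * (n%:R + m%:R) * s.
  apply: (@le_trans _ _ (n%:R * s)).
    rewrite ler_wpM2l ?(ltW nR)//; apply: le_trans (Ss z hz) _.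
    by rewrite ler_pdivrMr// ler_peMr ?(ltW s0)// ler1n.
  rewrite ler_wpM2r ?(ltW s0)// -[leLHS]mul1r; apply: ler_pM => //; last by rewrite lerDl ltW.
  rewrite -[1]mulr1; apply: ler_pM => //; apply: le_trans th4; by rewrite ler1n.
have h3 : 0 <= kap * theta * (n%:R + m%:R) * s := le_trans X0 h1.
move: h1 h2 h3; rewrite -!(mulrA (10 ^+ 4)).
move: (kap * theta * q * s) (kap * theta * (n%:R + m%:R) * s) => a b.
move: (\sum_k _) (n%:R * bform S z z) => a1 a2; clear; lra.
Qed.

(** * The operator norm *)

(** By uniqueness on rectangles the joint law of [U] and [V] is the product of their laws; the
    probabilities of the sections are then integrated over [G]. *)
Lemma independent_section_bound d (T : measurableType d) d1
    (S1 : measurableType d1) d2 (S2 : measurableType d2) (R : realType)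
    (P : probability T R) (U : T -> S1) (V : T -> S2) (G : set S1)
    (E : set (S1 * S2)) (a b : R) :
  measurable_fun setT U -> measurable_fun setT V -> independent P U V ->
  measurable G -> measurable E -> 0 <= a -> 0 <= b ->
  ((1 - a)%:E <= P (U @^-1` G))%E ->
  (forall x, G x -> ((1 - b)%:E <= P [set w | E (x, V w)])%E) ->
  ((1 - (a + b))%:E <= P [set w | E (U w, V w)])%E.
Proof.
move=> mU mV indUV mG mE a0 b0 hG hE.
pose mu1 : probability S1 R := distribution P
  (HB.pack U (isMeasurableFun.Build _ _ _ _ U mU) : {RV P >-> _}).
pose mu2 : probability S2 R := distribution P
  (HB.pack V (isMeasurableFun.Build _ _ _ _ V mV) : {RV P >-> _}).
have mUV : measurable_fun setT (fun w => (U w, V w)) by exact: measurable_fun_pair.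
pose mu : probability (S1 * S2)%type R := distribution P
  (HB.pack (fun w => (U w, V w)) (isMeasurableFun.Build _ _ _ _ (fun w => (U w, V w)) mUV) : {RV P >-> _}).
have muE : (mu1 \x mu2)%E E = P [set w | E (U w, V w)].
  have rect (A : set S1) (B : set S2) : measurable A -> measurable B ->
      mu (A `*` B) = (mu1 A * mu2 B)%E.
    by move=> mA mB; exact: (indUV A B mA mB).
  by rewrite (@product_measure_unique _ _ _ _ _ mu1 mu2 mu).
(* Integration over [G] needs a nonnegative [1 - b]; for [b > 1] the left-hand side is negative. *)
have [b1|b1] := ltP 1 b.
  by apply: (@le_trans _ _ 0%E); rewrite ?measure_ge0// lee_fin; lra.
rewrite -muE /product_measure1.
apply: (@le_trans _ _ (\int[mu1]_(x in G) (1 - b)%:E)%E).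
  rewrite integral_cst//; apply: (@le_trans _ _ ((1 - b)%:E * (1 - a)%:E)%E).
    rewrite -EFinM lee_fin; nra.
  by apply: lee_wpmul2l => //; rewrite lee_fin subr_ge0.
apply: (@le_trans _ _ (\int[mu1]_(x in G) (mu2 (xsection E x)))%E).
  apply: ge0_le_integral => //.
  - by move=> x _; rewrite lee_fin subr_ge0.
  - by apply: measurable_funTS; exact: measurable_fun_xsection.
  - move=> x Gx; apply: le_trans (hE x Gx) _; rewrite le_eqVlt; apply/orP; left.
    apply/eqP; congr (P _); apply/seteqP; split => w /=.
      by rewrite /xsection /= inE.
    by rewrite /xsection /= inE.
apply: ge0_subset_integral => //.
exact: measurable_fun_xsection.
Qed.

Lemma dotv_mulmx (R : realType) (p : nat) (M : 'M[R]_p) (x : 'cV[R]_p) :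
  dotv (M *m x) (M *m x) = bform M (fun i => (M *m x) i 0) (fun j => x j 0).
Proof.
apply: eq_bigr => i _; rewrite {2}mxE mulr_sumr; apply: eq_bigr => j _; ring.
Qed.

Lemma dotv_ge0 (R : realType) (p : nat) (x : 'cV[R]_p) : 0 <= dotv x x.
Proof. by apply: sumr_ge0 => i _; rewrite -expr2 sqr_ge0. Qed.

Lemma dotvE (R : realType) (p : nat) (x : 'cV[R]_p) :
  dotv x x = \sum_i x i 0 ^+ 2.
Proof. by apply: eq_bigr => i _; rewrite expr2. Qed.

Lemma enorm_sqr (R : realType) (p : nat) (x : 'cV[R]_p) :
  enorm x ^+ 2 = dotv x x.
Proof. by rewrite sqr_sqrtr// dotv_ge0. Qed.

Lemma dot_sqr_le (R : realType) (p : nat) (a x : 'I_p -> R) :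
  (\sum_i a i * x i) ^+ 2 <= (\sum_i a i ^+ 2) * (\sum_i x i ^+ 2).
Proof.
have s0 (y : 'I_p -> R) : 0 <= \sum_i y i ^+ 2.
  by apply: sumr_ge0 => i _; exact: sqr_ge0.
set Z := \sum_i x i ^+ 2.
have [Z0|Zn] := eqVneq Z 0.
  rewrite Z0 mulr0 big1 ?expr0n// => i _.
  have /eqP : x i ^+ 2 = 0 by exact: (psumr_eq0P (fun i _ => sqr_ge0 (x i)) Z0).
  by rewrite sqrf_eq0 => /eqP ->; rewrite mulr0.
have Zp : 0 < Z by rewrite lt_def Zn s0.
set D := \sum_i a i * x i; set A := \sum_i a i ^+ 2.
have : 0 <= \sum_i (Z * a i - D * x i) ^+ 2 by exact: s0.
have -> : \sum_i (Z * a i - D * x i) ^+ 2 = Z * (A * Z - D ^+ 2).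
  transitivity (\sum_i (Z ^+ 2 * a i ^+ 2 - 2 * Z * D * (a i * x i) + D ^+ 2 * x i ^+ 2)).
    by apply: eq_bigr => i _; ring.
  by rewrite big_split/= sumrB -!mulr_sumr -/A -/D -/Z; ring.
by rewrite pmulr_rge0// subr_ge0.
Qed.

Lemma dotv_mulmx_le (R : realType) (p : nat) (M : 'M[R]_p) (x : 'cV[R]_p) :
  dotv (M *m x) (M *m x) <= (\sum_i \sum_j M i j ^+ 2) * dotv x x.
Proof.
rewrite !dotvE mulr_suml; apply: ler_sum => i _.
by rewrite mxE; exact: dot_sqr_le.
Qed.

Lemma opnorm_has_ubound (R : realType) (p : nat) (M : 'M[R]_p) :
  has_ubound [set enorm (M *m x) | x in [set x : 'cV[R]_p | enorm x <= 1]].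
Proof.
exists (Num.sqrt (\sum_i \sum_j M i j ^+ 2)) => _ [x /= x1 <-].
apply: ler_wsqrtr; apply: le_trans (dotv_mulmx_le _ _) _.
rewrite ler_piMr//.
  by apply: sumr_ge0 => i _; apply: sumr_ge0 => j _; exact: sqr_ge0.
by rewrite -enorm_sqr -[leRHS](expr1n _ 2%N) lerXn2r ?nnegrE ?sqrtr_ge0.
Qed.

Lemma enorm0 (R : realType) (p : nat) : enorm (0 : 'cV[R]_p) = 0.
Proof.
by rewrite /enorm /dotv big1 ?sqrtr0// => i _; rewrite !mxE mulr0.
Qed.

Lemma opnorm_ge0 (R : realType) (p : nat) (M : 'M[R]_p) : 0 <= opnorm M.
Proof.
apply: ub_le_sup; first exact: opnorm_has_ubound.
by exists 0; rewrite /= ?mulmx0 enorm0.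
Qed.

Lemma dotvZ (R : realType) (p : nat) (c : R) (x : 'cV[R]_p) :
  dotv (c *: x) (c *: x) = c ^+ 2 * dotv x x.
Proof. by rewrite mulr_sumr; apply: eq_bigr => i _; rewrite !mxE; ring. Qed.

Lemma dotv_mulmx_opnorm (R : realType) (p : nat) (M : 'M[R]_p) (x : 'cV[R]_p) :
  dotv (M *m x) (M *m x) <= opnorm M ^+ 2 * dotv x x.
Proof.
have [x0|xn] := eqVneq (dotv x x) 0.
  by apply: le_trans (dotv_mulmx_le _ _) _; rewrite x0 !mulr0.
have xp : 0 < dotv x x by rewrite lt_def xn dotv_ge0.
have q0 : 0 < enorm x by rewrite sqrtr_gt0.
have h : enorm (M *m ((enorm x)^-1 *: x)) <= opnorm M.
  apply: ub_le_sup; first exact: opnorm_has_ubound.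
  exists ((enorm x)^-1 *: x) => //=.
  by rewrite /enorm dotvZ exprVn enorm_sqr mulVf// sqrtr1.
have : enorm (M *m ((enorm x)^-1 *: x)) ^+ 2 <= opnorm M ^+ 2.
  by rewrite lerXn2r ?nnegrE ?sqrtr_ge0 ?opnorm_ge0.
by rewrite enorm_sqr -scalemxAr dotvZ exprVn enorm_sqr ler_pdivrMl// mulrC.
Qed.

Lemma opnorm_le (R : realType) (p : nat) (M : 'M[R]_p) (c : R) :
  0 <= c -> (forall x : 'cV[R]_p, dotv (M *m x) (M *m x) <= c ^+ 2 * dotv x x) ->
  opnorm M <= c.
Proof.
move=> c0 H; apply: ge_sup.
  by exists 0; exists 0; rewrite /= ?mulmx0 enorm0.
move=> _ [x /= x1 <-]; rewrite -(ger0_norm c0) -[leRHS]sqrtr_sqr.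
apply: ler_wsqrtr; apply: le_trans (H x) _; rewrite ler_piMr ?sqr_ge0//.
by rewrite -enorm_sqr -[leRHS](expr1n _ 2%N) lerXn2r ?nnegrE ?sqrtr_ge0.
Qed.

(** Both [x] and [M x] are scaled to norm 1/2, hence the factor 4. *)
Lemma opnorm_le_half_ball (R : realType) (p : nat) (M : 'M[R]_p) (c : R) :
  0 <= c ->
  (forall x y : 'I_p -> R, half_ball x -> half_ball y -> bform M x y <= c) ->
  opnorm M <= 4 * c.
Proof.
move=> c0 H; apply: opnorm_le; first by rewrite mulr_ge0.
move=> x; set y := M *m x.
have [x0|xn] := eqVneq (dotv x x) 0.
  by apply: le_trans (dotv_mulmx_le _ _) _; rewrite x0 !mulr0.
have [y0|yn] := eqVneq (dotv y y) 0.
  by rewrite y0 mulr_ge0 ?sqr_ge0 ?dotv_ge0.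
have xp : 0 < enorm x by rewrite sqrtr_gt0 lt_def xn dotv_ge0.
have yp : 0 < enorm y by rewrite sqrtr_gt0 lt_def yn dotv_ge0.
have hb (z : 'cV[R]_p) : 0 < enorm z -> half_ball (fun i => (2 * enorm z)^-1 * z i 0).
  move=> zp; rewrite /half_ball; under eq_bigr do rewrite exprMn.
  rewrite -mulr_sumr -dotvE -enorm_sqr le_eqVlt; apply/orP; left; apply/eqP.
  by field; rewrite gt_eqF.
have := H _ _ (hb y yp) (hb x xp).
have -> : bform M (fun i => (2 * enorm y)^-1 * y i 0) (fun i => (2 * enorm x)^-1 * x i 0)
    = (2 * enorm y)^-1 * (2 * enorm x)^-1 * dotv y y.
  rewrite /y dotv_mulmx /bform mulr_sumr; apply: eq_bigr => i _.
  by rewrite mulr_sumr; apply: eq_bigr => j _; ring.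
rewrite -!enorm_sqr (_ : _ * _ * _ = enorm y / (4 * enorm x)); last first.
  by field; rewrite !gt_eqF.
rewrite ler_pdivrMr ?mulr_gt0// => h.
rewrite -exprMn lerXn2r ?nnegrE ?(ltW yp)//.
  by rewrite mulr_ge0 ?(ltW xp)// mulr_ge0.
by rewrite (_ : 4 * c * _ = c * (4 * enorm x)) //; ring.
Qed.

(** * Measurability of the operator norm *)

Lemma sqrD_weighted_le (R : realType) (a b e : R) :
  0 < e -> (a + b) ^+ 2 <= (1 + e) * a ^+ 2 + (1 + e^-1) * b ^+ 2.
Proof.
move=> e0; rewrite -subr_ge0.
rewrite (_ : _ - _ = e^-1 * (e * a - b) ^+ 2); last by field; rewrite gt_eqF.
by rewrite mulr_ge0 ?sqr_ge0// invr_ge0 ltW.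
Qed.

Lemma dotvD_weighted_le (R : realType) (p : nat) (x y : 'cV[R]_p) (e : R) :
  0 < e ->
  dotv (x + y) (x + y) <= (1 + e) * dotv x x + (1 + e^-1) * dotv y y.
Proof.
move=> e0; rewrite !dotvE !mulr_sumr -big_split/=; apply: ler_sum => i _.
by rewrite mxE; exact: sqrD_weighted_le.
Qed.

(** A rational [y] is taken within [e] of [x] in each coordinate. The weights [1 + e] and
    [1 + 1 / e] turn the squared distance [p e ^ 2] into an error of order [e], which tends to 0. *)
Lemma dotv_le_of_rat (R : realType) (p : nat) (M : 'M[R]_p) (c : R) :
  (forall q : {ffun 'I_p -> rat}, let x := \col_i ratr (q i) in
     dotv (M *m x) (M *m x) <= c ^+ 2 * dotv x x) ->
  forall x : 'cV[R]_p, dotv (M *m x) (M *m x) <= c ^+ 2 * dotv x x.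
Proof.
move=> H x; pose F := \sum_i \sum_j M i j ^+ 2.
have F0 : 0 <= F.
  by apply: sumr_ge0 => i _; apply: sumr_ge0 => j _; exact: sqr_ge0.
pose C := 3 * (c ^+ 2 * dotv x x) + 4 * (c ^+ 2 * p%:R) + 2 * (F * p%:R).
have C0 : 0 <= C.
  have c0 := sqr_ge0 c; have x0 := dotv_ge0 x.
  by rewrite /C; apply: addr_ge0; [apply: addr_ge0|]; apply: mulr_ge0 => //; apply: mulr_ge0.
have key e : 0 < e -> e <= 1 ->
    dotv (M *m x) (M *m x) <= c ^+ 2 * dotv x x + e * C.
  move=> e0 e1.
  have /choice[q0 hq0] : forall i, exists r : rat, x i 0 - e < ratr r < x i 0 + e.
    move=> i; have h : x i 0 - e < x i 0 + e by move: e0; clear; lra.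
    by have [r] := rat_in_itvoo h; rewrite in_itv/=; exists r.
  pose q := [ffun i => q0 i]; pose y := \col_i ratr (q i) : 'cV[R]_p.
  have hd : dotv (x - y) (x - y) <= p%:R * e ^+ 2.
    have -> : p%:R * e ^+ 2 = \sum_(i < p) e ^+ 2.
      by rewrite sumr_const card_ord mulr_natl.
    rewrite dotvE.
    apply: ler_sum => i _; rewrite !mxE ffunE.
    by have /andP[] := hq0 i; nra.
  have hd' : dotv (y - x) (y - x) <= p%:R * e ^+ 2.
    by rewrite -(opprB x y) -scaleN1r dotvZ sqrrN expr1n mul1r.
  have h1 := dotvD_weighted_le (M *m y) (M *m (x - y)) e0.
  have h2 := dotvD_weighted_le x (y - x) e0.
  have h3 := H q.
  rewrite -mulmxDr (addrC y) subrK in h1.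
  rewrite addrCA subrr addr0 in h2.
  have h4 : (1 + e^-1) * dotv (y - x) (y - x) <= 2 * p%:R * e.
    apply: (@le_trans _ _ ((1 + e^-1) * (p%:R * e ^+ 2))).
      by rewrite ler_wpM2l// addr_ge0// invr_ge0 ltW.
    rewrite (_ : _ * (_ * _) = p%:R * e * (1 + e)); last by field; rewrite gt_eqF.
    rewrite (_ : 2 * _ * _ = p%:R * e * 2); last by ring.
    by rewrite ler_wpM2l ?mulr_ge0 ?(ltW e0)//; move: e1; clear; lra.
  have h5 : (1 + e^-1) * dotv (M *m (x - y)) (M *m (x - y)) <= F * (2 * p%:R * e).
    apply: (@le_trans _ _ ((1 + e^-1) * (F * (p%:R * e ^+ 2)))).
      rewrite ler_wpM2l ?addr_ge0 ?invr_ge0 ?(ltW e0)//.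
      by apply: le_trans (dotv_mulmx_le _ _) _; rewrite ler_wpM2l.
    rewrite mulrCA ler_wpM2l//.
    rewrite (_ : _ * (_ * _) = p%:R * e * (1 + e)); last by field; rewrite gt_eqF.
    rewrite (_ : 2 * _ * _ = p%:R * e * 2); last by ring.
    by rewrite ler_wpM2l ?mulr_ge0 ?(ltW e0)//; move: e1; clear; lra.
  have c2 : 0 <= c ^+ 2 by exact: sqr_ge0.
  have e1' : 0 <= 1 + e by rewrite addr_ge0 ?(ltW e0).
  have h6 : (1 + e) * dotv (M *m y) (M *m y) <=
      (1 + e) * (c ^+ 2 * ((1 + e) * dotv x x + 2 * p%:R * e)).
    rewrite ler_wpM2l//; apply: le_trans h3 _; rewrite ler_wpM2l//.
    by apply: le_trans h2 _; rewrite lerD2l.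
  apply: le_trans h1 _; apply: le_trans (lerD h6 h5) _.
  have X0 := dotv_ge0 x.
  rewrite -subr_ge0 (_ : _ - _ = (1 - e) * e * (c ^+ 2 * dotv x x) +
    (1 - e) * e * (2 * (c ^+ 2 * p%:R))); last by rewrite /C; ring.
  have e2 : 0 <= (1 - e) * e by rewrite mulr_ge0 ?(ltW e0)// subr_ge0.
  by apply: addr_ge0; apply: mulr_ge0 => //; apply: mulr_ge0 => //; apply: mulr_ge0.
apply/ler_addgt0Pr => e e0.
pose e' := Num.min 1 (e / (C + 1)).
have C1 : 0 < C + 1 by rewrite ltr_wpDl.
have e'0 : 0 < e' by rewrite lt_min ltr01 divr_gt0.
apply: le_trans (key e' e'0 _) _; first by rewrite ge_min lexx.
rewrite lerD2l; apply: (@le_trans _ _ (e / (C + 1) * C)).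
  by rewrite ler_wpM2r// ge_min lexx orbT.
by rewrite mulrAC ler_pdivrMr// ler_wpM2l ?(ltW e0)// lerDl.
Qed.

(** The supremum runs over an uncountable ball; homogeneity and density turn the event into a
    countable intersection of conditions at rational vectors. *)
Lemma measurable_opnorm_le d (T : measurableType d) (R : realType) (p : nat)
    (M : T -> 'M[R]_p) (c : R) :
  (forall i j, measurable_fun setT (fun w => M w i j)) ->
  measurable [set w | opnorm (M w) <= c].
Proof.
move=> mM; have [c0|c0] := ltP c 0.
  rewrite (_ : [set w | _] = set0)//; apply/seteqP; split => w //= h.
  by have := le_lt_trans (le_trans (opnorm_ge0 (M w)) h) c0; rewrite ltxx.
pose B (q : {ffun 'I_p -> rat}) := [set w | let x := \col_i ratr (q i) in
     dotv (M w *m x) (M w *m x) <= c ^+ 2 * dotv x x].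
have mB q : measurable (B q).
  apply: measurable_le_set => //.
  apply: measurable_sum => i.
  suff H : measurable_fun setT (fun w => (M w *m (\col_i ratr (q i))) i 0).
    exact: measurable_funM.
  under eq_fun do rewrite mxE.
  by apply: measurable_sum => j; apply: measurable_funM.
rewrite (_ : [set w | _] = \bigcap_(k : nat) (if unpickle k is Some q then B q else setT)).
  by apply: bigcapT_measurable => k; case: (unpickle k).
apply/seteqP; split => w /= h.
  move=> k _; case: (unpickle k) => // q; rewrite /B /=.
  apply: le_trans (dotv_mulmx_opnorm _ _) _.
  by rewrite ler_wpM2r ?dotv_ge0// lerXn2r ?nnegrE ?opnorm_ge0.
apply: opnorm_le => //; apply: dotv_le_of_rat => q.
by have := h (pickle q) I; rewrite pickleK.
Qed.

(** * Quadratic forms and positive semidefinite matrices *)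

Lemma dotv_bform (R : realType) (p : nat) (M : 'M[R]_p) (z : 'I_p -> R) :
  bform M z z = \sum_i z i * (M *m \col_j z j) i 0.
Proof.
apply: eq_bigr => i _; rewrite mxE mulr_sumr; apply: eq_bigr => j _.
by rewrite mxE; ring.
Qed.

Lemma bform_le_opnorm (R : realType) (p : nat) (M : 'M[R]_p) (z : 'I_p -> R) :
  bform M z z <= opnorm M * \sum_i z i ^+ 2.
Proof.
have Z0 : 0 <= \sum_i z i ^+ 2 by apply: sumr_ge0 => i _; exact: sqr_ge0.
have s0 := opnorm_ge0 M.
apply: le_trans (ler_norm _) _.
rewrite -[leRHS]ger0_norm ?mulr_ge0// -ler_sqr ?nnegrE// !real_normK ?num_real//.
rewrite dotv_bform; apply: le_trans (dot_sqr_le _ _) _.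
rewrite -dotvE; set x := \col_j z j.
have xE : dotv x x = \sum_i z i ^+ 2 by rewrite dotvE; apply: eq_bigr => i _; rewrite mxE.
rewrite -xE in Z0 *.
apply: le_trans (ler_wpM2l Z0 (dotv_mulmx_opnorm M x)) _.
by rewrite (_ : dotv x x * _ = (opnorm M * dotv x x) ^+ 2)//; ring.
Qed.

Lemma diag_le_opnorm (R : realType) (p : nat) (M : 'M[R]_p) (i : 'I_p) :
  M i i <= opnorm M.
Proof.
rewrite -[leLHS](bform_unitv M); apply: le_trans (bform_le_opnorm _ _) _.
rewrite (bigD1 i)//= /unitv eqxx expr1n big1 ?addr0 ?mulr1// => j /negbTE ->.
by rewrite expr0n.
Qed.

Lemma bform_two_unitv (R : realType) (p : nat) (M : 'M[R]_p) (i j : 'I_p) (a b : R) :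
  bform M (fun k => a * unitv R i k + b * unitv R j k)
          (fun k => a * unitv R i k + b * unitv R j k) =
  a ^+ 2 * M i i + a * b * (M i j + M j i) + b ^+ 2 * M j j.
Proof.
rewrite -(bform_unitv M i i) -(bform_unitv M i j) -(bform_unitv M j i) -(bform_unitv M j j).
rewrite -!big_split/= !mulr_sumr -!big_split/=; apply: eq_bigr => k _.
rewrite -!big_split/= !mulr_sumr -!big_split/=; apply: eq_bigr => l _.
ring.
Qed.

Lemma psd_entry_sqr_le (R : realType) (p : nat) (M : 'M[R]_p) (i j : 'I_p) :
  M j i = M i j -> (forall z, 0 <= bform M z z) -> M i j ^+ 2 <= M i i * M j j.
Proof.
move=> Mji M0.
have H a b : 0 <= a ^+ 2 * M i i + a * b * (M i j + M i j) + b ^+ 2 * M j j.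
  by have := bform_two_unitv M i j a b; rewrite Mji => <-.
have Mii : 0 <= M i i by have := H 1 0; rewrite expr1n expr0n/= mul1r mulr0 !mul0r !addr0.
have Mjj : 0 <= M j j by have := H 0 1; rewrite expr1n expr0n/= mul1r !mul0r !add0r.
have [j0|jn] := eqVneq (M j j) 0.
  have [->|mn] := eqVneq (M i j) 0; first by rewrite expr0n mulr_ge0.
  (* With [M j j = 0] this coefficient makes the form equal to [- M i i - 2], which is negative. *)
  have := H 1 (- (M i i + 1) / M i j).
  rewrite j0 (_ : _ + _ = - M i i - 2); last by field.
  by move: Mii; clear; lra.
have jp : 0 < M j j by rewrite lt_def jn.
have := H (M j j) (- M i j).
rewrite (_ : _ + _ = M j j * (M i i * M j j - M i j ^+ 2)); last by ring.
by rewrite pmulr_rge0// subr_ge0.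
Qed.

(** Through the Frobenius norm: the sum of the [M i j ^ 2] is at most that of the [M i i * M j j],
    the squared trace. This gives an effective rank of at least 1. *)
Lemma opnorm_le_trace (R : realType) (p : nat) (M : 'M[R]_p) :
  (forall i j, M j i = M i j) -> (forall z, 0 <= bform M z z) ->
  opnorm M <= \tr M.
Proof.
move=> Ms M0; have tr0 : 0 <= \tr M.
  by apply: sumr_ge0 => i _; rewrite -(bform_unitv M).
apply: opnorm_le => // x; apply: le_trans (dotv_mulmx_le _ _) _.
rewrite ler_wpM2r ?dotv_ge0// expr2 /mxtrace mulr_suml; apply: ler_sum => i _.
by rewrite mulr_sumr; apply: ler_sum => j _; exact: psd_entry_sqr_le.
Qed.

Lemma opnorm_eq0 (R : realType) (p : nat) (M : 'M[R]_p) : opnorm M = 0 -> M = 0.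
Proof.
move=> M0; apply/matrixP => i j; rewrite mxE.
have := dotv_mulmx_opnorm M (delta_mx j 0).
rewrite M0 expr0n/= mul0r -colE dotvE => h.
have {h} h : \sum_i col j M i 0 ^+ 2 = 0.
  by apply/le_anti; rewrite h sumr_ge0// => k _; exact: sqr_ge0.
have := psumr_eq0P (fun i _ => sqr_ge0 (col j M i 0)) h.
by move=> /(_ i isT) /eqP; rewrite sqrf_eq0 mxE => /eqP.
Qed.

Lemma opnorm0 (R : realType) (p : nat) : opnorm (0 : 'M[R]_p) = 0.
Proof.
apply/le_anti; rewrite opnorm_ge0 andbT; apply: opnorm_le => // x.
by rewrite mul0mx expr0n/= mul0r /dotv big1// => i _; rewrite mxE mul0r.
Qed.

(** * The estimator *)

Lemma Lambda_mulmxE (R : realType) (n p : nat) (c : R) (X : 'I_n.+1 -> 'cV[R]_p)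
    (k : 'I_n) (v : 'cV[R]_p) (i : 'I_p) :
  (Lambda c X k *m v) i 0 =
  c * Num.sqrt (ln k.+1%:R) *
  Num.sqrt (k.+1%:R^-1 * \sum_(j < n.+1 | (j < k.+1)%N) X j i 0 ^+ 2) * v i 0.
Proof. by rewrite /Lambda mul_diag_mx !mxE. Qed.

Lemma onebit_entry (R : realType) (n p : nat) (K : R) (xs : 'I_n.+1 -> p.-tuple R)
    (t : 'I_n -> p.-tuple R) (k : 'I_n) (i : 'I_p) :
  (Lambda (2 * (K + 1)) (fun j => colv (xs j)) k *m
     map_mx (@sgn1 R) (colv (xs (lift ord0 k)) +
       Lambda (2 * (K + 1)) (fun j => colv (xs j)) k *m colv (t k))) i 0 =
  if 0 <= obs xs (k, i) + scale K xs (k, i) * tnth (t k) i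
  then scale K xs (k, i) else - scale K xs (k, i).
Proof.
have E (v : 'cV[R]_p) : (Lambda (2 * (K + 1)) (fun j => colv (xs j)) k *m v) i 0 =
    scale K xs (k, i) * v i 0.
  rewrite Lambda_mulmxE /scale; congr (_ * Num.sqrt (_ * _) * _).
  by apply: eq_bigr => j _; rewrite mxE.
rewrite E mxE [X in sgn1 X]mxE E !mxE /sgn1 /obs /=.
by case: ifP => _; rewrite ?mulr1 ?mulrN1.
Qed.

Lemma bform_outer (R : realType) (p : nat) (u v : 'cV[R]_p) (y x : 'I_p -> R) :
  bform (u *m v^T) y x = (\sum_i u i 0 * y i) * (\sum_i v i 0 * x i).
Proof.
rewrite big_distrlr/=; apply: eq_bigr => i _; apply: eq_bigr => j _.
by rewrite mxE big_ord1 !mxE; ring.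
Qed.

Lemma bform_Sigma' (R : realType) (n p : nat) (c : R) (X : 'I_n.+1 -> 'cV[R]_p)
    (tau taub : 'I_n -> 'cV[R]_p) (y x : 'I_p -> R) :
  let u t (k : 'I_n) := Lambda c X k *m
       map_mx (@sgn1 R) (X (lift ord0 k) + Lambda c X k *m t k) in
  bform (Sigma' c X tau taub) y x =
  n%:R^-1 * \sum_k (\sum_i u tau k i 0 * y i) * (\sum_i u taub k i 0 * x i).
Proof.
move=> u; transitivity (n%:R^-1 * \sum_k bform (u tau k *m (u taub k)^T) y x); last first.
  by congr (_ * _); apply: eq_bigr => k _; exact: bform_outer.
rewrite /bform [in RHS]exchange_big/= mulr_sumr; apply: eq_bigr => i _.
rewrite [in RHS]exchange_big/= mulr_sumr; apply: eq_bigr => j _.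
by rewrite /Sigma' mxE summxE -mulrA mulr_suml.
Qed.

Lemma opnorm_symmetrized_le (R : realType) (p : nat) (A S : 'M[R]_p) (b : R) :
  (forall i j, S j i = S i j) -> 0 <= b ->
  (forall y x, half_ball y -> half_ball x -> bform A y x - bform S y x <= b) ->
  opnorm (2^-1 *: A + 2^-1 *: A^T - S) <= 4 * b.
Proof.
move=> Ss b0 H; apply: opnorm_le_half_ball => // y x hy hx.
have E : bform (2^-1 *: A + 2^-1 *: A^T - S) y x =
    2^-1 * (bform A y x - bform S y x) + 2^-1 * (bform A x y - bform S x y).
  have T (M : 'M[R]_p) : bform M x y = \sum_i \sum_j M j i * (y i * x j).
    rewrite /bform exchange_big; apply: eq_bigr => i _; apply: eq_bigr => j _.
    by rewrite (mulrC (x j)).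
  rewrite !T /bform -!sumrB !mulr_sumr -big_split/=; apply: eq_bigr => i _.
  rewrite -!sumrB !mulr_sumr -big_split/=; apply: eq_bigr => j _.
  by rewrite !mxE Ss; field.
rewrite E; have := H y x hy hx; have := H x y hx hy.
by clear; lra.
Qed.

(** With [y = r / n], the squared left side is at most [2 y + 4 y ^ 2], whereas the squared right
    side is [4 y + 8 y sqrt y + 4 y ^ 2]. *)
Lemma effective_rate_le (R : realType) (n m : nat) (r : R) :
  (0 < n)%N -> 0 <= r -> m%:R <= 2 * r ->
  Num.sqrt (m%:R * (n%:R + m%:R)) / n%:R <= 2 * (Num.sqrt (r / n%:R) + r / n%:R).
Proof.
move=> n0 r0 hm; have nR : (0 : R) < n%:R by rewrite ltr0n.
have y0 : 0 <= r / n%:R by rewrite divr_ge0// ltW.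
have [y yE] : exists y, y = r / n%:R by eexists.
have rE : r = y * n%:R by rewrite yE divfK// gt_eqF.
rewrite -yE in y0 *; have sy := sqrtr_ge0 y.
rewrite ler_pdivrMr// -[leRHS]ger0_norm ?mulr_ge0 ?addr_ge0 ?(ltW nR)//.
rewrite -[leRHS]sqrtr_sqr; apply: ler_wsqrtr.
have hy : Num.sqrt y ^+ 2 = y by rewrite sqr_sqrtr.
set N : R := n%:R in nR rE *; set M : R := m%:R in hm *.
have M0 : 0 <= M by rewrite /M.
have h : M * (N + M) <= 2 * r * (N + 2 * r).
  by apply: ler_pM => //; [apply: addr_ge0 => //; exact: ltW | rewrite lerD2l].
apply: le_trans h _; rewrite rE.
rewrite -subr_ge0 (_ : _ - _ = 2 * (2 * Num.sqrt y ^+ 2 - y) * N ^+ 2 + 8 * (Num.sqrt y * y * N ^+ 2)); last by ring.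
rewrite hy addr_ge0// mulr_ge0 ?sqr_ge0//; last by rewrite mulr_ge0 ?sqr_ge0// mulr_ge0.
by move: y0; clear; lra.
Qed.

Lemma half_le_ln2 (R : realType) : 2^-1 <= ln 2 :> R.
Proof.
rewrite -ler_expR lnK ?posrE//.
have h : (2^-1 : R) <= 1 by clear; lra.
by apply: le_trans (expR_le_quadratic h) _; clear; lra.
Qed.

Lemma half_le_ln_nat (R : realType) (n : nat) : (1 < n)%N -> 2^-1 <= ln n%:R :> R.
Proof.
move=> n1; apply: le_trans (half_le_ln2 R) _.
by rewrite ler_ln ?posrE ?ltr0n ?(ltnW n1)// ler_nat.
Qed.

(** The argument produces the rate [theta ^ 2], which [theta >= 1] places below both stated powers,
    and the factor [ln p] enters through [1 <= 2 ln p]. The constant is [272 = 4 * 17 * 2 * 2]. *)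
Lemma error_rate_le (R : realType) (k l lp s th r q : R) (n : nat) :
  0 <= k -> 2^-1 <= l -> 2^-1 <= lp -> 0 <= s -> 1 <= th -> 0 <= r ->
  q / n%:R <= 2 * (Num.sqrt (r / n%:R) + r / n%:R) ->
  4 * (17 * 10 ^+ 4 * k * l * th ^+ 2 * s * q / n%:R) <=
  272 * 10 ^+ 4 * k * (lp * l * s *
    (th `^ (5 / 2) * Num.sqrt (r / n%:R) + th `^ (7 / 2) * (r / n%:R))).
Proof.
move=> k0 l0 lp0 s0 th1 r0 hq.
have y0 : 0 <= r / n%:R by rewrite divr_ge0.
have th2 a : 2 <= a -> th ^+ 2 <= th `^ a.
  move=> a2; rewrite -powR_mulrn ?(le_trans ler01 th1)//.
  exact: ler_powR.
move: (r / n%:R) y0 hq => z y0; have := sqrtr_ge0 z.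
move: (Num.sqrt z) => w w0 hq.
have h5 : th ^+ 2 <= th `^ (5 / 2) by apply: th2; clear; lra.
have h7 : th ^+ 2 <= th `^ (7 / 2) by apply: th2; clear; lra.
move: (th `^ (5 / 2)) (th `^ (7 / 2)) h5 h7 => t5 t7 h5 h7.
have t0 := sqr_ge0 th.
have [c cE] : exists c : R, c = 10 ^+ 4 by eexists.
have c0 : 0 <= c by rewrite cE exprn_ge0.
rewrite -cE {cE}.
have hL : 0 <= l by apply: le_trans l0; rewrite invr_ge0.
have A : th ^+ 2 * (q / n%:R) <= 2 * (t5 * w + t7 * z).
  apply: (@le_trans _ _ (th ^+ 2 * (2 * (w + z)))); first exact: ler_wpM2l.
  rewrite mulrCA ler_wpM2l// mulrDr.
  by apply: lerD; apply: ler_wpM2r.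
have B0 : 0 <= t5 * w + t7 * z.
  by apply: addr_ge0; apply: mulr_ge0 => //; apply: le_trans t0 _.
rewrite (_ : 4 * _ = 68 * (c * k * l * s) * (th ^+ 2 * (q / n%:R))); last by ring.
have D0 : 0 <= c * k * l * s by rewrite !mulr_ge0.
apply: (@le_trans _ _ (68 * (c * k * l * s) * (2 * (t5 * w + t7 * z)))).
  by apply: ler_wpM2l => //; apply: mulr_ge0.
rewrite (_ : 68 * _ * _ = 136 * (c * k * l * s) * (t5 * w + t7 * z) * 1); last by ring.
rewrite (_ : 272 * c * _ * _ = 136 * (c * k * l * s) * (t5 * w + t7 * z) * (2 * lp)); last by ring.
apply: ler_wpM2l; first by apply: mulr_ge0 => //; apply: mulr_ge0.
by move: lp0; clear; lra.
Qed.

(** The bound is stated on a measurable event inside the error event, namely the complement of the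
    bad sign patterns, so that the measurability of the operator norm can be treated separately. *)
Lemma onebit_section d (T : measurableType d) (R : realType)
    (P : probability T R) (n p m : nat) (K theta : R) (S : 'M[R]_p)
    (xs : 'I_n.+1 -> p.-tuple R) (tau taub : 'I_n -> {RV P >-> p.-tuple R}) :
  0 < K -> (1 < n)%N -> (1 < p)%N -> (0 < m)%N -> 4 <= theta ->
  p%:R <= expR (theta / 8) -> n%:R <= expR (theta / 8) ->
  (forall i j, S j i = S i j) -> (forall z, 0 <= bform S z z) ->
  0 < opnorm S -> \tr S <= m%:R * opnorm S -> good_sample m K theta S xs ->
  (forall k, uniform_cube P (tau k)) -> (forall k, uniform_cube P (taub k)) ->
  mutually_independent P
    (fun s : 'I_n + 'I_n =>
       (match s with inl k => tau k | inr k => taub k end) : T -> p.-tuple R) ->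
  exists A : set T, [/\ measurable A, ((1 - 3 * expR (- theta))%:E <= P A)%E &
    A `<=` [set w | opnorm (Sigma_adap (2 * (K + 1)) (fun j => colv (xs j))
                        (fun k => colv (tau k w)) (fun k => colv (taub k w)) - S)
              <= 4 * (17 * 10 ^+ 4 * ((K + 1) ^+ 2) ^+ 3 * ln n%:R * theta ^+ 2 *
                   opnorm S * Num.sqrt (m%:R * (n%:R + m%:R)) / n%:R)]].
Proof.
move=> K0 n1 p1 m0 th4 hp hn Ss S0 s0 trS gs utau utaub ind.
have th0 : 0 < theta by apply: lt_le_trans th4.
have kap1 : 1 <= (K + 1) ^+ 2 by rewrite exprn_ege1// lerDr ltW.
have Sii i : 0 <= S i i <= opnorm S by rewrite diag_le_opnorm andbT -(bform_unitv S).
have Sii0 i : 0 <= S i i by case/andP: (Sii i).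
have nR : (0 : R) < n%:R by rewrite ltr0n ltnW.
have tr0 : 0 < \sum_i S i i by exact: lt_le_trans s0 (opnorm_le_trace Ss S0).
have Sq z : half_ball z -> bform S z z <= opnorm S / 4.
  by move=> hz; apply: le_trans (bform_le_opnorm _ _) _; rewrite ler_wpM2l// ltW.
have [hD hX] := good_sample_covariance (ltnW n1) (ltnW p1) m0 K0 th4 s0 S0 Sq Sii tr0 trS gs.
have hx c : obs xs c ^+ 2 <= 3 * theta * (K + 1) ^+ 2 * S c.2 c.2.
  by case: gs => g1 _ _ _; rewrite -mulrA; exact: g1.
have he i := good_sample_excess K0 th4 (Sii0 i) gs.
have hl c := good_sample_scale (c := c) K0 (ltW th0) (Sii0 c.2) gs.
have [Q [Qp Qe]] := onebit_error_bound n1 p1 m0 (lexx _) th4 kap1 (half_le_ln_nat R n1)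
  s0 hp hn Sii trS (fun c => scale_ge0 xs c K0) hl hx he hX hD.
have [mQ PQ] := dither_patterns (obs xs) (scale K xs) Q utau utaub ind.
eexists; split; first exact: measurableC mQ.
  rewrite [leRHS](probability_setC _ mQ) EFinB; apply: leeB => //.
  by apply: le_trans PQ _; rewrite lee_fin.
move=> w /= /negP nQ; set B := _ / n%:R.
have B0 : 0 <= B.
  rewrite /B divr_ge0 ?(ltW nR)//; apply: mulr_ge0; last exact: sqrtr_ge0.
  apply: mulr_ge0; last exact: ltW.
  apply: mulr_ge0; last exact: sqr_ge0.
  apply: mulr_ge0; last by apply: le_trans (half_le_ln_nat R n1); rewrite invr_ge0.
  by apply: mulr_ge0; [apply: mulr_ge0 => //|]; apply: exprn_ge0 => //; exact: sqr_ge0.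
apply: opnorm_symmetrized_le => // y z hy hz.
rewrite bform_Sigma' -(ler_pM2l nR) mulrBr mulrA divff ?gt_eqF// mul1r.
rewrite /B mulrCA divff ?gt_eqF// mulr1.
apply: le_trans (Qe _ nQ y z hy hz); rewrite lerD2r le_eqVlt; apply/orP; left; apply/eqP.
apply: eq_bigr => k _; congr (_ * _); apply: eq_bigr => i _; congr (_ * _);
  rewrite ffunE; [exact: (onebit_entry K xs (fun k => tau k w))|].
exact: (onebit_entry K xs (fun k => taub k w)).
Qed.

(** * Measurability of the estimator *)

Lemma measurable_scale d (T : measurableType d) (R : realType) (n p : nat) (K : R)
    (xs : T -> 'I_n.+1 -> p.-tuple R) (c : 'I_n * 'I_p) :
  (forall j i, measurable_fun setT (fun w => tnth (xs w j) i)) ->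
  measurable_fun setT (fun w => scale K (xs w) c).
Proof.
move=> mx; apply: measurable_funM => //.
apply: (measurableT_comp (continuous_measurable_fun (@sqrt_continuous R))).
apply: measurable_funM => //; under eq_fun do rewrite big_mkcond/=.
apply: measurable_sum => j; case: (j < c.1.+1)%N => //; exact: measurable_funX.
Qed.

Lemma Sigma'E (R : realType) (n p : nat) (K : R) (xs : 'I_n.+1 -> p.-tuple R)
    (t tb : 'I_n -> p.-tuple R) (i j : 'I_p) :
  let o (u : 'I_n -> p.-tuple R) k i :=
    if 0 <= obs xs (k, i) + scale K xs (k, i) * tnth (u k) i
    then scale K xs (k, i) else - scale K xs (k, i) in
  Sigma' (2 * (K + 1)) (fun j => colv (xs j)) (fun k => colv (t k))
    (fun k => colv (tb k)) i j = n%:R^-1 * \sum_k o t k i * o tb k j.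
Proof.
move=> o; rewrite /Sigma' mxE summxE; congr (_ * _); apply: eq_bigr => k _.
rewrite mxE big_ord1 [X in _ * X]mxE; congr (_ * _); exact: onebit_entry.
Qed.

Lemma measurable_Sigma_adap_sub d (T : measurableType d) (R : realType)
    (n p : nat) (K : R) (xs : T -> 'I_n.+1 -> p.-tuple R)
    (t tb : T -> 'I_n -> p.-tuple R) (S : 'M[R]_p) (i j : 'I_p) :
  (forall j i, measurable_fun setT (fun w => tnth (xs w j) i)) ->
  (forall k i, measurable_fun setT (fun w => tnth (t w k) i)) ->
  (forall k i, measurable_fun setT (fun w => tnth (tb w k) i)) ->
  measurable_fun setT (fun w => (Sigma_adap (2 * (K + 1)) (fun j => colv (xs w j))
    (fun k => colv (t w k)) (fun k => colv (tb w k)) - S) i j).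
Proof.
move=> mx mt mtb.
have mo (u : T -> 'I_n -> p.-tuple R) k l :
    (forall k i, measurable_fun setT (fun w => tnth (u w k) i)) ->
    measurable_fun setT (fun w =>
    if 0 <= obs (xs w) (k, l) + scale K (xs w) (k, l) * tnth (u w k) l
    then scale K (xs w) (k, l) else - scale K (xs w) (k, l)).
  move=> mu; have ms := measurable_scale K (k, l) mx.
  apply: measurable_fun_ifT => //; last exact: measurableT_comp.
  apply: measurable_fun_ler => //; apply: measurable_funD; first exact: mx.
  exact: measurable_funM.
have mS a b : measurable_fun setT (fun w => Sigma' (2 * (K + 1))
    (fun j => colv (xs w j)) (fun k => colv (t w k)) (fun k => colv (tb w k)) a b).
  under eq_fun do rewrite Sigma'E.
  apply: measurable_funM => //; apply: measurable_sum => k.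
  by apply: measurable_funM; exact: mo.
have E (A : 'M[R]_p) : (2^-1 *: A + 2^-1 *: A^T - S) i j =
    2^-1 * A i j + 2^-1 * A j i - S i j by rewrite !mxE.
under eq_fun do rewrite E.
by apply: measurable_funB => //; apply: measurable_funD; apply: measurable_funM.
Qed.

Lemma Sigma_adap_sample0 (R : realType) (n p : nat) (c : R)
    (X : 'I_n.+1 -> 'cV[R]_p) (tau taub : 'I_n -> 'cV[R]_p) :
  (forall j, X j = 0) -> Sigma_adap c X tau taub = 0.
Proof.
move=> X0; have L0 k : Lambda c X k = 0.
  apply/matrixP => i j; rewrite !mxE big1 => [|l _]; last by rewrite X0 mxE expr0n.
  by rewrite mulr0 sqrtr0 mulr0 mul0rn.
have S0 : Sigma' c X tau taub = 0.
  by rewrite /Sigma' big1 ?scaler0// => k _; rewrite L0 !mul0mx.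
by rewrite /Sigma_adap S0 trmx0 !scaler0 addr0.
Qed.

Theorem theorem7 (R : realType) (K : R) (hK : 0 < K) :
  exists C1 C2 C : R, [/\ 0 < C1, 0 < C2, 0 < C &
  forall (n p : nat), (1 < n)%N -> (1 < p)%N ->
  forall (d0 : measure_display) (T0 : measurableType d0)
    (P0 : probability T0 R) (X : {RV P0 >-> p.-tuple R}),
    square_integrable P0 X -> mean_zero P0 X -> subgaussian P0 K X ->
  forall (d : measure_display) (T : measurableType d) (P : probability T R)
    (Xs : 'I_n.+1 -> {RV P >-> p.-tuple R})
    (tau taub : 'I_n -> {RV P >-> p.-tuple R}),
    (forall j, same_law P (Xs j) P0 X) ->
    mutually_independent P (fun j => Xs j : T -> p.-tuple R) ->
    (forall k, uniform_cube P (tau k)) ->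
    (forall k, uniform_cube P (taub k)) ->
    mutually_independent P
      (fun s : 'I_n + 'I_n =>
         (match s with inl k => tau k | inr k => taub k end)
         : T -> p.-tuple R) ->
    independent P
      (fun w => [tuple Xs j w | j < n.+1])
      (fun w => [tuple (tau k w, taub k w) | k < n]) ->
  forall theta : R, C2 * Num.max (ln p%:R) (ln n%:R) <= theta ->
  let Sigma := covmx P0 X in
  let r := effective_rank Sigma in
  ((1 - 4 * expR (- theta))%:E <=
   P [set w | (opnorm (Sigma_adap C1 (fun j => colv (Xs j w))
                        (fun k => colv (tau k w)) (fun k => colv (taub k w))
                      - Sigma)
              <= C * (ln p%:R * ln n%:R * opnorm Sigma *
                   (theta `^ (5 / 2) * Num.sqrt (r / n%:R) +
                    theta `^ (7 / 2) * (r / n%:R))))%R])%E].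
Proof.
(* The 8 makes [p] and [n] at most [exp (theta / 8)], as all the union bounds require, and gives
   [theta >= 4] because [ln 2 >= 1/2]. *)
exists (2 * (K + 1)), 8, (272 * 10 ^+ 4 * ((K + 1) ^+ 2) ^+ 3).
have K1 : 0 < K + 1 by rewrite addr_gt0.
split; [by rewrite mulr_gt0| by []| |].
  by apply: mulr_gt0; [apply: mulr_gt0; [by []|] |]; apply: exprn_gt0; [|exact: exprn_gt0].
move=> n p n1 p1 d0 T0 P0 X sX _ sgX d T P Xs tau taub law indX utau utaub indt ind
  theta hth; cbv zeta; set S := covmx P0 X; set r := effective_rank S.
have [hlp hln] : ln p%:R <= theta / 8 /\ ln n%:R <= theta / 8.
  split; rewrite ler_pdivlMr// mulrC; apply: le_trans hth; rewrite ler_wpM2l//;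
    by rewrite le_max lexx ?orbT.
have lp := half_le_ln_nat R p1; have ln_ := half_le_ln_nat R n1.
have th4 : 4 <= theta by move: lp hlp; clear; lra.
have nat_le (q : nat) : (1 < q)%N -> ln q%:R <= theta / 8 -> q%:R <= expR (theta / 8).
  by move=> q1 h; rewrite -[leLHS]lnK ?ler_expR// posrE ltr0n ltnW.
have hp := nat_le p p1 hlp; have hn := nat_le n n1 hln.
have Ssym i j : S j i = S i j by exact: covmx_sym.
have S0 z : 0 <= bform S z z by exact: covmx_ge0.
set b := 272 * 10 ^+ 4 * _ * _.
pose U w := [tuple Xs j w | j < n.+1].
pose V w := [tuple (tau k w, taub k w) | k < n].
have mU : measurable_fun setT U.
  apply/measurable_fun_tnthP => j.
  rewrite (_ : _ \o _ = Xs j); first exact: measurable_funP.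
  by apply/funext => w /=; rewrite tnth_mktuple.
have mV : measurable_fun setT V.
  apply/measurable_fun_tnthP => k.
  rewrite (_ : _ \o _ = (fun w => (tau k w, taub k w))).
    by apply: measurable_fun_pair; exact: measurable_funP.
  by apply/funext => w /=; rewrite tnth_mktuple.
pose D (x : (n.+1).-tuple (p.-tuple R)) (v : n.-tuple (p.-tuple R * p.-tuple R)) :=
  Sigma_adap (2 * (K + 1)) (fun j => colv (tnth x j))
    (fun k => colv (tnth v k).1) (fun k => colv (tnth v k).2) - S.
pose E := [set z : (n.+1).-tuple (p.-tuple R) * n.-tuple (p.-tuple R * p.-tuple R) |
  opnorm (D z.1 z.2) <= b].
have mE : measurable E.
  apply: measurable_opnorm_le => i j.
  apply: measurable_Sigma_adap_sub => k l.
  - exact: measurableT_comp (measurable_tnth l)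
      (measurableT_comp (measurable_tnth k) measurable_fst).
  - exact: measurableT_comp (measurable_tnth l) (measurableT_comp measurable_fst
      (measurableT_comp (measurable_tnth k) measurable_snd)).
  - exact: measurableT_comp (measurable_tnth l) (measurableT_comp measurable_snd
      (measurableT_comp (measurable_tnth k) measurable_snd)).
have DE x w : D x (V w) = Sigma_adap (2 * (K + 1)) (fun j => colv (tnth x j))
    (fun k => colv (tau k w)) (fun k => colv (taub k w)) - S.
  have -> : (fun k => colv (tau k w)) = (fun k => colv (tnth (V w) k).1).
    by apply/funext => k; rewrite tnth_mktuple.
  have -> : (fun k => colv (taub k w)) = (fun k => colv (tnth (V w) k).2).
    by apply/funext => k; rewrite tnth_mktuple.
  by [].
have -> : [set w | (opnorm (Sigma_adap (2 * (K + 1)) (fun j => colv (Xs j w))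
    (fun k => colv (tau k w)) (fun k => colv (taub k w)) - S) <= b)%R] =
    [set w | E (U w, V w)].
  apply/funext => w; rewrite /E [RHS]/= DE.
  have -> : (fun j => colv (tnth (U w) j)) = (fun j => colv (Xs j w)).
    by apply/funext => j; rewrite tnth_mktuple.
  by [].
have e0 := expR_ge0 (- theta).
have mEx x : measurable [set w | E (x, V w)].
  rewrite -[X in measurable X]setTI.
  apply: (@measurable_fun_pair _ _ _ _ _ _ (fun=> x) V) => //.
suff [m [m0 H]] : exists m, (0 < m)%N /\ forall x, good_sample m K theta S (tnth x) ->
    ((1 - 3 * expR (- theta))%:E <= P [set w | E (x, V w)])%E.
  have [mG PG] := good_sample_prob hK sX sgX law indX n1 p1 m0 th4 hp hn.
  rewrite (_ : 4 * _ = expR (- theta) + 3 * expR (- theta)); last by ring.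
  by apply: (independent_section_bound mU mV ind mG mE) => //; rewrite mulr_ge0.
(* If the covariance vanishes, the effective rank is a quotient by zero. The first clause of
   [good_sample] then makes the sample zero, and both sides of the bound are 0. *)
have [s0|sn] := eqVneq (opnorm S) 0.
  have SE := opnorm_eq0 s0.
  exists 1; split=> // x [g1 _ _ _].
  have x0 j : colv (tnth x j) = 0.
    apply/matrixP => i k; rewrite !mxE; apply/eqP; rewrite -sqrf_eq0.
    apply/eqP/le_anti; rewrite sqr_ge0 andbT.
    by apply: le_trans (g1 j i) _; rewrite SE mxE !mulr0.
  rewrite (_ : [set w | _] = setT).
    by rewrite probability_setT lee_fin gerBl mulr_ge0.
  apply/seteqP; split=> // w _; rewrite /E /= DE Sigma_adap_sample0// SE subr0 opnorm0.
  by rewrite /b s0 mulr0 mul0r mulr0.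
have s0 : 0 < opnorm S by rewrite lt_def sn opnorm_ge0.
have r1 : 1 <= r by rewrite ler_pdivlMr// mul1r; exact: opnorm_le_trace.
have r0 : 0 <= r by apply: le_trans r1.
have /andP[h1 h2] := truncn_itv r0.
(* Here [r < m <= 2 r]: the lower bound controls the trace by [m] times the norm, the upper one uses
   [r >= 1] and keeps the rate in terms of [r]. *)
exists (Num.truncn r).+1; split=> // x gs.
have trS : \tr S <= (Num.truncn r).+1%:R * opnorm S by rewrite -ler_pdivrMr// ltW.
have [A [mA PA AE]] := onebit_section hK n1 p1 (ltn0Sn _) th4 hp hn Ssym S0 s0 trS gs
  utau utaub indt.
apply: le_trans PA _.
apply: le_measure; [by rewrite inE | by rewrite inE; exact: mEx |].
move=> w /AE h; change (is_true (opnorm (D x (V w)) <= b)); rewrite DE; apply: le_trans h _.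
apply: error_rate_le; [| exact: ln_ | exact: lp | exact: ltW | | exact: r0 |].
- by apply: exprn_ge0; exact: sqr_ge0.
- by apply: le_trans th4; rewrite ler1n.
- apply: effective_rate_le => //; first exact: ltnW.
  by rewrite -natr1 mulrDl mul1r lerD.
Qed.
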